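(* Let $f\colon\mathbb N\to\mathbb U$ be a multiplicative function that satisfies $f\sim n^{it}\cdot\chi$ for some $t\in\mathbb R$ and some primitive Dirichlet character $\chi$ with conductor $q$, and let $(X,\mu,T)$ be a Furstenberg system of $f$ for Cesàro or logarithmic averages. Then for every prime $p$ the following properties are equivalent: (i) $1/p\in\mathrm{Spec}(X,\mu,T)$. (ii) Either $p\mid q$ or $f(p^s)\neq p^{ist}\cdot\chi(p^s)$ for some $s\in\mathbb N$.
   Context: $\mathbb N=\{1,2,\ldots\}$, $\mathbb P$ is the set of primes, $\mathbb U$ is the closed complex unit disc, $e(t)=e^{2\pi i t}$, $[N]=\{1,\ldots,N\}$. A function $f\colon\mathbb N\to\mathbb U$ is multiplicative if $f(mn)=f(m)f(n)$ whenever $(m,n)=1$. For multiplicative $f,g\colon\mathbb N\to\mathbb U$ let $\mathbb D^2(f,g)=\sum_{p\in\mathbb P}\frac1p\big(1-\mathrm{Re}(f(p)\overline{g(p)})\big)$ and write $f\sim g$ if $\mathbb D(f,g)<+\infty$. The constant $\chi=1$ is regarded as a primitive Dirichlet character with conductor $q=1$. For a finite non-empty $A\subset\mathbb N$, $\mathbb E_{n\in A}a(n)=\frac1{|A|}\sum_{n\in A}a(n)$ (Cesàro average) and $\mathbb E^{\log}_{n\in A}a(n)=\big(\sum_{n\in A}\frac1n\big)^{-1}\sum_{n\in A}\frac{a(n)}n$ (logarithmic average); these also act on measures. Let $X=\mathbb U^{\mathbb Z}$ with the product topology and let $T\colon X\to X$ be the shift $(Tx)(k)=x(k+1)$. A sequence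 $a\colon\mathbb N\to\mathbb U$ is extended to $\mathbb Z$ arbitrarily (the extension does not matter) and viewed as a point of $X$. If $(N_k)$ is a strictly increasing sequence of positive integers and the weak-star limit $\mu=\lim_{k\to\infty}\mathbb E_{n\in[N_k]}\delta_{T^na}$ exists, then $(X,\mu,T)$ is called the Furstenberg system of $a$ along $(N_k)$ for Cesàro averages. With $\mathbb E^{\log}$ in place of $\mathbb E$ one gets the Furstenberg system of $a$ along $(N_k)$ for logarithmic averages. A Furstenberg system of $a$ is one obtained along some $(N_k)$. The spectrum $\mathrm{Spec}(X,\mu,T)$ is the set of $\alpha\in[0,1)$ for which there is a non-zero $g\in L^2(\mu)$ with $g\circ T=e(\alpha)\,g$. *)

(* Defs.v *)
From HB Require Import structures.
From mathcomp Require Import all_boot all_order all_algebra.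
From mathcomp Require Import all_classical all_reals all_analysis.
From mathcomp Require Import complex.

Set Implicit Arguments.
Unset Strict Implicit.
Unset Printing Implicit Defensive.

Import Order.TTheory GRing.Theory Num.Theory.
Import numFieldNormedType.Exports.

Local Open Scope classical_set_scope.
Local Open Scope ring_scope.
Local Open Scope complex_scope.

(* Sequences indexed by {1, 2, ...} are functions on nat whose value at 0 is
   never used. Dirichlet characters are periodic functions on all of nat. *)

(* [R[i]^o] carries the topology of the complex norm; [set_type] then gives
   the closed disc the subspace topology. *)
Definition disc (R : realType) : Type :=
  set_type [set z : R[i]^o | `|z| <= 1].

HB.instance Definition _ (R : realType) := Uniform.on (disc R).

Coercion disc_val (R : realType) (z : disc R) : R[i] := set_val z.

Lemma disc0_subproof (R : realType) :
  (0 : R[i]^o) \in [set z : R[i]^o | `|z| <= 1].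
Proof. by rewrite inE /= normr0 ler01. Qed.

HB.instance Definition _ (R : realType) :=
  isPointed.Build (disc R) (SigSub (disc0_subproof R)).

(* [{ptws _ -> _}] is the product topology. *)
Definition shift_space (R : realType) : Type := {ptws int -> disc R}.

HB.instance Definition _ (R : realType) := Uniform.on (shift_space R).
HB.instance Definition _ (R : realType) := Pointed.on (shift_space R).

Definition borel (R : realType) : Type :=
  g_sigma_algebraType (@open (shift_space R)).

HB.instance Definition _ (R : realType) := Measurable.on (borel R).

Definition left_shift (R : realType) (x : shift_space R) : shift_space R :=
  fun k => x (k + 1).

(* e(t) = exp(2 pi i t) *)
Definition cis2pi (R : realType) (t : R) : R[i] :=
  cos (2 * pi * t) +i* sin (2 * pi * t).

(* n^(i t) = exp(i t log n), for n > 0 *)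
Definition npow_it (R : realType) (n : nat) (t : R) : R[i] :=
  cos (t * ln n%:R) +i* sin (t * ln n%:R).

Definition multiplicative_fun (R : realType) (f : nat -> R[i]) : Prop :=
  forall m n : nat, (0 < m)%N -> (0 < n)%N -> coprime m n ->
    f (m * n)%N = f m * f n.

Definition dirichlet_character (R : realType) (q : nat) (chi : nat -> R[i]) :
  Prop :=
  [/\ (0 < q)%N,
      forall n, chi (n + q)%N = chi n,
      forall m n, chi (m * n)%N = chi m * chi n &
      forall n, chi n != 0 <-> coprime n q].

(* A character mod q is primitive (has conductor q) when it is not induced by
   a character of a smaller modulus d dividing q. The constant 1 is a
   primitive character mod 1. *)
Definition primitive_character (R : realType) (q : nat) (chi : nat -> R[i]) :
  Prop :=
  dirichlet_character q chi /\
  forall (d : nat) (psi : nat -> R[i]),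
    (d %| q)%N -> (d < q)%N -> dirichlet_character d psi ->
    ~ (forall n, coprime n q -> chi n = psi n).

(* The square of the distance D(f, g); the terms are nonnegative when f and g
   are bounded by 1. *)
Definition sq_distance (R : realType) (f g : nat -> R[i]) : \bar R :=
  (\sum_(0 <= p <oo | prime p)
     (p%:R^-1 * (1 - complex.Re (f p * conjc (g p))))%:E)%E.

Definition pretends (R : realType) (f g : nat -> R[i]) : Prop :=
  (sq_distance f g < +oo)%E.

Inductive averaging := Cesaro | Logarithmic.

Definition weight (R : realType) (av : averaging) (n : nat) : {nonneg R} :=
  if av is Cesaro then 1%:nng else (n%:R^-1)%:nng.

Definition total_weight (R : realType) (av : averaging) (N : nat) : R :=
  \sum_(1 <= n < N.+1) (weight R av n)%:num.

Lemma total_weightV_ge0 (R : realType) (av : averaging) (N : nat) :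
  0 <= (total_weight R av N)^-1.
Proof. by rewrite invr_ge0; apply: sumr_ge0. Qed.

(* E_(n in [N]) m_n, or its logarithmic version; the index n of [msum] stands
   for the integer n + 1. *)
Definition average_measure (R : realType) (av : averaging) (N : nat)
    (m : nat -> {measure set (borel R) -> \bar R}) :
    {measure set (borel R) -> \bar R} :=
  mscale (NngNum (total_weightV_ge0 R av N))
    (msum (fun n => mscale (weight R av n.+1) (m n.+1)) N).

Definition weak_star_limit (R : realType)
    (m : nat -> {measure set (borel R) -> \bar R})
    (mu : {measure set (borel R) -> \bar R}) : Prop :=
  forall F : shift_space R -> R, continuous F ->
    (fun k => \int[m k]_x F x)%R @ \oo --> (\int[mu]_x F x)%R.

Definition furstenberg_system_along (R : realType) (av : averaging)
    (a : nat -> disc R) (N : nat -> nat) (mu : probability (borel R) R) :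
    Prop :=
  exists2 x : shift_space R,
    forall n : nat, (0 < n)%N -> x n%:Z = a n &
    weak_star_limit
      (fun k => average_measure av (N k)
         (fun n => dirac (iter n (@left_shift R) x : borel R)))
      mu.

Definition furstenberg_system (R : realType) (av : averaging)
    (a : nat -> disc R) (mu : probability (borel R) R) : Prop :=
  exists N : nat -> nat,
    [/\ forall k, (0 < N k)%N,
        forall j k, (j < k)%N -> (N j < N k)%N &
        furstenberg_system_along av a N mu].

(* Measurability is that of the real and imaginary parts. *)
Definition square_integrable (R : realType) (mu : probability (borel R) R)
    (g : borel R -> R[i]) : Prop :=
  [/\ measurable_fun setT (fun x => complex.Re (g x)),
      measurable_fun setT (fun x => complex.Im (g x)) &
      (\int[mu]_x ((ComplexField.Normc.normc (g x)) ^+ 2)%:E < +oo)%E].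

Definition spectrum (R : realType) (mu : probability (borel R) R) : set R :=
  [set alpha | 0 <= alpha < 1 /\
     exists g : borel R -> R[i],
       [/\ square_integrable mu g,
           ~ {ae mu, forall x, g x = 0} &
           {ae mu, forall x, g (left_shift x) = cis2pi alpha * g x}]].

(* Main.v *)
Require Import Defs.
From HB Require Import structures.
From mathcomp Require Import all_boot all_order all_algebra cyclic.
From mathcomp Require Import all_classical all_reals all_analysis.
From mathcomp Require Import measurable_realfun complex lra ring zify.

(** Let h(n) = f(n) conj(chi(n) n^(it)); the sum of (1 - Re h(l)) / l over the primes l
    converges.

    Both implications rest on [phase_concentration]: if W is divisible by all the primes
    up to a large K, except possibly some at whose powers h is 1, then for r prime to W the values h(r + W m) are close in mean to
    e^(i theta(m)), where theta varies slowly and does not depend on r. Each prime divisor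
    l of n contributes to h(n) a factor close to e^(i Im h(l)), up to a multiple of
    1 - Re h(l), and the sum of these arguments stays near its mean by the
    Turan-Kubilius inequality. All error terms are bounds on limsups of Cesaro means, and
    such bounds pass to logarithmic means, hence to integrals of continuous functions
    against mu.

    (i) implies (ii). Suppose that p does not divide q and that h(p^s) = 1 for all s. Then
    W can be chosen prime to p, and a high power Q of W, with Q = 1 mod p, is an almost
    period of f: f(n + Q) is close to f(n) in mean ([almost_period]). Hence T^Q moves the
    coordinate 0 little in mean, and then also every bounded measurable function, since
    these are approximated by functions of finitely many coordinates. But
    g o T^Q = e(1/p) g for an eigenfunction g for e(1/p), so that g = 0
    ([near_periods_no_eigenvalue]).

    (ii) implies (i). There are two residue classes modulo some p^b Q, with offsets that
    differ by a multiple k Q of Q, on which f follows the same slowly varying function up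
    to two distinct constant factors ([separates_at_prime_power],
    [separates_at_conductor]). Consequently long averages of the coordinate 0 over the
    powers of T^(p^b Q) are not nearly fixed by T^(kQ). By the mean ergodic theorem these
    averages converge to functions fixed by T^(p^b Q). If 1/p were not in the spectrum,
    every bounded function fixed by T^(pV) would be fixed by T^V, for every V > 0
    ([period_drop]); applied b times, this makes the limits fixed by T^Q, a
    contradiction. *)

Import Order.TTheory GRing.Theory Num.Theory.
Import numFieldNormedType.Exports.

Set Implicit Arguments.
Unset Strict Implicit.
Unset Printing Implicit Defensive.

Local Open Scope classical_set_scope.
Local Open Scope ring_scope.

Local Notation normc := ComplexField.Normc.normc.
Local Notation normcM := ComplexField.Normc.normcM.
Local Notation normc0 := ComplexField.Normc.normc0.
Local Notation normc1 := ComplexField.Normc.normc1.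
Local Notation eq0_normc := ComplexField.Normc.eq0_normc.

Lemma ler_eq (R : realType) (x y : R) : x = y -> x <= y.
Proof. by move=> ->. Qed.

(** * Complex numbers *)

Section ComplexNumbers.
Variable R : realType.
Implicit Types (z w : R[i]).

Lemma normc_def2 (z : R[i]) :
  `|z| = (normc z)%:C%C.
Proof. by case: z. Qed.

Lemma ler_Re_normc (z : R[i]) : `|complex.Re z| <= normc z.
Proof. by have := normc_ge_Re z; rewrite normc_def2 lecR. Qed.

Lemma ler_Im_normc (z : R[i]) : `|complex.Im z| <= normc z.
Proof.
case: z => a b /=; rewrite -sqrtr_sqr ler_wsqrtr // lerDr sqr_ge0 //.
Qed.

Lemma ler_normc_ReIm (z : R[i]) :
  normc z <= `|complex.Re z| + `|complex.Im z|.
Proof.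
case: z => a b /=.
rewrite -[leRHS]ger0_norm ?addr_ge0 // -sqrtr_sqr ler_wsqrtr // sqrrD !real_normK ?num_real //.
by rewrite addrAC lerDl mulrn_wge0 // mulr_ge0.
Qed.

Lemma ReB (z w : R[i]) : complex.Re (z - w) = complex.Re z - complex.Re w.
Proof. by case: z w => [? ?] [? ?]. Qed.

Lemma ImB (z w : R[i]) : complex.Im (z - w) = complex.Im z - complex.Im w.
Proof. by case: z w => [? ?] [? ?]. Qed.

Lemma Re_lipschitz z w : `|complex.Re z - complex.Re w| <= normc (z - w).
Proof. by rewrite -ReB; exact: ler_Re_normc. Qed.

Lemma Im_lipschitz z w : `|complex.Im z - complex.Im w| <= normc (z - w).
Proof. by rewrite -ImB; exact: ler_Im_normc. Qed.

Lemma complexReM z w :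
  complex.Re (z * w) = complex.Re z * complex.Re w - complex.Im z * complex.Im w.
Proof. by case: z w => [? ?] [? ?]. Qed.

Lemma complexImM z w :
  complex.Im (z * w) = complex.Re z * complex.Im w + complex.Im z * complex.Re w.
Proof. by case: z w => [? ?] [? ?]. Qed.

Lemma normc_sqr (z : R[i]) : normc z ^+ 2 = complex.Re z ^+ 2 + complex.Im z ^+ 2.
Proof. by case: z => a b /=; rewrite sqr_sqrtr // addr_ge0 ?sqr_ge0. Qed.

Lemma normcB z w : normc (z - w) = normc (w - z).
Proof. by rewrite -opprB normcN. Qed.

Lemma normcD z w : normc (z + w) <= normc z + normc w.
Proof. exact: le_normcD. Qed.

Lemma normc_ge0 z : 0 <= normc z.
Proof. by case: z => a b; exact: sqrtr_ge0. Qed.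

Lemma normc_conj z : normc (conjc z) = normc z.
Proof. by case: z => a b /=; rewrite sqrrN. Qed.

Lemma normc_dist z w v : normc (z - w) <= normc (z - v) + normc (v - w).
Proof. by rewrite -[z - w](subrKA v) normcD. Qed.

Lemma normc_real (c : R) : 0 <= c -> normc c%:C%C = c.
Proof. by move=> c0; rewrite /= expr0n addr0 sqrtr_sqr ger0_norm. Qed.

Lemma normc_sum I (r : seq I) (F : I -> R[i]) :
  normc (\sum_(i <- r) F i) <= \sum_(i <- r) normc (F i).
Proof.
elim: r => [|i r IH]; first by rewrite !big_nil normc0.
by rewrite !big_cons; apply: le_trans (normcD _ _) _; rewrite lerD2l.
Qed.

End ComplexNumbers.

(** * Upper bounds for the mean value of a sequence *)

Section UpperMean.
Variable R : realType.
Implicit Types (a b : nat -> R) (e : R).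

(** The limsup of the Cesaro means of a is at most e. The form with an additive
    constant is stable under summation by parts, so that it yields the same bound
    for logarithmic means. *)
Definition ubmean a e := forall eta : R, 0 < eta ->
  exists C : R, forall N, \sum_(n < N) a n <= (e + eta) * N%:R + C.

Lemma ub_le a b e : (forall n, a n <= b n) -> ubmean b e -> ubmean a e.
Proof.
move=> ab hb eta eta0; have [C hC] := hb eta eta0; exists C => N.
by apply: le_trans (hC N); apply: ler_sum.
Qed.

Lemma ub_weaken a e e' : e <= e' -> ubmean a e -> ubmean a e'.
Proof.
move=> ee' ha eta eta0; have [C hC] := ha eta eta0; exists C => N.
by apply: le_trans (hC N) _; rewrite lerD2r ler_wpM2r // lerD2r.
Qed.

Lemma ubD a b e e' : ubmean a e -> ubmean b e' -> ubmean (fun n => a n + b n) (e + e').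
Proof.
move=> ha hb eta eta0; have d0 : 0 < eta / 2 by rewrite divr_gt0.
have [C hC] := ha _ d0; have [C' hC'] := hb _ d0.
exists (C + C') => N; rewrite big_split /=; apply: le_trans (lerD (hC N) (hC' N)) _.
by apply: ler_eq; field.
Qed.

Lemma ubZ c a e : 0 <= c -> ubmean a e -> ubmean (fun n => c * a n) (c * e).
Proof.
move=> c0 ha eta eta0; have d0 : 0 < eta / (c + 1) by rewrite divr_gt0 // ltr_wpDl.
have [C hC] := ha _ d0; exists (c * C) => N.
rewrite -big_distrr /=; apply: le_trans (ler_wpM2l c0 (hC N)) _.
rewrite mulrDr lerD2r mulrA ler_wpM2r // mulrDr lerD2l mulrCA.
by rewrite -[leRHS]mulr1 ler_wpM2l ?(ltW eta0) // ler_pdivrMr ?ltr_wpDl // mul1r lerDl.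
Qed.

Lemma ub_cst c : ubmean (fun=> c) c.
Proof.
move=> eta eta0; exists 0 => N; rewrite sumr_const card_ord addr0 -[c *+ N]mulr_natr.
by rewrite ler_wpM2r // lerDl ltW.
Qed.

Lemma ub_sum (I : Type) (s : seq I) (a : I -> nat -> R) (e : I -> R) :
  (forall i, ubmean (a i) (e i)) ->
  ubmean (fun n => \sum_(i <- s) a i n) (\sum_(i <- s) e i).
Proof.
move=> ha; elim: s => [|i s IH].
  rewrite big_nil; under eq_fun do rewrite big_nil; exact: ub_cst.
rewrite big_cons; under eq_fun do rewrite big_cons; exact: (ubD (ha i) IH).
Qed.

Lemma ub_shift a e k : ubmean a e -> ubmean (fun n => a (n + k)%N) e.
Proof.
move=> ha eta eta0; have [C hC] := ha eta eta0.
exists (C + (e + eta) * k%:R - \sum_(n < k) a n) => N.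
have := hC (k + N)%N; rewrite big_split_ord /= natrD.
under [X in _ + X <= _]eq_bigr => i _ do rewrite addnC.
move: (\sum_(i < k) _) (\sum_(i < N) _) => s1 s2; lra.
Qed.

Lemma ub_null a : a n @[n --> \oo] --> (0 : R) -> ubmean a 0.
Proof.
move=> /cvgrPdist_le ha eta eta0; have [n0 _ hn0] := ha eta eta0.
exists (\sum_(n < n0) `|a n|) => N; rewrite add0r.
elim: N => [|N IH]; first by rewrite big_ord0 mulr0 add0r sumr_ge0.
rewrite big_ord_recr /=.
have [h|h] := leqP n0 N.
  have := hn0 N h; rewrite /= sub0r normrN => h1.
  have h2 := ler_norm (a N); rewrite -addn1 natrD mulrDr mulr1.
  move: IH h1 h2; move: (\sum_(i < n0) _) (\sum_(i < N) _) (`|a N|) => s1 s2 s3; lra.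
apply: (@le_trans _ _ (\sum_(n < N.+1) `|a n|)).
  by rewrite big_ord_recr /= lerD ?ler_norm // ler_sum // => i _; exact: ler_norm.
rewrite -[leLHS]add0r lerD ?mulr_ge0 ?(ltW eta0) //.
rewrite -(subnKC h) big_split_ord /= lerDl; exact: sumr_ge0.
Qed.

(** Summation by parts: the differences w n - w n.+1 are nonnegative and telescope,
    so that only the first weight is left. *)
Lemma abel_le (w b : nat -> R) (C : R) : (forall n, (0 < n)%N -> 0 <= w n) ->
  (forall n, (0 < n)%N -> w n.+1 <= w n) ->
  (forall N, \sum_(1 <= n < N.+1) b n <= C) ->
  forall N, \sum_(1 <= n < N.+1) w n * b n <= w 1%N * C.
Proof.
move=> w0 wd hC N.
have C0 : 0 <= C by have := hC 0%N; rewrite big_geq.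
case: N => [|N]; first by rewrite big_geq // mulr_ge0 ?w0.
have h : \sum_(1 <= n < N.+2) w n * b n <=
    w N.+1 * (\sum_(1 <= n < N.+2) b n) + (w 1%N - w N.+1) * C.
  elim: N => [|N IH]; first by rewrite !big_nat1 subrr mul0r addr0.
  rewrite big_nat_recr //= [in leRHS]big_nat_recr //=.
  have := wd N.+1 isT; have := hC N.+1.
  move: IH; move: (\sum_(1 <= n < N.+2) w n * b n) (\sum_(1 <= n < N.+2) b n) => s1 s2.
  move: (w N.+1) (w N.+2) (w 1%N) => v1 v2 v3.
  nra.
apply: le_trans h _; have := w0 N.+1 isT; have := hC N.+1.
by move: (\sum_(1 <= n < N.+2) b n) (w N.+1) => s v ? ?; nra.
Qed.

Variable av : averaging.
Local Notation w n := ((weight R av n)%:num).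
Local Notation tot := (total_weight R av).

Definition avg N a : R := (tot N)^-1 * \sum_(1 <= n < N.+1) w n * a n.

Lemma weight_ge0 n : 0 <= w n. Proof. by []. Qed.

Lemma weight1 : w 1%N = 1.
Proof. by rewrite /weight; case: av => //=; rewrite invr1. Qed.

Lemma weight_decr n : (0 < n)%N -> w n.+1 <= w n.
Proof.
move=> n0; rewrite /weight; case: av => //=.
by rewrite lef_pV2 ?posrE ?ltr0n // ler_nat.
Qed.

Lemma tot_unbounded (A : R) : exists N0, forall N, (N0 <= N)%N -> A <= tot N.
Proof.
suff [N0 h] : exists N0, A <= tot N0.
  exists N0 => N NN; apply: le_trans h _.
  by rewrite /total_weight (@big_cat_nat _ _ _ N0.+1 1 N.+1) //= lerDl sumr_ge0.
rewrite /total_weight /weight; case: av => /=.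
  exists (Num.truncn A).+1.
  rewrite [leRHS](_ : _ = (Num.truncn A).+1%:R); first exact: ltW (truncnS_gt A).
  by rewrite (eq_bigr (fun=> 1)) // big_const_nat subn1 /= iter_addr addr0 -natr1 addrC.
have := @dvg_harmonic R.
apply: contra_notP => hN.
have h N0 : ~ (A <= \sum_(1 <= n < N0.+1) n%:R^-1) by move=> ?; apply: hN; exists N0.
apply: nondecreasing_is_cvgn.
  apply/nondecreasing_seqP => n; rewrite /series /= big_nat_recr //= lerDl.
  by rewrite invr_ge0.
exists A => _ [n _ <-]; have /negP := h n; rewrite -ltNge => /ltW; apply: le_trans.
by rewrite /series /= big_add1 /=.
Qed.

Lemma tot_gt0 N : (0 < N)%N -> 0 < tot N.
Proof.
case: N => // N _; rewrite /total_weight big_ltn // weight1.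
by rewrite ltr_wpDr // sumr_ge0.
Qed.

Lemma avg_le N a b : (forall n, (0 < n)%N -> a n <= b n) -> avg N a <= avg N b.
Proof.
move=> ab; rewrite /avg ler_wpM2l ?total_weightV_ge0 //.
by rewrite !big_nat ler_sum // => n /andP[n0 _]; rewrite ler_wpM2l ?ab.
Qed.

Lemma avgD N a b : avg N (fun n => a n + b n) = avg N a + avg N b.
Proof.
rewrite /avg -mulrDr -big_split /=; congr (_ * _); apply: eq_bigr => n _.
by rewrite mulrDr.
Qed.

Lemma avg_cst N c : (0 < N)%N -> avg N (fun=> c) = c.
Proof.
move=> N0; rewrite /avg -big_distrl /= mulrA mulVf ?mul1r //.
by rewrite gt_eqF // tot_gt0.
Qed.

(** The partial sums of a - (e + eta / 2) are bounded above; weighting them by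
    summation by parts keeps them bounded while the total weight tends to infinity. *)
Lemma avg_ub a e : ubmean a e -> forall eta, 0 < eta ->
  exists N0, forall N, (N0 <= N)%N -> avg N a <= e + eta.
Proof.
move=> ha eta eta0; have d0 : 0 < eta / 2 by rewrite divr_gt0.
have [C hC] := ha _ d0.
pose C' := Num.max 0 (C + (e + eta / 2) - a 0%N).
have h N : \sum_(1 <= n < N.+1) (a n - (e + eta / 2)) <= C'.
  rewrite sumrB big_const_nat subn1 /= iter_addr addr0.
  have := hC N.+1; rewrite -(big_mkord xpredT a) big_ltn //= -[_ *+ N]mulr_natr.
  rewrite /C' -[N.+1%:R]natr1 le_max; move: (\sum_(1 <= i < _) a i) => s hs.
  by apply/orP; right; move: hs; lra.
have := @abel_le (fun n => w n) _ _ (fun n _ => weight_ge0 n) weight_decr h.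
rewrite weight1 mul1r => {}h.
have [N0 hN0] := tot_unbounded (C' / (eta / 2)).
exists N0.+1 => N NN; have N0' : (0 < N)%N by exact: leq_trans NN.
have t0 := tot_gt0 N0'.
rewrite /avg mulrC ler_pdivrMr // .
have := h N; under eq_bigr do rewrite mulrBr.
rewrite sumrB -big_distrl /= -/(tot N) => h1.
have := hN0 N (ltnW NN); rewrite ler_pdivrMr // => h2.
move: h1 h2; move: (\sum_(1 <= i < _) _) (tot N) => s t; lra.
Qed.

(** The weights have total variation at most 1, so that moving the sequence by one
    place changes its weighted sum by a bounded amount. *)
Lemma avg_shift_diff a B : (forall n, `|a n| <= B) -> forall N, (0 < N)%N ->
  `|avg N (fun n => a n.+1) - avg N a| <= 2 * B / tot N.
Proof.
move=> hB N N0; have B0 := le_trans (normr_ge0 _) (hB 0%N).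
rewrite /avg -mulrBr normrM ger0_norm ?total_weightV_ge0 // mulrC.
rewrite ler_wpM2r ?total_weightV_ge0 //.
rewrite -sumrB; under eq_bigr do rewrite -mulrBr.
case: N N0 => // N _.
have h : `|\sum_(1 <= n < N.+2) w n * (a n.+1 - a n) - w N.+1 * a N.+2| <= B * (2 - w N.+1).
  elim: N => [|N IH].
    rewrite big_nat1 weight1 !mul1r addrC addrA addNr add0r normrN; apply: le_trans (hB _) _; lra.
  rewrite big_nat_recr //=.
  rewrite (_ : _ - _ = (\sum_(1 <= n < N.+2) w n * (a n.+1 - a n) - w N.+1 * a N.+2)
     + (w N.+1 - w N.+2) * a N.+2); last by ring.
  apply: le_trans (ler_normD _ _) _; apply: le_trans (lerD IH (lexx _)) _.
  have wd := @weight_decr N.+1 isT.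
  rewrite normrM ger0_norm ?subr_ge0 //.
  have := hB N.+2; have : 0 <= w N.+1 - w N.+2 by rewrite subr_ge0.
  by move: (w N.+1) (w N.+2) (`|a N.+2|) => v1 v2 v3; nra.
have h2 : `|w N.+1 * a N.+2| <= w N.+1 * B.
  by rewrite normrM ger0_norm // ler_wpM2l.
rewrite -[X in `|X|](subrK (w N.+1 * a N.+2)).
apply: le_trans (ler_normD _ _) _; apply: le_trans (lerD h h2) _.
by apply: ler_eq; ring.
Qed.

End UpperMean.

(** * Arithmetic progressions *)

Section Progressions.
Variable R : realType.

Definition inprog (r W n : nat) : bool := (r <= n)%N && (W %| n - r)%N.

Definition progcount (r W N : nat) : nat := ((N + W - 1 - r) %/ W)%N.

Lemma progcountS r W N : (0 < W)%N ->
  progcount r W N.+1 = (progcount r W N + inprog r W N)%N.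
Proof.
move=> W0; rewrite /progcount /inprog; have [rN|Nr] := leqP r N; last first.
  by rewrite !divn_small //; lia.
have -> : (N.+1 + W - 1 - r = (N - r) + W)%N by lia.
have -> : (N + W - 1 - r = (N - r) + W.-1)%N by lia.
move: (N - r)%N => k /=; rewrite divnDr // divnn W0.
rewrite {2}(divn_eq k W) -addnA divnMDl // -addnA; congr addn.
rewrite /dvdn; have := ltn_pmod k W0; move: (k %% W)%N => j jW.
case: eqP => [->|/eqP j0] /=; first by rewrite add0n divn_small //; lia.
have -> : (j + W.-1 = (j.-1) + W)%N by lia.
by rewrite divnDr // divnn W0 divn_small //; lia.
Qed.

Lemma inprog_index r W N : (0 < W)%N -> inprog r W N ->
  progcount r W N = ((N - r) %/ W)%N.
Proof.
move=> W0 /andP[rN /dvdnP[k hk]]; rewrite /progcount hk mulnK //.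
have -> : (N + W - 1 - r = (N - r) + W.-1)%N by lia.
by rewrite hk divnMDl // divn_small ?addn0 //; lia.
Qed.

Lemma sum_prog r W (b : nat -> R) N : (0 < W)%N ->
  \sum_(n < N | inprog r W n) b ((n - r) %/ W)%N = \sum_(m < progcount r W N) b m.
Proof.
move=> W0; elim: N => [|N IH].
  by rewrite big_ord0 /progcount divn_small ?big_ord0 //; lia.
rewrite big_mkcond big_ord_recr /= -big_mkcond /= IH progcountS //.
case: ifP => h; last by rewrite addn0 addr0.
by rewrite addn1 big_ord_recr /= inprog_index.
Qed.

Lemma progcount_ub r W N : (0 < W)%N -> (progcount r W N)%:R <= N%:R / W%:R + 1 :> R.
Proof.
move=> W0; have W0' : 0 < W%:R :> R by rewrite ltr0n.
rewrite -(ler_pM2r W0') mulrDl mulfVK ?gt_eqF // mul1r -natrM -natrD ler_nat.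
have := leq_trunc_div (N + W - 1 - r) W; rewrite -/(progcount r W N); lia.
Qed.

Lemma progcount_lb r W N : (0 < W)%N -> (N%:R - r%:R) / W%:R <= (progcount r W N)%:R :> R.
Proof.
move=> W0; have W0' : 0 < W%:R :> R by rewrite ltr0n.
rewrite ler_pdivrMr // lerBlDr -natrM -natrD ler_nat.
have := ltn_ceil (N + W - 1 - r) W0; rewrite -/(progcount r W N) mulSn; lia.
Qed.

Definition spread (r W : nat) (b : nat -> R) (n : nat) : R :=
  if inprog r W n then b ((n - r) %/ W)%N else 0.

Lemma sum_spread r W (b : nat -> R) N : (0 < W)%N ->
  \sum_(n < N) spread r W b n = \sum_(m < progcount r W N) b m.
Proof. by move=> W0; rewrite /spread -big_mkcond sum_prog. Qed.

(** Comparing with the counting function of the progression, instead of its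
    asymptotic value N / W, lets such bounds be added over disjoint progressions. *)
Lemma ub_prog r W b e : (0 < W)%N -> ubmean b e -> forall eta, 0 < eta ->
  exists C, forall N, \sum_(n < N) spread r W b n <=
    (e + eta) * (\sum_(n < N) spread r W (fun=> 1) n) + C.
Proof.
move=> W0 hb eta eta0; have [C hC] := hb eta eta0; exists C => N.
rewrite !sum_spread //; apply: le_trans (hC _) _.
by rewrite lerD2r sumr_const card_ord.
Qed.

Lemma ub_spread r W b e : (0 < W)%N -> 0 <= e -> ubmean b e ->
  ubmean (spread r W b) (e / W%:R).
Proof.
move=> W0 e0 hb eta eta0; have W0' : 0 < W%:R :> R by rewrite ltr0n.
have d0 : 0 < eta * W%:R by rewrite mulr_gt0.
have [C hC] := hb _ d0.
exists (C + (e + eta * W%:R)) => N.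
rewrite sum_spread //; apply: le_trans (hC _) _.
have h : 0 <= e + eta * W%:R by rewrite addr_ge0 // ltW.
have := ler_wpM2l h (progcount_ub r N W0).
have -> : (e / W%:R + eta) * N%:R = (e + eta * W%:R) * (N%:R / W%:R).
  by field; rewrite gt_eqF.
rewrite mulrDr mulr1; move: (_ * (progcount _ _ _)%:R) => s hs; lra.
Qed.

Lemma ub_spread_compl r W : (0 < W)%N ->
  ubmean (fun n => W%:R^-1 - spread r W (fun=> 1) n) 0.
Proof.
move=> W0 eta eta0; have W0' : 0 < W%:R :> R by rewrite ltr0n.
exists (r%:R / W%:R) => N.
rewrite sumrB sum_spread // !sumr_const !card_ord -[_^-1 *+ N]mulr_natl.
have := progcount_lb r N W0; rewrite mulrBl add0r.
have : 0 <= eta * N%:R by rewrite mulr_ge0 // ltW.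
lra.
Qed.

(** Bezout gives one solution m0 of d | r + W m, and the others differ from it by
    multiples of d. *)
Lemma dvd_prog (d r W : nat) : coprime d W -> (0 < d)%N ->
  exists2 m0, (m0 < d)%N & forall m, (d %| r + W * m)%N = inprog m0 d m.
Proof.
move=> cdW d0.
have [a _] := Bezoutl W d0; rewrite (eqP cdW) => ha.
pose m0 := ((a * r) %% d)%N; have m0d : (m0 < d)%N by rewrite ltn_pmod.
have h0 : (d %| r + W * m0)%N.
  have : (d %| r + W * (a * r))%N.
    have -> : (r + W * (a * r) = (1 + a * W) * r)%N by ring.
    exact: dvdn_mulr.
  rewrite {1}(divn_eq (a * r) d) mulnDr addnCA dvdn_addr //.
  by rewrite mulnA dvdn_mull.
exists m0 => // m; rewrite /inprog; have [h|h] := leqP m0 m; last first.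
  apply/negP => hd; have : (d %| W * (m0 - m))%N.
    have := h0; rewrite -{1}(subnKC (ltnW h)) mulnDr addnA dvdn_addr //.
  rewrite Gauss_dvdr // => /dvdn_leq; lia.
by rewrite -{1}(subnKC h) mulnDr addnA dvdn_addr // Gauss_dvdr.
Qed.

Definition dvdind (d n : nat) : R := (d %| n)%:R.

Lemma count_dvd (d r W M : nat) : coprime d W -> (0 < d)%N ->
  `|\sum_(m < M) dvdind d (r + W * m) - M%:R / d%:R| <= 1.
Proof.
move=> cdW d0; have [m0 m0d hm0] := dvd_prog r cdW d0.
have d0' : 0 < d%:R :> R by rewrite ltr0n.
have -> : \sum_(m < M) dvdind d (r + W * m) = (progcount m0 d M)%:R.
  transitivity (\sum_(m < M) spread m0 d (fun=> 1) m).
    by apply: eq_bigr => m _; rewrite /dvdind /spread hm0; case: ifP.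
  by rewrite sum_spread // sumr_const card_ord.
rewrite ler_norml; apply/andP; split; last by rewrite lerBlDl progcount_ub.
rewrite lerBrDl; apply: le_trans (progcount_lb m0 M d0); rewrite mulrBl lerD2l lerN2.
by rewrite ler_pdivrMr // mul1r ler_nat ltnW.
Qed.

End Progressions.

(** * Prime divisors along a progression *)

Section Sieve.
Variable R : realType.
Implicit Types (A : pred nat) (c y : nat -> R).

Lemma ub_eventually (a b : nat -> R) e n0 : (forall n, (n0 <= n)%N -> a n <= b n) ->
  ubmean b e -> ubmean a e.
Proof.
move=> ab hb eta eta0; have [C hC] := hb eta eta0.
exists (C + \sum_(n < n0) `|a n - b n|) => N.
apply: (@le_trans _ _ (\sum_(n < N) b n + \sum_(n < n0) `|a n - b n|)); last first.
  by rewrite addrA lerD2r.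
rewrite -lerBlDl -sumrB.
have [h|h] := leqP N n0.
  rewrite -(subnKC h) big_split_ord /=; apply: le_trans (_ : _ <= \sum_(i < N) `|a i - b i|) _.
    by apply: ler_sum => i _; exact: ler_norm.
  by rewrite lerDl sumr_ge0.
rewrite -(subnKC (ltnW h)) big_split_ord /= -[leRHS]addr0 lerD //.
  by apply: ler_sum => i _; exact: ler_norm.
by apply: sumr_le0 => i _; rewrite subr_le0 ab // leq_addr.
Qed.

Lemma sum_range (F : nat -> R) a b : (forall l, (a <= l)%N -> F l = 0) ->
  (forall l, (b <= l)%N -> F l = 0) -> \sum_(0 <= l < a) F l = \sum_(0 <= l < b) F l.
Proof.
wlog ab : a b / (a <= b)%N => [hw ha hb|ha hb].
  by have [h|h] := leqP a b; [exact: hw | apply/esym/hw => //; exact: ltnW].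
rewrite [RHS](@big_cat_nat _ _ _ a) //= [X in _ = _ + X]big1_seq ?addr0 //.
by move=> l /andP[_]; rewrite mem_index_iota => /andP[/ha].
Qed.

Lemma sum_indic A (P : pred nat) (F : nat -> R) a b :
  (forall l, A l -> P l -> (l < a)%N && (l < b)%N) ->
  \sum_(0 <= l < a | A l && P l) F l = \sum_(0 <= l < b | A l) (P l)%:R * F l.
Proof.
move=> h; rewrite big_mkcond [RHS]big_mkcond /=.
pose G l := if A l && P l then F l else 0.
transitivity (\sum_(0 <= l < b) G l).
  apply: sum_range => l hl; rewrite /G; case: ifP => // /andP[Al Pl]; have := h l Al Pl; lia.
by apply: eq_bigr => l _; rewrite /G; case: (A l) => //=; case: (P l); rewrite ?mul1r ?mul0r.
Qed.

Definition summable_on A c (e : R) :=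
  forall B, \sum_(0 <= l < B | A l) c l / l%:R <= e.

Lemma tail_small A c e : (forall l, 0 <= c l) -> summable_on A c e ->
  forall eta, 0 < eta -> exists K, forall B, \sum_(K <= l < B | A l) c l / l%:R <= eta.
Proof.
move=> c0 hs eta eta0.
have t0 l : 0 <= c l / l%:R by rewrite divr_ge0.
pose S := [set x | exists B, x = \sum_(0 <= l < B | A l) c l / l%:R].
have hS : has_sup S.
  split; first by exists (\sum_(0 <= l < 0 | A l) c l / l%:R); exists 0%N.
  by exists e => x [B ->].
have [x [K xK] hx] := sup_adherent eta0 hS.
exists K => B; have [BK|KB] := leqP B K; first by rewrite big_geq // ltW.
have hB : \sum_(0 <= l < B | A l) c l / l%:R <= sup S.
  by apply: (sup_upper_bound hS); exists B.
move: hB; rewrite (@big_cat_nat _ _ _ K 0 B) //=; last exact: ltnW.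
by rewrite -xK; move: hx; move: (sup S) (\sum_(K <= l < B | _) _) => s1 s2; lra.
Qed.

(** Past a point K the sum of c l / l is below eta, and there c l <= x (c l / l) for
    l < x. *)
Lemma kronecker A c e : (forall l, 0 <= c l) -> (forall l, A l -> (0 < l)%N) ->
  summable_on A c e -> forall eta, 0 < eta ->
  exists2 C, 0 <= C & forall x, \sum_(0 <= l < x | A l) c l <= eta * x%:R + C.
Proof.
move=> c0 A0 hs eta eta0; have [K hK] := tail_small c0 hs eta0.
exists (\sum_(0 <= l < K | A l) c l); first exact: sumr_ge0.
move=> x; have [xK|Kx] := leqP x K.
  rewrite [X in _ <= _ + X](@big_cat_nat _ _ _ x) //= -[leLHS]add0r lerD //.
    by rewrite mulr_ge0 // ltW.
  by rewrite lerDl sumr_ge0.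
rewrite (@big_cat_nat _ _ _ K) //=; last exact: ltnW.
rewrite addrC lerD2r.
apply: (@le_trans _ _ (x%:R * \sum_(K <= l < x | A l) c l / l%:R)); last first.
  by rewrite [leRHS]mulrC ler_wpM2l.
rewrite big_distrr /= big_nat_cond [leRHS]big_nat_cond.
apply: ler_sum => l /andP[/andP[_ lx] Al].
have l0 : 0 < l%:R :> R by rewrite ltr0n A0.
by rewrite mulrCA ler_peMr // ler_pdivlMr // mul1r ler_nat ltnW.
Qed.

Definition dsum A c (n : nat) : R := \sum_(0 <= l < n.+1 | A l && (l %| n)%N) c l.

Lemma dsum_expand A c n B : (0 < n)%N -> (n < B)%N ->
  dsum A c n = \sum_(0 <= l < B | A l) c l * dvdind R l n.
Proof.
move=> n0 nB; rewrite /dsum (@sum_indic _ _ _ _ B).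
  by apply: eq_bigr => l _; rewrite mulrC.
by move=> l _ /(dvdn_leq n0) ln; rewrite ltnS ln (leq_ltn_trans ln nB).
Qed.

(** Exchange the summations: l divides about N / l of the first N terms, with an error
    at most 1, and the errors add up to o(N) by Kronecker's lemma. *)
Lemma ub_dsum A c e r W : (forall l, 0 <= c l) -> (forall l, A l -> prime l) ->
  (forall l, A l -> coprime l W) -> (0 < r)%N -> (0 < W)%N ->
  summable_on A c e -> ubmean (fun m => dsum A c (r + W * m)) e.
Proof.
move=> c0 Ap AW r0 W0 hs eta eta0.
have W0' : 0 < W%:R :> R by rewrite ltr0n.
have A0 l : A l -> (0 < l)%N by move/Ap/prime_gt0.
have d0 : 0 < eta / W%:R by rewrite divr_gt0.
have [C C0 hC] := kronecker c0 A0 hs d0.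
exists (C + eta / W%:R * (r.+1)%:R) => N.
pose B := (r + W * N).+1.
apply: (@le_trans _ _ (\sum_(0 <= l < B | A l) c l * (N%:R / l%:R + 1))).
  rewrite (eq_bigr (fun m : 'I_N => \sum_(0 <= l < B | A l) c l * dvdind R l (r + W * m))); last first.
    move=> m _; apply: dsum_expand; first by rewrite addn_gt0 r0.
    by rewrite ltnS leq_add2l leq_mul2l ltnW ?orbT.
  rewrite exchange_big /=; apply: ler_sum => l Al.
  rewrite -big_distrr /= ler_wpM2l //.
  have := count_dvd R r N (AW l Al) (A0 l Al); rewrite ler_norml => /andP[_].
  by rewrite lerBlDl.
have -> : \sum_(0 <= l < B | A l) c l * (N%:R / l%:R + 1) =
   N%:R * (\sum_(0 <= l < B | A l) c l / l%:R) + \sum_(0 <= l < B | A l) c l.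
  rewrite big_distrr -big_split /=; apply: eq_bigr => l _; ring.
have h1 := ler_wpM2l (ler0n R N) (hs B); have h2 := hC B.
apply: le_trans (lerD h1 h2) _.
rewrite /B -addSn natrD natrM mulrDr; apply: ler_eq.
by field; rewrite gt_eqF.
Qed.

Lemma isqrt_exists (N : nat) : exists s, (N <= s * s)%N /\ (s * s <= 2 * N + 2)%N.
Proof.
have hex : exists s, (N <= s * s)%N by exists N; case: N => // N; rewrite leq_pmulr.
exists (ex_minn hex); case: ex_minnP => s hs hmin; split=> //.
case: s hs hmin => // s hs hmin.
have : ~~ (N <= s * s)%N by apply/negP => /hmin; rewrite ltnn.
rewrite -ltnNge => h; nia.
Qed.

Lemma isqrt_small (eta : R) : 0 < eta -> exists2 C, 0 <= C & forall N s : nat,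
  (s * s <= 2 * N + 2)%N -> s%:R <= eta * N%:R + C.
Proof.
move=> eta0; (* s <= d s^2 + 1 / d, and s^2 is O(N) *)
pose d := eta / 2; have d0 : 0 < d by rewrite divr_gt0.
exists (eta + d^-1); first by rewrite addr_ge0 ?invr_ge0 ?ltW.
move=> N s hs.
have h1 : s%:R * s%:R <= 2 * N%:R + 2 :> R by rewrite -!natrM -natrD ler_nat.
have h2 : s%:R <= d * (s%:R * s%:R) + d^-1.
  rewrite -subr_ge0 -(pmulr_rge0 _ d0) mulrBr mulrDr divff ?gt_eqF //.
  by move: s%:R => x; nra.
apply: le_trans h2 _; rewrite addrA lerD2r.
apply: le_trans (ler_wpM2l (ltW d0) h1) _.
by apply: ler_eq; rewrite /d; field.
Qed.

Definition sqd A (n : nat) : R := \sum_(0 <= l < n.+1 | A l && (l * l %| n)%N) 1.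

Lemma sqd_expand A n B : (0 < n)%N -> (n < B * B)%N ->
  sqd A n = \sum_(0 <= l < B | A l) dvdind R (l * l) n.
Proof.
move=> n0 nB; rewrite /sqd (@sum_indic _ _ _ _ B).
  by apply: eq_bigr => l _; rewrite mulr1.
by move=> l _ /(dvdn_leq n0) ln; apply/andP; split; nia.
Qed.

(** Only the l with l^2 <= r + W N matter, so that the errors 1 in counting the
    multiples of l^2 add up to O(sqrt N). *)
Lemma ub_sqd A e r W : (forall l, A l -> prime l) ->
  (forall l, A l -> coprime l W) -> (0 < r)%N -> (0 < W)%N ->
  summable_on A (fun l => l%:R^-1) e -> ubmean (fun m => sqd A (r + W * m)) e.
Proof.
move=> Ap AW r0 W0 hs eta eta0.
have W0' : 0 < W%:R :> R by rewrite ltr0n.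
have A0 l : A l -> (0 < l)%N by move/Ap/prime_gt0.
have d0 : 0 < eta / W%:R by rewrite divr_gt0.
have [C C0 hC] := isqrt_small d0.
exists (C + eta / W%:R * (r.+1)%:R) => N.
pose B := (r + W * N).+1.
have [s [s1 s2]] := isqrt_exists B.
apply: (@le_trans _ _ (\sum_(0 <= l < s | A l) (N%:R / (l * l)%:R + 1))).
  rewrite (eq_bigr (fun m : 'I_N => \sum_(0 <= l < s | A l) dvdind R (l * l) (r + W * m))); last first.
    move=> m _; apply: sqd_expand; first by rewrite addn_gt0 r0.
    by apply: leq_trans s1; rewrite ltnS leq_add2l leq_mul2l ltnW ?orbT.
  rewrite exchange_big /=; apply: ler_sum => l Al.
  have l0 : (0 < l * l)%N by rewrite muln_gt0 A0.
  have lW : coprime (l * l) W by rewrite coprimeMl AW.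
  have := count_dvd R r N lW l0; rewrite ler_norml => /andP[_].
  by rewrite lerBlDl.
rewrite big_split /=; have h1 : \sum_(0 <= l < s | A l) N%:R / (l * l)%:R <= N%:R * e.
  apply: le_trans (ler_wpM2l (ler0n R N) (hs s)).
  rewrite big_distrr /=; apply: ler_sum => l _.
  by rewrite natrM invfM.
have h2 : \sum_(0 <= l < s | A l) (1 : R) <= s%:R.
  rewrite big_mkcond /=; apply: (@le_trans _ _ (\sum_(0 <= l < s) 1)).
    by apply: ler_sum => l _; case: ifP.
  by rewrite big_const_nat subn0 iter_addr addr0.
have h3 := hC _ _ s2.
apply: le_trans (lerD h1 (le_trans h2 h3)) _.
rewrite /B -addSn natrD natrM mulrDr; apply: ler_eq.
by field; rewrite gt_eqF.
Qed.

End Sieve.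

Section TuranKubilius.
Variable R : realType.
Implicit Types (A : pred nat) (c y : nat -> R).

(** The indicator of l | n, centred at its mean value. *)
Definition dlt (l n : nat) : R := dvdind R l n - l%:R^-1.

Section Correlation.
Variables (A : pred nat) (W r : nat).
Hypotheses (Ap : forall l, A l -> prime l) (AW : forall l, A l -> coprime l W).

(** Divisibility by two distinct primes is independent up to the rounding in three
    counts of multiples. *)
Lemma corr_bound l1 l2 N : A l1 -> A l2 -> l1 != l2 ->
  `|\sum_(m < N) dlt l1 (r + W * m) * dlt l2 (r + W * m)| <= 3.
Proof.
move=> A1 A2 l12.
have p1 := Ap A1; have p2 := Ap A2.
have c12 : coprime l1 l2 by rewrite prime_coprime // dvdn_prime2.
have l10 : (0 < l1)%N by exact: prime_gt0.
have l20 : (0 < l2)%N by exact: prime_gt0.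
have h1 := count_dvd R r N (AW A1) l10.
have h2 := count_dvd R r N (AW A2) l20.
have c12W : coprime (l1 * l2) W by rewrite coprimeMl !AW.
have h3 := count_dvd R r N c12W (_ : 0 < l1 * l2)%N.
rewrite muln_gt0 l10 l20 in h3; have {}h3 := h3 isT.
have -> : \sum_(m < N) dlt l1 (r + W * m) * dlt l2 (r + W * m) =
  (\sum_(m < N) dvdind R (l1 * l2) (r + W * m) - N%:R / (l1 * l2)%:R)
  - (\sum_(m < N) dvdind R l1 (r + W * m) - N%:R / l1%:R) / l2%:R
  - (\sum_(m < N) dvdind R l2 (r + W * m) - N%:R / l2%:R) / l1%:R.
  rewrite (eq_bigr (fun m : 'I_N => dvdind R (l1 * l2) (r + W * m)
     - dvdind R l1 (r + W * m) / l2%:R - dvdind R l2 (r + W * m) / l1%:R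
     + (l1%:R * l2%:R)^-1)); last first.
    move=> m _.
    have -> : dvdind R (l1 * l2) (r + W * m) =
        dvdind R l1 (r + W * m) * dvdind R l2 (r + W * m).
      by rewrite /dvdind Gauss_dvd //; do 2 case: (_ %| _)%N; rewrite ?mulr1 ?mulr0.
    by rewrite /dlt invfM; ring.
  rewrite big_split /= !sumrB -!big_distrl /= sumr_const card_ord -[_ *+ N]mulr_natl natrM.
  by field; rewrite !pnatr_eq0 -!lt0n l10 l20.
have i1 : l1%:R^-1 <= 1 :> R by rewrite invf_le1 ?ltr0n // ler1n.
have i2 : l2%:R^-1 <= 1 :> R by rewrite invf_le1 ?ltr0n // ler1n.
have j1 : 0 <= l1%:R^-1 :> R by rewrite invr_ge0.
have j2 : 0 <= l2%:R^-1 :> R by rewrite invr_ge0.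
apply: le_trans (ler_normB _ _) _; apply: le_trans (lerD (ler_normB _ _) (lexx _)) _.
rewrite !normrM (ger0_norm j1) (ger0_norm j2).
have k1 : `|\sum_(m < N) dvdind R l1 (r + W * m) - N%:R / l1%:R| / l2%:R <= 1.
  by rewrite -[leRHS]mulr1 ler_pM.
have k2 : `|\sum_(m < N) dvdind R l2 (r + W * m) - N%:R / l2%:R| / l1%:R <= 1.
  by rewrite -[leRHS]mulr1 ler_pM.
apply: le_trans (lerD (lerD h3 k1) k2) _; lra.
Qed.

Lemma corr_bound_from l1 l2 N K : A l1 -> A l2 -> l1 != l2 ->
  `|\sum_(m < N) (K <= m)%:R * (dlt l1 (r + W * m) * dlt l2 (r + W * m))| <= 6.
Proof.
move=> A1 A2 l12; have [h|h] := leqP N K.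
  rewrite big1 ?normr0 // => m _; rewrite leqNgt (leq_trans (ltn_ord m) h) /= mul0r //.
pose F m := dlt l1 (r + W * m) * dlt l2 (r + W * m).
have -> : \sum_(m < N) (K <= m)%:R * (dlt l1 (r + W * m) * dlt l2 (r + W * m)) =
    \sum_(m < N) F m - \sum_(m < K) F m.
  rewrite -(subnKC (ltnW h)) !big_split_ord /= [X in X + _]big1 ?add0r; last first.
    by move=> i _; rewrite leqNgt ltn_ord mul0r.
  by rewrite [RHS]addrC addKr; apply: eq_bigr => i _; rewrite leq_addr mul1r.
apply: le_trans (ler_normB _ _) _.
have := lerD (corr_bound N A1 A2 l12) (corr_bound K A1 A2 l12).
by move/le_trans; apply; lra.
Qed.

Lemma corr_diag l N K : A l ->
  \sum_(m < N) (K <= m)%:R * (dlt l (r + W * m) * dlt l (r + W * m)) <= 2 * (N%:R / l%:R) + 1.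
Proof.
move=> Al; have l0 := prime_gt0 (Ap Al).
have l0' : 0 < l%:R :> R by rewrite ltr0n.
have i1 : l%:R^-1 <= 1 :> R by rewrite invf_le1 ?ltr0n // ler1n.
have j1 : 0 <= l%:R^-1 :> R by rewrite invr_ge0.
apply: (@le_trans _ _ (\sum_(m < N) (dvdind R l (r + W * m) + l%:R^-1))).
  apply: ler_sum => m _.
  have h : dlt l (r + W * m) * dlt l (r + W * m) <= dvdind R l (r + W * m) + l%:R^-1.
    rewrite /dlt /dvdind; case: (_ %| _)%N => /=; move: i1 j1; move: (_^-1) => x *; nra.
  case: (_ <= _)%N; rewrite ?mul1r // mul0r addr_ge0 //.
rewrite big_split /= sumr_const card_ord -[_ *+ N]mulr_natl.
have := count_dvd R r N (AW Al) l0; rewrite ler_norml => /andP[_].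
by move: (\sum_(m < N) _) => x; lra.
Qed.
End Correlation.

(** Only the primes l with l^2 <= m are kept: up to m = N there are at most sqrt N of
    them, hence at most N pairs, and each pair of distinct primes has a bounded
    correlation. *)
Definition dev A y r W (m : nat) : R :=
  \sum_(0 <= l < m.+1 | A l && (l * l <= m)%N) y l * dlt l (r + W * m).

Lemma dev_expand A y r W m s : (m < s * s)%N ->
  dev A y r W m = \sum_(0 <= l < s | A l) (l * l <= m)%:R * (y l * dlt l (r + W * m)).
Proof. by move=> ms; apply: sum_indic => l _ h; apply/andP; split; nia. Qed.

(** The Turan-Kubilius inequality. The diagonal terms give 2 e N + V; the others add up
    to 6 s V, where s is of the order of sqrt N and V, the sum of y l ^+ 2 over l < s,
    is o(s). *)
Lemma ub_dev A y e r W : (forall l, A l -> prime l) -> (forall l, A l -> coprime l W) ->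
  0 <= e -> summable_on A (fun l => y l ^+ 2) e ->
  ubmean (fun m => dev A y r W m ^+ 2) (2 * e).
Proof.
move=> Ap AW e0 hs eta eta0.
have A0 l : A l -> (0 < l)%N by move/Ap/prime_gt0.
have v0 l : 0 <= y l ^+ 2 by exact: sqr_ge0.
have d0 : 0 < eta / 28 by rewrite divr_gt0.
have [C C0 hC] := kronecker v0 A0 hs d0.
have d1 : 0 < eta / (12 * (C + 1)) by rewrite divr_gt0 // mulr_gt0 // ltr_wpDl.
have [C2 C20 hC2] := isqrt_small d1.
exists (eta + C + 6 * C * C2) => N.
have [s [s1 s2]] := isqrt_exists N.
pose V := \sum_(0 <= l < s | A l) y l ^+ 2.
have step1 : \sum_(m < N) dev A y r W m ^+ 2 <=
    2 * N%:R * e + (1 + 6 * s%:R) * V.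
  pose G l1 l2 : R := (l1 == l2)%:R * (y l1 ^+ 2 * (2 * (N%:R / l1%:R) + 1))
     + 3 * (y l1 ^+ 2 + y l2 ^+ 2).
  apply: (@le_trans _ _ (\sum_(0 <= l1 < s | A l1) \sum_(0 <= l2 < s | A l2) G l1 l2)).
    rewrite (eq_bigr (fun m : 'I_N => \sum_(0 <= l1 < s | A l1) \sum_(0 <= l2 < s | A l2)
       (y l1 * y l2) * ((maxn (l1 * l1) (l2 * l2) <= m)%:R *
         (dlt l1 (r + W * m) * dlt l2 (r + W * m))))); last first.
      move=> m _; rewrite (@dev_expand _ _ _ _ _ s); last exact: leq_trans (ltn_ord m) s1.
      rewrite expr2 big_distrl /=; apply: eq_bigr => l1 _.
      rewrite big_distrr /=; apply: eq_bigr => l2 _.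
      by rewrite geq_max; do 2 case: (_ <= _)%N => /=; ring.
    rewrite exchange_big /=; apply: ler_sum => l1 A1.
    rewrite exchange_big /=; apply: ler_sum => l2 A2.
    rewrite -big_distrr /= /G; case: eqP => [<-|/eqP l12] /=.
      rewrite mul1r -expr2; apply: (@le_trans _ _ (y l1 ^+ 2 * (2 * (N%:R / l1%:R) + 1))).
        by rewrite ler_wpM2l //; exact: (corr_diag r Ap AW).
      by rewrite lerDl mulr_ge0 // addr_ge0.
    rewrite mul0r add0r; apply: le_trans (ler_norm _) _; rewrite normrM.
    have h := corr_bound_from r Ap AW N (maxn (l1 * l1) (l2 * l2)) A1 A2 l12.
    apply: le_trans (ler_wpM2l (normr_ge0 _) h) _.
    rewrite normrM -[y l1 ^+ 2]real_normK ?num_real // -[y l2 ^+ 2]real_normK ?num_real //.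
    have := sqr_ge0 (`|y l1| - `|y l2|).
    by move: `|y l1| `|y l2| => a b; lra.
  have cnt : \sum_(0 <= l < s | A l) (1 : R) <= s%:R.
    rewrite big_mkcond /=; apply: (@le_trans _ _ (\sum_(0 <= l < s) 1)).
      by apply: ler_sum => l _; case: ifP.
    by rewrite big_const_nat subn0 iter_addr addr0.
  have V0 : 0 <= V by exact: sumr_ge0.
  rewrite (eq_bigr (fun l1 =>
      (\sum_(0 <= l2 < s | A l2) (l1 == l2)%:R * (y l1 ^+ 2 * (2 * (N%:R / l1%:R) + 1)))
      + (3 * y l1 ^+ 2 * (\sum_(0 <= l2 < s | A l2) 1) + 3 * V))); last first.
    move=> l1 _; rewrite big_split /=; congr (_ + _).
    rewrite /V !big_distrr -big_split /=; apply: eq_bigr => l2 _; ring.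
  rewrite big_split /= big_split /= -big_distrl -big_distrr /= -/V.
  have -> : \sum_(0 <= i < s | A i) 3 * V = 3 * V * \sum_(0 <= i < s | A i) 1.
    by clearbody V; rewrite big_distrr /=; apply: eq_bigr => l _; rewrite mulr1.
  have diag : \sum_(0 <= l1 < s | A l1) \sum_(0 <= l2 < s | A l2)
      (l1 == l2)%:R * (y l1 ^+ 2 * (2 * (N%:R / l1%:R) + 1)) <= 2 * N%:R * e + V.
    apply: (@le_trans _ _ (\sum_(0 <= l1 < s | A l1) y l1 ^+ 2 * (2 * (N%:R / l1%:R) + 1))).
      apply: ler_sum => l1 _; rewrite -big_distrl /= -[leRHS]mul1r ler_wpM2r //.
        by rewrite mulr_ge0 // addr_ge0 // mulr_ge0 // divr_ge0.
      apply: (@le_trans _ _ (\sum_(0 <= l2 < s | l2 == l1) 1)).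
        rewrite big_mkcond [leRHS]big_mkcond /=; apply: ler_sum => l2 _.
        by rewrite eq_sym; case: (l2 == l1); case: (A l2).
      by rewrite big_nat1_eq; case: ifP.
    rewrite (eq_bigr (fun l1 => 2 * N%:R * (y l1 ^+ 2 / l1%:R) + y l1 ^+ 2)); last by move=> l _; ring.
    by rewrite big_split /= -big_distrr /= lerD2r ler_wpM2l // mulr_ge0.
  move: diag cnt; move: (\sum_(0 <= l1 < s | _) \sum_(0 <= l2 < s | _) _).
  move: (\sum_(0 <= l < s | _) 1) => z x h1 h2.
  have h3 := ler_wpM2l V0 h2.
  move: h1 h3; move: (s%:R) (N%:R * e) => S NE; rewrite -(mulrA 2); lra.
apply: le_trans step1 _.
have hV : V <= eta / 28 * s%:R + C := hC s.
have hs1 : s%:R * s%:R <= 2 * N%:R + 2 :> R by rewrite -!natrM -natrD ler_nat.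
have hs2 : s%:R <= s%:R * s%:R :> R by rewrite -natrM ler_nat; case: (s) => // k; rewrite leq_pmulr.
have hs3 := hC2 _ _ s2.
have s0 : 0 <= s%:R :> R by [].
have hV2 : (1 + 6 * s%:R) * V <= (1 + 6 * s%:R) * (eta / 28 * s%:R + C).
  by rewrite ler_wpM2l // addr_ge0 // mulr_ge0.
have h6 : 6 * C * s%:R <= 6 * C * (eta / (12 * (C + 1)) * N%:R + C2) by rewrite ler_wpM2l // mulr_ge0.
have h7 : 6 * C * (eta / (12 * (C + 1)) * N%:R) <= eta / 2 * N%:R.
  rewrite mulrA ler_wpM2r // -subr_ge0.
  have -> : eta / 2 - 6 * C * (eta / (12 * (C + 1))) = eta / (2 * (C + 1)).
    by field; rewrite gt_eqF // ltr_wpDl.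
  by rewrite divr_ge0 ?(ltW eta0) // mulr_ge0 // addr_ge0.
have e1 : eta * s%:R <= eta * (s%:R * s%:R) by rewrite ler_wpM2l // ltW.
have e2 : eta * (s%:R * s%:R) <= eta * (2 * N%:R + 2) by rewrite ler_wpM2l // ltW.
move: hV2 h6 h7 e1 e2; rewrite !mulrDr !mulrDl.
move: (6 * C * (eta / (12 * (C + 1)) * N%:R)) => q.
move: (s%:R) (N%:R) => S n *; lra.
Qed.

End TuranKubilius.

Section LargePrimes.
Variable R : realType.
Implicit Types (A : pred nat) (c y : nat -> R).

(** The part of a sum over the prime divisors of r + W m that [dev] leaves out. *)
Definition lpd A c r W (m : nat) : R :=
  \sum_(0 <= l < (r + W * m).+1 | [&& A l, (l %| r + W * m)%N & (m < l * l)%N]) c l.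

(** Three such primes would have a product above m^(3/2), while r + W m is O(m). *)
Lemma lpd_count A r W m : (forall l, A l -> prime l) -> (0 < r)%N ->
  ((r + W) * (r + W) <= m)%N -> lpd A (fun=> 1) r W m <= 2.
Proof.
move=> Ap r0 hm; rewrite /lpd big_const_seq iter_addr addr0.
set P := (fun l => _); set n := (r + W * m)%N.
rewrite (ler_nat R _ 2) -size_filter.
have : uniq [seq l <- index_iota 0 n.+1 | P l] by rewrite filter_uniq // iota_uniq.
have : forall l, l \in [seq l <- index_iota 0 n.+1 | P l] -> P l.
  by move=> l; rewrite mem_filter => /andP[].
case: [seq l <- index_iota 0 n.+1 | P l] => [|a [|b [|c s]]] //= hP.
rewrite !inE !negb_or -!andbA => /and5P[ab ac _ bc _]; exfalso.
have /and3P[Aa an ma] := hP a (mem_head _ _).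
have /and3P[Ab bn mb] : P b by apply: hP; rewrite !inE eqxx orbT.
have /and3P[Ac cn mc] : P c by apply: hP; rewrite !inE eqxx !orbT.
have cop x z : A x -> A z -> x != z -> coprime x z.
  by move=> Ax Az xz; rewrite prime_coprime ?Ap // dvdn_prime2 ?Ap.
have n0 : (0 < n)%N by rewrite addn_gt0 r0.
have : (a * b * c %| n)%N.
  rewrite Gauss_dvd ?Gauss_dvd ?an ?bn ?cn //; first exact: cop.
  by rewrite coprimeMl !cop.
move=> /(dvdn_leq n0) habc.
have m0 : (0 < m)%N by apply: leq_trans hm; rewrite muln_gt0 addn_gt0 r0.
have nm : (n <= (r + W) * m)%N by rewrite /n mulnDl leq_add2r leq_pmulr.
have h1 : (m * m * m < (a * a) * (b * b) * (c * c))%N.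
  have h12 : (m * m < (a * a) * (b * b))%N by exact: ltn_mul.
  exact: ltn_mul.
have h2 : ((a * a) * (b * b) * (c * c) <= ((r + W) * m) * ((r + W) * m))%N.
  have -> : ((a * a) * (b * b) * (c * c) = (a * b * c) * (a * b * c))%N by ring.
  by apply: leq_mul; exact: leq_trans habc nm.
have h3 : (((r + W) * m) * ((r + W) * m) <= m * m * m)%N.
  have -> : (((r + W) * m) * ((r + W) * m) = ((r + W) * (r + W)) * (m * m))%N by ring.
  by rewrite -[leqRHS]mulnA leq_mul2r hm orbT.
by have := leq_trans h1 (leq_trans h2 h3); rewrite ltnn.
Qed.

Lemma lpd_expand A c r W m B : (0 < r)%N -> (r + W * m < B)%N ->
  lpd A c r W m = \sum_(0 <= l < B | A l) c l * (dvdind R l (r + W * m) * (m < l * l)%:R).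
Proof.
move=> r0 nB; have n0 : (0 < r + W * m)%N by rewrite addn_gt0 r0.
rewrite /lpd (@sum_indic _ _ _ _ _ B).
  by apply: eq_bigr => l _; rewrite /dvdind -natrM mulnb mulrC.
by move=> l _ /andP[/(dvdn_leq n0) ln _]; rewrite ltnS ln (leq_ltn_trans ln nB).
Qed.

(** The primes below K only matter for boundedly many m; the others divide a small
    proportion of the terms, counted with the weight c. *)
Lemma ub_lpd_null A c e r W : (forall l, A l -> prime l) -> (forall l, A l -> coprime l W) ->
  (0 < r)%N -> (0 < W)%N -> (forall l, 0 <= c l) ->
  summable_on A c e -> ubmean (lpd A c r W) 0.
Proof.
move=> Ap AW r0 W0 c0 hs eta eta0.
have W0' : 0 < W%:R :> R by rewrite ltr0n.
have A0 l : A l -> (0 < l)%N by move/Ap/prime_gt0.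
have d0 : 0 < eta / 2 by rewrite divr_gt0.
have d1 : 0 < eta / 2 / W%:R by rewrite divr_gt0.
have [K hK] := tail_small c0 hs d0.
have [C C0 hC] := kronecker c0 A0 hs d1.
exists (\sum_(0 <= l < K | A l) c l * (l * l)%:R + (C + eta / 2 / W%:R * (r + W * K).+1%:R)) => N.
rewrite add0r.
pose B := (r + W * N + W * K).+1.
have KB : (K <= B)%N.
  by rewrite /B; apply: leq_trans (_ : W * K <= _)%N; rewrite ?leq_pmull // leqW // leq_addl.
rewrite (eq_bigr (fun m : 'I_N => \sum_(0 <= l < B | A l)
  c l * (dvdind R l (r + W * m) * (m < l * l)%:R))); last first.
  move=> m _; apply: lpd_expand => //.
  by rewrite ltnS; apply: leq_trans (leq_addr _ _); rewrite leq_add2l leq_mul2l ltnW ?orbT.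
rewrite exchange_big /= (@big_cat_nat _ _ _ K) //= [leRHS]addrCA lerD //.
  apply: ler_sum => l Al; rewrite -big_distrr /= ler_wpM2l //.
  apply: (@le_trans _ _ (\sum_(m < N) (m < l * l)%:R)).
    by apply: ler_sum => m _; rewrite /dvdind; case: (_ %| _)%N; rewrite ?mul1r // mul0r.
  rewrite -natr_sum ler_nat -(big_mkord xpredT (fun m => (m < l * l)%N : nat)).
  have [h|h] := leqP N (l * l).
    apply: leq_trans h; rewrite -[leqRHS]subn0 -[leqRHS]muln1 -sum_nat_const_nat.
    by apply: leq_sum => m _; exact: leq_b1.
  rewrite (@big_cat_nat _ _ _ (l * l)) //=; last exact: ltnW.
  rewrite [X in (_ + X)%N]big1_seq ?addn0; last first.
    by move=> m /andP[_]; rewrite mem_index_iota => /andP[hm _]; rewrite ltnNge hm.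
  rewrite -[leqRHS]subn0 -[leqRHS]muln1 -sum_nat_const_nat.
  by apply: leq_sum => m _; exact: leq_b1.
apply: (@le_trans _ _ (\sum_(K <= l < B | A l) c l * (N%:R / l%:R + 1))).
  apply: ler_sum => l Al; rewrite -big_distrr /= ler_wpM2l //.
  apply: (@le_trans _ _ (\sum_(m < N) dvdind R l (r + W * m))).
    by apply: ler_sum => m _; rewrite /dvdind; case: (_ %| _)%N; case: (_ < _)%N; rewrite ?mul1r ?mul0r.
  have := count_dvd R r N (AW l Al) (A0 l Al); rewrite ler_norml => /andP[_].
  by rewrite lerBlDl.
have -> : \sum_(K <= l < B | A l) c l * (N%:R / l%:R + 1) =
   N%:R * (\sum_(K <= l < B | A l) c l / l%:R) + \sum_(K <= l < B | A l) c l.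
  rewrite big_distrr -big_split /=; apply: eq_bigr => l _; ring.
have h1 := ler_wpM2l (ler0n R N) (hK B).
have h2 : \sum_(K <= l < B | A l) c l <= \sum_(0 <= l < B | A l) c l.
  by rewrite [leRHS](@big_cat_nat _ _ _ K) //= lerDr sumr_ge0.
apply: le_trans (lerD h1 (le_trans h2 (hC B))) _.
rewrite (_ : B = (r + W * K).+1 + W * N)%N; last by rewrite /B; lia.
rewrite natrD natrM mulrDr; apply: ler_eq.
by field; rewrite gt_eqF.
Qed.

(** At most two primes contribute, and |y| <= rho + y^2 / rho turns the first moment
    into the second one, which has mean 0. *)
Lemma ub_lpd A y e rho r W : (forall l, A l -> prime l) -> (forall l, A l -> coprime l W) ->
  (0 < r)%N -> (0 < W)%N -> 0 < rho ->
  summable_on A (fun l => y l ^+ 2) e -> ubmean (lpd A (fun l => `|y l|) r W) (2 * rho).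
Proof.
move=> Ap AW r0 W0 rho0 hs.
have h0 := ub_lpd_null Ap AW r0 W0 (fun l => sqr_ge0 (y l)) hs.
have irho : 0 <= rho^-1 by rewrite invr_ge0 ltW.
have := ubD (ub_cst (2 * rho)) (ubZ irho h0); rewrite mulr0 addr0.
apply: ub_eventually (((r + W) * (r + W))%N) _ => m hm.
have hc := lpd_count Ap r0 hm.
apply: (@le_trans _ _ (rho * lpd A (fun=> 1) r W m + rho^-1 * lpd A (fun l => y l ^+ 2) r W m)).
  rewrite /lpd !big_distrr -big_split /=; apply: ler_sum => l _.
  rewrite mulr1 -[y l ^+ 2]real_normK ?num_real //; move: `|y l| (normr_ge0 (y l)) => a a0.
  rewrite -(ler_pM2l rho0) mulrDr mulrA divff ?gt_eqF // mul1r; nra.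
by rewrite lerD2r mulrC ler_wpM2r // ltW.
Qed.

End LargePrimes.

(** * Phases and concentration *)

Section Phases.
Variable R : realType.
Implicit Types (x y : R) (z w : R[i]).

Lemma sin_mvt x : 0 < x -> exists2 c, 0 < c < x & sin x = cos c * x.
Proof.
move=> x0.
have [c cx] := @MVT R sin cos 0 x x0 (fun y _ => is_derive_sin y)
   (continuous_subspaceT (@continuous_sin R)).
rewrite sin0 !subr0 => ->; exists c => //; by move: cx; rewrite in_itv.
Qed.

Lemma ler_sin_norm x : `|sin x| <= `|x|.
Proof.
wlog x0 : x / 0 < x => [hw|].
  have [h|h|->] := ltgtP x 0; last by rewrite sin0.
    by have := hw (- x); rewrite sinN !normrN; apply; rewrite oppr_gt0.
  exact: hw.
have [c _ ->] := sin_mvt x0; rewrite normrM ler_piMl //; exact: cos_max.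
Qed.

Lemma cos_ge x : 1 - x ^+ 2 / 2 <= cos x.
Proof.
have := cos_mulr2n (x / 2); rewrite -[x / 2 *+ 2]mulr_natr mulfVK ?pnatr_eq0 // => ->.
rewrite cos2sin2.
have : sin (x / 2) ^+ 2 <= (x / 2) ^+ 2.
  rewrite -[leLHS]real_normK ?num_real // -[leRHS]real_normK ?num_real //.
  by rewrite lerXn2r ?nnegrE // ler_sin_norm.
have -> : (x / 2) ^+ 2 = x ^+ 2 / 4 by field.
move: (sin _ ^+ 2) (x ^+ 2) => a b; lra.
Qed.

Lemma ler_sub_sin x : `|x| <= 1 -> `|x - sin x| <= x ^+ 2 / 2.
Proof.
wlog x0 : x / 0 < x => [hw|].
  have [h|h|->] := ltgtP x 0; last by rewrite sin0 subrr normr0 expr0n mul0r.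
    move=> hx; have := hw (- x); rewrite sinN !normrN sqrrN -opprD normrN; apply=> //.
    by rewrite oppr_gt0.
  exact: hw.
rewrite gtr0_norm // => x1.
have [c /andP[c0 cx] ->] := sin_mvt x0.
have h1 := cos_ge c; have h2 := cos_le1 c.
rewrite -{1}[x]mul1r -mulrBl normrM (gtr0_norm x0) ger0_norm ?subr_ge0 //.
have h3 : 1 - cos c <= x / 2.
  have : c ^+ 2 <= x by rewrite expr2; nra.
  by move: (cos c) (c ^+ 2) h1 => *; lra.
apply: le_trans (ler_wpM2r (ltW x0) h3) _.
by rewrite mulrAC -expr2.
Qed.

Definition expi x : R[i] := (cos x +i* sin x)%C.

Lemma expi0 : expi 0 = 1. Proof. by rewrite /expi cos0 sin0. Qed.

Lemma expiD x y : expi (x + y) = expi x * expi y.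
Proof.
rewrite /expi cosD sinD; apply/eqP; rewrite eq_complex /=.
by rewrite eqxx /= addrC eqxx.
Qed.

Lemma normc_expi x : normc (expi x) = 1.
Proof. by rewrite /= cos2Dsin2 sqrtr1. Qed.

Lemma normc_expiB x y : normc (expi x - expi y) <= `|x - y|.
Proof.
rewrite /expi /=.
have -> : (cos x - cos y) ^+ 2 + (sin x - sin y) ^+ 2 = (2 * sin ((x - y) / 2)) ^+ 2.
  have e : cos (x - y) = 1 - 2 * sin ((x - y) / 2) ^+ 2.
    have := cos_mulr2n ((x - y) / 2); rewrite -[_ / 2 *+ 2]mulr_natr mulfVK ?pnatr_eq0 // => ->.
    by rewrite cos2sin2; ring.
  have c1 := cos2Dsin2 x; have c2 := cos2Dsin2 y.
  have -> : (2 * sin ((x - y) / 2)) ^+ 2 = 2 - 2 * cos (x - y) by rewrite e; ring.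
  rewrite cosB; move: c1 c2.
  move: (cos x) (cos y) (sin x) (sin y) => a b c d c1 c2.
  have -> : (a - b) ^+ 2 + (c - d) ^+ 2 =
      (a ^+ 2 + c ^+ 2) + (b ^+ 2 + d ^+ 2) - 2 * (a * b + c * d) by ring.
  by rewrite c1 c2; ring.
rewrite sqrtr_sqr normrM ger0_norm //.
apply: le_trans (ler_wpM2l (ler0n _ 2) (ler_sin_norm _)) _.
by rewrite normrM [`|2^-1|]ger0_norm ?invr_ge0 // mulrCA divff ?mulr1.
Qed.

(** For z = a + ib in the disc b^2 <= 2 (1 - a), so that replacing z by e^(ib) costs
    only a multiple of 1 - a, although |z - 1| may be of the order of its square root. *)
Lemma normc_sub_expi z : normc z <= 1 ->
  normc (z - expi (complex.Im z)) <= 3 * (1 - complex.Re z).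
Proof.
move=> hz; apply: le_trans (ler_normc_ReIm _) _; rewrite ReB ImB.
have hre := le_trans (ler_norm _) (le_trans (ler_Re_normc z) hz).
have him := le_trans (ler_Im_normc z) hz.
have hq : complex.Re z ^+ 2 + complex.Im z ^+ 2 <= 1.
  by rewrite -normc_sqr expr_le1 ?normc_ge0.
rewrite /expi; move: (complex.Re z) (complex.Im z) hre him hq => a b hre him hq /=.
have h1 := cos_ge b; have h2 := cos_le1 b; have h3 := ler_sub_sin him.
have h4 : b ^+ 2 <= 2 * (1 - a) by nra.
have h5 : `|a - cos b| <= (1 - a) + b ^+ 2 / 2.
  by rewrite ler_norml; move: (b ^+ 2) (cos b) h1 h2 h4 => *; apply/andP; split; lra.
apply: le_trans (lerD h5 h3) _; move: (b ^+ 2) h4 => *; lra.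
Qed.

Lemma sqr_Im_le z : normc z <= 1 -> complex.Im z ^+ 2 <= 2 * (1 - complex.Re z).
Proof.
move=> hz.
have hre := le_trans (ler_norm _) (le_trans (ler_Re_normc z) hz).
have hq : complex.Re z ^+ 2 + complex.Im z ^+ 2 <= 1.
  by rewrite -normc_sqr expr_le1 ?normc_ge0.
by move: (complex.Re z) (complex.Im z) hre hq => a b; nra.
Qed.

Lemma Re_le1 z : normc z <= 1 -> 0 <= 1 - complex.Re z.
Proof.
move=> hz; rewrite subr_ge0.
exact: le_trans (ler_norm _) (le_trans (ler_Re_normc z) hz).
Qed.

End Phases.

Section Concentration.
Variable R : realType.
Variables (A : pred nat) (h : nat -> R[i]).
Hypotheses (Ap : forall l, A l -> prime l).
Hypotheses (hm : multiplicative_fun h) (h1 : h 1%N = 1) (hb : forall n, normc (h n) <= 1).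

Definition gap (l : nat) : R := 1 - complex.Re (h l).
Definition arg1 (l : nat) : R := complex.Im (h l).

(** The mean of the argument of h(r + W m), as predicted by the small primes. It
    depends neither on r nor on W. *)
Definition theta (m : nat) : R :=
  \sum_(0 <= l < m.+1 | A l && (l * l <= m)%N) arg1 l / l%:R.

Lemma dsum_split c (n p k m : nat) : n = (p ^ k * m)%N -> prime p -> (0 < k)%N ->
  (0 < m)%N -> coprime p m ->
  dsum (R:=R) A c n = (if A p then c p else 0) + dsum A c m.
Proof.
move=> nE pp k0 m0 cpm.
have n0 : (0 < n)%N by rewrite nE muln_gt0 expn_gt0 prime_gt0.
have mn : (m <= n)%N by rewrite nE leq_pmull // expn_gt0 prime_gt0.
have pn : (p <= n)%N by rewrite dvdn_leq // nE dvdn_mulr // dvdn_exp.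
rewrite (@dsum_expand _ _ _ _ n.+1 n0) // (@dsum_expand _ _ _ _ n.+1 m0) //.
have -> : (if A p then c p else 0) = \sum_(0 <= l < n.+1 | A l) (if l == p then c p else 0).
  rewrite -big_mkcondr /= (eq_bigl (fun l => A p && (l == p))); last first.
    by move=> l; case: eqP => [->|]; rewrite ?andbF ?andbT.
  case: (A p); last by rewrite big_pred0_eq.
  by rewrite big_nat1_eq /= ltnS pn.
rewrite -big_split /=; apply: eq_bigr => l Al; have pl := Ap Al.
have -> : dvdind R l n = (l == p)%:R + dvdind R l m.
  rewrite /dvdind nE Euclid_dvdM // Euclid_dvdX // k0 andbT dvdn_prime2 //.
  case: eqP => [->|_] /=; last by rewrite add0r.
  have : ~~ (p %| m)%N by rewrite -prime_coprime.
  by move=> /negbTE ->; rewrite addr0.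
by case: eqP => [->|_] /=; rewrite ?add0r // mulrDr mulr1.
Qed.


Lemma sqd_split (n p k m : nat) : n = (p ^ k * m)%N -> prime p -> (0 < k)%N ->
  (0 < m)%N -> coprime p m ->
  (if A p && (1 < k)%N then 1 else 0) + sqd R A m <= sqd R A n.
Proof.
move=> nE pp k0 m0 cpm.
have n0 : (0 < n)%N by rewrite nE muln_gt0 expn_gt0 prime_gt0.
have mn : (m <= n)%N by rewrite nE leq_pmull // expn_gt0 prime_gt0.
have pn : (p <= n)%N by rewrite dvdn_leq // nE dvdn_mulr // dvdn_exp.
rewrite (@sqd_expand _ _ n n.+1 n0) ?leq_pmulr // (@sqd_expand _ _ m n.+1 m0); last by nia.
have -> : (if A p && (1 < k)%N then 1 else 0) =
    \sum_(0 <= l < n.+1 | A l) (if (l == p) && (1 < k)%N then 1 else 0) :> R.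
  rewrite -big_mkcondr /= (eq_bigl (fun l => (A p && (1 < k)%N) && (l == p))); last first.
    by move=> l; case: eqP => [->|]; rewrite ?andbF ?andbT.
  case: (A p && _); last by rewrite big_pred0_eq.
  by rewrite big_nat1_eq /= ltnS pn.
rewrite -big_split /=; apply: ler_sum => l Al; have pl := Ap Al; rewrite /dvdind.
case: eqP => [lp|_] /=; last first.
  rewrite add0r ler_nat; case: (boolP (l * l %| m)%N) => // hl.
  by rewrite nE dvdn_mull.
have /negbTE -> : ~~ (l * l %| m)%N.
  apply/negP => hl; have : ~~ (p %| m)%N by rewrite -prime_coprime.
  by rewrite -lp (dvdn_trans _ hl) // dvdn_mulr.
rewrite addr0; case: ifP => // k1.
by rewrite nE lp dvdn_mulr // (dvdn_exp2l p k1).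
Qed.

Lemma gap_ge0 l : 0 <= gap l. Proof. exact: Re_le1. Qed.

(** Telescoping the product over the prime powers of n: a prime of A occurring once
    costs a multiple of its gap, a repeated one costs at most 2, and the primes outside
    A contribute a factor 1. *)
Lemma mult_near_phase n : (0 < n)%N ->
  (forall p k, prime p -> (p %| n)%N -> ~~ A p -> (0 < k)%N -> h (p ^ k)%N = 1) ->
  normc (h n - expi (dsum A arg1 n)) <= 3 * dsum A gap n + 2 * sqd R A n.
Proof.
elim/ltn_ind: n => n IH n0 hA.
have [n1|n1] := leqP n 1.
  have -> : n = 1%N by lia.
  have d0 (F : nat -> R) : dsum A F 1 = 0.
    rewrite /dsum big1 // => l; rewrite dvdn1 => /andP[Al /eqP l1].
    by have := Ap Al; rewrite l1.
  rewrite !d0 expi0 h1 subrr normc0 mulr0 add0r mulr_ge0 //.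
  exact: sumr_ge0.
pose p := pdiv n; have pp : prime p := pdiv_prime n1.
have pn : (p %| n)%N := pdiv_dvd n.
pose k := logn p n; have k0 : (0 < k)%N by rewrite logn_gt0 mem_primes pp n0.
have [m cpm nE'] := pfactor_coprime pp n0.
have nE : n = (p ^ k * m)%N by rewrite mulnC.
have m0 : (0 < m)%N by case: (m) nE n0 => // ->; rewrite muln0.
have mn : (m < n)%N.
  rewrite nE ltn_Pmull // -{1}(expn0 p) ltn_exp2l // prime_gt1 //.
have cpkm : coprime (p ^ k) m by rewrite coprimeXl.
have hn : h n = h (p ^ k)%N * h m.
  by rewrite {1}nE hm // expn_gt0 prime_gt0.
have m_n : (m %| n)%N by rewrite nE dvdn_mull.
have {}IH := IH m mn m0 (fun l j pl lm => hA l j pl (dvdn_trans lm m_n)).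
have hsq := sqd_split nE pp k0 m0 cpm.
rewrite (dsum_split _ nE pp k0 m0 cpm) (dsum_split _ nE pp k0 m0 cpm) hn.
case: (boolP (A p)) hsq => [Ap'|nAp] /=; last first.
  rewrite !add0r (hA p k) // mul1r => hsq; apply: le_trans IH _.
  by rewrite lerD2l ler_wpM2l.
move=> hsq; rewrite expiD.
have tri : normc (h (p ^ k)%N * h m - expi (arg1 p) * expi (dsum A arg1 m)) <=
    normc (h (p ^ k)%N - expi (arg1 p)) + normc (h m - expi (dsum A arg1 m)).
  apply: le_trans (normc_dist _ _ (expi (arg1 p) * h m)) _.
  rewrite -mulrBl -mulrBr !normcM normc_expi mul1r lerD2r.
  by rewrite -[leRHS]mulr1 ler_wpM2l ?normc_ge0.
apply: le_trans tri _; rewrite mulrDr -addrA [leRHS]addrCA.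
have [k1|k1] := leqP k 1.
  have {k1}k1 : k = 1%N by lia.
  rewrite k1 ltnn add0r in hsq.
  rewrite k1 expn1 addrCA lerD ?normc_sub_expi //.
  by apply: le_trans IH _; rewrite lerD2l ler_wpM2l.
rewrite k1 in hsq; have := ler_wpM2l (ler0n R 2) hsq; rewrite mulrDr mulr1 => {}hsq.
have h2 : normc (h (p ^ k)%N - expi (arg1 p)) <= 2.
  by apply: le_trans (normcD _ _) _; rewrite normcN normc_expi; have := hb (p ^ k)%N; lra.
have g0 := gap_ge0 p.
lra.
Qed.

Lemma theta_expand m B : (m < B)%N ->
  theta m = \sum_(0 <= l < B | A l) (l * l <= m)%:R * (arg1 l / l%:R).
Proof. by move=> mB; apply: sum_indic => l _ lm; apply/andP; split; nia. Qed.

(** A new term enters only when m + 1 is the square of a prime l, and its size is at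
    most 1 / l. *)
Lemma theta_step L m : (0 < L)%N -> (L * L <= m)%N -> `|theta m.+1 - theta m| <= L%:R^-1.
Proof.
move=> L0 Lm.
rewrite (@theta_expand m.+1 m.+2) // (@theta_expand m m.+2); last exact: leqW.
rewrite -sumrB.
rewrite (eq_bigr (fun l => (l * l == m.+1)%:R * (arg1 l / l%:R))); last first.
  move=> l _; rewrite [(_ <= m.+1)%N]leq_eqVlt ltnS.
  by case: eqP => [->|_] /=; rewrite ?ltnn ?mul0r ?subr0 ?subrr.
have [[l0 hl0]|hno] := pselect (exists l, (l * l)%N = m.+1); last first.
  rewrite big1 ?normr0 ?invr_ge0 // => l _; case: eqP => h0; last by rewrite mul0r.
  by exfalso; apply: hno; exists l.
have Ll0 : (L <= l0)%N by nia.
rewrite (eq_bigr (fun l => if l == l0 then arg1 l0 / l0%:R else 0)); last first.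
  move=> l _; case: eqP => h0; case: eqP => h0'; rewrite ?mul1r ?mul0r ?h0' //.
    by exfalso; apply: h0'; nia.
  by exfalso; apply: h0; rewrite h0'.
rewrite -big_mkcondr /= (eq_bigl (fun l => A l0 && (l == l0))); last first.
  by move=> l; case: eqP => [->|]; rewrite ?andbF ?andbT.
case: (A l0); last by rewrite big_pred0_eq normr0 invr_ge0.
rewrite big_nat1_eq /=; case: ifP => _; last by rewrite normr0 invr_ge0.
rewrite normrM normfV normr_nat -[leRHS]mul1r ler_pM ?invr_ge0 //.
  exact: le_trans (ler_Im_normc _) (hb _).
by rewrite lef_pV2 ?posrE ?ltr0n ?ler_nat //; exact: leq_trans Ll0.
Qed.

Lemma theta_slow j : (fun m => theta (m + j) - theta m) @ \oo --> (0 : R).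
Proof.
elim: j => [|j IH].
  under eq_fun do rewrite addn0 subrr; exact: cvg_cst.
have h0 : (fun m => theta (m + j).+1 - theta (m + j)) @ \oo --> (0 : R).
  apply/cvgrPdist_le => e e0.
  pose L := (Num.truncn e^-1).+1; exists (L * L)%N => // m /= Lm.
  rewrite sub0r normrN; apply: le_trans (@theta_step L (m + j) isT _) _.
    exact: leq_trans Lm (leq_addr _ _).
  by rewrite invf_ple ?posrE // ?ltr0n // ltW // truncnS_gt.
have -> : (fun m => theta (m + j.+1) - theta m) =
    (fun m => theta (m + j).+1 - theta (m + j)) \+ (fun m => theta (m + j) - theta m).
  by apply/funext => m; rewrite /= addrA subrK addnS.
rewrite -[X in _ --> X]addr0; exact: cvgD.
Qed.

(** The primes at which h may differ from 1, apart from the divisors of W, belong to A,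
    and A is thin enough. *)
Definition active W e := [/\ forall l, A l -> prime l && coprime l W,
  forall l k, prime l -> coprime l W -> ~~ A l -> (0 < k)%N -> h (l ^ k)%N = 1,
  summable_on A gap e & summable_on A (fun l => l%:R^-1) e].

(** By [mult_near_phase], h(n) is near e^(i s) in mean, where s is the sum of arg1 l
    over the l in A dividing n. The Turan-Kubilius inequality replaces the part of s
    with l^2 <= m by its mean value theta m; the other part is small by [ub_lpd]. *)
Lemma phase_concentration rho r W : 0 < rho -> rho <= 1 -> active W (rho ^+ 2) ->
  (0 < r)%N -> (0 < W)%N -> coprime r W ->
  ubmean (fun m => normc (h (r + W * m)%N - expi (theta m))) (13 * rho).
Proof.
move=> rho0 rho1 [ApW hA hg hs] r0 W0 crW.
have AW l : A l -> coprime l W by case/ApW/andP.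
have sy : summable_on A (fun l => arg1 l ^+ 2) (2 * rho ^+ 2).
  move=> B; apply: le_trans (ler_wpM2l (ler0n R 2) (hg B)).
  rewrite big_distrr; apply: ler_sum => l _ /=; rewrite mulrA ler_wpM2r ?invr_ge0 //.
  exact: sqr_Im_le.
have u1 := ub_dsum gap_ge0 Ap AW r0 W0 hg.
have u2 := ub_sqd Ap AW r0 W0 hs.
have r20 : 0 <= 2 * rho ^+ 2 by rewrite mulr_ge0 // sqr_ge0.
have u3 := ub_dev r Ap AW r20 sy.
have u4 := ub_lpd Ap AW r0 W0 rho0 sy.
have irho : 0 <= rho^-1 by rewrite invr_ge0 ltW.
have u := ubD (ubD (ubZ (ler0n R 3) u1) (ubZ (ler0n R 2) u2))
   (ubD (ubD (ub_cst rho) (ubZ irho u3)) u4).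
apply: ub_weaken (ub_le _ u) => [|m].
  have -> : rho^-1 * (2 * (2 * rho ^+ 2)) = 4 * rho by field; rewrite gt_eqF.
  have : rho ^+ 2 <= rho by rewrite expr2 ler_piMr // ltW.
  by move: (rho ^+ 2) => x; lra.
set n := (r + W * m)%N.
have n0 : (0 < n)%N by rewrite addn_gt0 r0.
apply: le_trans (normc_dist _ _ (expi (dsum A arg1 n))) _.
have cpn p : prime p -> (p %| n)%N -> coprime p W.
  move=> pp pn; rewrite prime_coprime //; apply/negP => pW.
  have : (p %| r)%N by move: pn; rewrite /n dvdn_addl // dvdn_mulr.
  move=> pr; have : (p %| gcdn r W)%N by rewrite dvdn_gcd pr.
  by rewrite (eqP crW) dvdn1 => /eqP p1; move: pp; rewrite p1.
apply: lerD.
  by apply: mult_near_phase => // p k pp pn; apply: hA => //; exact: cpn.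
apply: le_trans (normc_expiB _ _) _.
have -> : dsum A arg1 n - theta m = dev A arg1 r W m + lpd A arg1 r W m.
  rewrite (@dsum_expand _ _ _ n n.+1) //.
  rewrite (@lpd_expand _ _ _ _ _ _ n.+1) //.
  have mn : (m < n.+1)%N by rewrite ltnS /n; apply: leq_trans (leq_addl _ _); rewrite leq_pmull.
  have ms : (m < n.+1 * n.+1)%N by apply: leq_trans mn _; rewrite leq_pmulr.
  rewrite (@dev_expand _ _ _ _ _ _ n.+1) //.
  rewrite (theta_expand mn).
  rewrite -sumrB -big_split /=; apply: eq_bigr => l _; rewrite /dlt -/n ltnNge.
  by case: (_ <= _)%N => /=; ring.
apply: le_trans (ler_normD _ _) _; apply: lerD.
  rewrite -[dev _ _ _ _ _ ^+ 2]real_normK ?num_real //; move: `|dev _ _ _ _ _| => x.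
  rewrite -(ler_pM2l rho0) mulrDr mulrA divff ?gt_eqF // mul1r; nra.
apply: le_trans (ler_norm_sum _ _ _) _; exact: lexx.
Qed.

End Concentration.

Lemma active_prime (R : realType) (h : nat -> R[i]) A W e :
  active A h W e -> forall l, A l -> prime l.
Proof. by case=> ApW _ _ _ l /ApW /andP[]. Qed.

(** * Dirichlet characters *)

Section Moduli.

(** Multiplying a modulus divisible by the primes of u by L leaves only primes above K
    among those prime to it. *)
Lemma smooth_modulus (K u : nat) : (0 < u)%N -> exists L, [/\ (0 < L)%N, coprime L u &
  forall l, prime l -> ~~ (l %| u)%N -> (l <= K)%N -> (l %| L)%N].
Proof.
move=> u0; pose P l := prime l && ~~ (l %| u)%N.
exists (\prod_(0 <= l < K.+1 | P l) l)%N; split.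
- by rewrite prodn_cond_gt0 // => l /andP[/prime_gt0].
- apply: (big_ind (fun x => coprime x u)).
  + exact: coprime1n.
  + by move=> x y; rewrite coprimeMl => -> ->.
  + by move=> l /andP[pl lu]; rewrite prime_coprime.
- move=> l pl lu lK; rewrite (big_rem l) /= ?mem_index_iota ?ltnS //.
  by rewrite /P pl lu dvdn_mulr.
Qed.

End Moduli.

Section Characters.
Variable R : realType.
Variables (q : nat) (chi : nat -> R[i]).
Hypothesis hchi : dirichlet_character q chi.

Lemma chi_gt0 : (0 < q)%N. Proof. by case: hchi. Qed.

Lemma chi_addM n k : chi (n + q * k)%N = chi n.
Proof.
case: hchi => _ hp _ _; elim: k => [|k IH]; first by rewrite muln0 addn0.
by have -> : (n + q * k.+1 = (n + q * k) + q)%N; [rewrite mulnS; lia | rewrite hp].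
Qed.

Lemma chi_mod n m : n = m %[mod q] -> chi n = chi m.
Proof.
move=> h; rewrite (divn_eq n q) (divn_eq m q) h.
by rewrite ![(_ * q + _)%N]addnC ![(_ * q)%N]mulnC !chi_addM.
Qed.

Lemma chiM m n : chi (m * n)%N = chi m * chi n.
Proof. by case: hchi. Qed.

Lemma chi_neq0 n : coprime n q -> chi n != 0.
Proof. by case: hchi => _ _ _ h /h. Qed.

Lemma chi_eq0 n : ~~ coprime n q -> chi n = 0.
Proof.
case: hchi => _ _ _ h /negP hn; apply/eqP/negP => /negP /h; exact: hn.
Qed.

Lemma chi1 : chi 1%N = 1.
Proof.
have c0 : chi 1%N != 0 by apply: chi_neq0; exact: coprime1n.
by apply: (mulfI c0); rewrite mulr1 -chiM.
Qed.

Lemma chiX n k : chi (n ^ k)%N = chi n ^+ k.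
Proof.
elim: k => [|k IH]; first by rewrite expn0 expr0 chi1.
by rewrite expnS exprS chiM IH.
Qed.

Lemma normcX (z : R[i]) k : normc (z ^+ k) = normc z ^+ k.
Proof.
elim: k => [|k IH]; first by rewrite !expr0 normc1.
by rewrite !exprS normcM IH.
Qed.

Lemma chi_norm n : coprime n q -> normc (chi n) = 1.
Proof.
move=> cnq; have := Euler_exp_totient cnq => /chi_mod.
rewrite chiX chi1 => /(congr1 (@normc R)); rewrite normcX normc1.
move=> /eqP; rewrite pexprn_eq1 ?normc_ge0 // -leqn0 leqNgt totient_gt0 chi_gt0 /=.
by move=> /eqP.
Qed.

Lemma chi_norm_le1 n : normc (chi n) <= 1.
Proof.
have [h|h] := boolP (coprime n q); first by rewrite chi_norm.
by rewrite chi_eq0 // normc0.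
Qed.

End Characters.

(** Otherwise n |-> chi(n'), where n' = n mod q' and n' = 1 mod p^a, is a character
    mod q' that induces chi. *)
Lemma primitive_separates (R : realType) (q : nat) (chi : nat -> R[i]) (p a q' : nat) :
  primitive_character q chi -> prime p -> (0 < a)%N -> q = (p ^ a * q')%N -> coprime p q' ->
  exists n1 n2, [/\ coprime n1 q, coprime n2 q, n1 = n2 %[mod q'] & chi n1 <> chi n2].
Proof.
move=> [hchi hprim] pp a0 qE cpq'.
have q0 := chi_gt0 hchi.
have q'0 : (0 < q')%N by case: (q') qE q0 => // ->; rewrite muln0.
have cpaq' : coprime q' (p ^ a) by rewrite coprime_sym coprimeXl.
apply: contrapT => hno.
have same n1 n2 : coprime n1 q -> coprime n2 q -> n1 = n2 %[mod q'] -> chi n1 = chi n2.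
  by move=> c1 c2 e; apply: contrapT => ne; apply: hno; exists n1, n2.
pose lift n := chinese q' (p ^ a) n 1.
have lift_mod n : lift n = n %[mod q'] by exact: chinese_modl.
have lift_cop n : coprime n q' -> coprime (lift n) q.
  move=> cn; rewrite qE coprimeMr; apply/andP; split.
    by rewrite -coprime_modl chinese_modr // coprime_modl coprime1n.
  by rewrite -coprime_modl lift_mod coprime_modl.
pose psi n := if coprime n q' then chi (lift n) else 0.
have q'q : (q' %| q)%N by rewrite qE dvdn_mull.
have copq n : coprime n q -> coprime n q' by move=> /coprime_dvdr; apply.
apply: (hprim q' psi) => //.
- by rewrite qE ltn_Pmull // -(expn0 p) ltn_exp2l // prime_gt1.
- split => //.
  + move=> n; rewrite /psi -coprime_modl modnDr coprime_modl; case: ifP => // cn.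
    apply: same; try exact: lift_cop.
      by apply: lift_cop; rewrite -coprime_modl modnDr coprime_modl.
    by rewrite !lift_mod modnDr.
  + move=> m n; rewrite /psi coprimeMl.
    case: (boolP (coprime m q')) => cm; last by rewrite mul0r.
    case: (boolP (coprime n q')) => cn /=; last by rewrite mulr0.
    rewrite -(chiM hchi); apply: same.
    * by apply: lift_cop; rewrite coprimeMl cm.
    * by rewrite coprimeMl !lift_cop.
    * by rewrite lift_mod -modnMm -[in LHS](lift_mod m) -[in LHS](lift_mod n) modnMm.
  + move=> n; rewrite /psi; case: (boolP (coprime n q')) => cn; last by rewrite eqxx.
    by split=> // _; apply: (chi_neq0 hchi); exact: lift_cop.
- move=> n cn; rewrite /psi copq //; apply: same => //.
  by apply: lift_cop; exact: copq.
Qed.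

(** * Pretentious functions *)

Section Archimedean.
Variable R : realType.
Implicit Types (t : R).

Lemma npow_itE n t : npow_it n t = expi (t * ln n%:R). Proof. by []. Qed.

Lemma npow_itM m n t : (0 < m)%N -> (0 < n)%N ->
  npow_it (m * n) t = npow_it m t * npow_it n t.
Proof.
by move=> m0 n0; rewrite !npow_itE natrM lnM ?posrE ?ltr0n // mulrDr expiD.
Qed.

Lemma npow_itX p s t : (0 < p)%N -> npow_it (p ^ s) t = npow_it p (s%:R * t).
Proof.
move=> p0; rewrite !npow_itE natrX lnXn ?ltr0n // -mulr_natl.
by congr (expi _); ring.
Qed.

Lemma npow_it1 t : npow_it 1 t = 1.
Proof. by rewrite npow_itE ln1 mulr0 expi0. Qed.

Lemma normc_npow n t : normc (npow_it n t) = 1.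
Proof. exact: normc_expi. Qed.

(** The logarithms of two integers larger than m at a bounded distance differ by
    O(1 / m). *)
Lemma npow_it_slow t (u v : nat -> nat) : (forall m, (m < u m)%N /\ (m < v m)%N) ->
  (exists c, forall m, (v m <= u m + c)%N /\ (u m <= v m + c)%N) ->
  (fun m => normc (npow_it (v m) t - npow_it (u m) t)) @ \oo --> (0 : R).
Proof.
move=> huv [c hc].
have half (a b m : nat) : (m < a)%N -> (a <= b)%N -> (b <= a + c)%N ->
    `|ln b%:R - ln a%:R| <= c%:R / m.+1%:R :> R.
  move=> ma ab bc.
  have a0 : 0 < a%:R :> R by rewrite ltr0n; exact: leq_ltn_trans ma.
  have b0 : 0 < b%:R :> R by rewrite ltr0n; exact: leq_trans (leq_ltn_trans (leq0n m) ma) ab.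
  rewrite -ln_div ?posrE //.
  have r1 : 1 <= b%:R / a%:R :> R by rewrite ler_pdivlMr // mul1r ler_nat.
  rewrite ger0_norm ?ln_ge0 //.
  have -> : b%:R / a%:R = 1 + (b - a)%N%:R / a%:R :> R.
    by rewrite natrB // mulrBl divff ?gt_eqF // addrC subrK.
  apply: le_trans (le_ln1Dx _) _.
    by apply: lt_le_trans (_ : 0 <= _); rewrite ?ltrN10 // divr_ge0.
  have h1 : (b - a)%N%:R <= c%:R :> R by rewrite ler_nat leq_subLR.
  have h2 : a%:R^-1 <= m.+1%:R^-1 :> R.
    by rewrite lef_pV2 ?posrE ?ltr0n // ?ler_nat //; exact: leq_ltn_trans ma.
  by apply: ler_pM; rewrite ?invr_ge0.
have key m : normc (npow_it (v m) t - npow_it (u m) t) <= `|t| * (c%:R / m.+1%:R).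
  apply: le_trans (normc_expiB _ _) _; rewrite -mulrBr normrM ler_wpM2l //.
  have [mu mv] := huv m; have [h1 h2] := hc m.
  have [h|h] := leqP (u m) (v m); first exact: half.
  by rewrite distrC; apply: half => //; exact: ltnW.
apply: (@squeeze_cvgr _ _ _ _ (fun=> 0) (fun m => `|t| * (c%:R / m.+1%:R))).
- by apply: nearW => m; rewrite normc_ge0 key.
- exact: cvg_cst.
rewrite -[X in _ --> X](mulr0 `|t|) -[X in _ * X](mulr0 c%:R).
apply: cvgM; first exact: cvg_cst.
apply: cvgM; first exact: cvg_cst.
exact: cvg_harmonic.
Qed.

End Archimedean.

Section Summability.
Variable R : realType.

Lemma summable_sub (A B : pred nat) (c : nat -> R) e : (forall l, 0 <= c l) ->
  (forall l, A l -> B l) -> summable_on B c e -> summable_on A c e.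
Proof.
move=> c0 AB hB N; apply: le_trans (hB N).
rewrite big_mkcond [leRHS]big_mkcond /=; apply: ler_sum => l _.
case: (boolP (A l)) => [/AB ->//|_]; case: ifP => // _.
by rewrite divr_ge0.
Qed.

Lemma summable_tail (B : pred nat) (c : nat -> R) e : (forall l, 0 <= c l) ->
  summable_on B c e -> forall eta, 0 < eta -> exists K, forall A : pred nat,
  (forall l, A l -> B l && (K <= l)%N) -> summable_on A c eta.
Proof.
move=> c0 hB eta eta0; have [K hK] := tail_small c0 hB eta0.
exists K => A AB N; apply: le_trans (hK N).
have t0 l : 0 <= c l / l%:R by rewrite divr_ge0.
have [h|h] := leqP N K.
  rewrite [leRHS]big_geq // big_nat_cond big1 // => l /andP[/andP[_ lN] /AB /andP[_ Kl]].
  by have := leq_trans lN (leq_trans h Kl); rewrite ltnn.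
rewrite (@big_cat_nat _ _ _ K) //=; last exact: ltnW.
rewrite big_nat_cond big1 ?add0r; last first.
  by move=> l /andP[/andP[_ lN] /AB /andP[_ Kl]]; have := leq_trans lN Kl; rewrite ltnn.
rewrite big_mkcond [leRHS]big_mkcond /=; apply: ler_sum => l _.
case: (boolP (A l)) => [/AB /andP[-> _]//|_]; by case: ifP.
Qed.

Lemma summable_inverse (A : pred nat) : summable_on A (fun l => l%:R^-1) (2 : R).
Proof.
apply: (@summable_sub _ xpredT) => // N.
apply: (@le_trans _ _ (\sum_(0 <= l < N.+2) (l%:R^-1 / l%:R))).
  by rewrite [leRHS](@big_cat_nat _ _ _ N) //= ?lerDl ?sumr_ge0 // leqW.
apply: (@le_trans _ _ (2 - N.+1%:R^-1)); last by rewrite gerBl.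
elim: N => [|N IH].
  rewrite big_nat_recr //= big_nat1 invr0 mul0r add0r invr1 mulr1; lra.
rewrite big_nat_recr //=; apply: le_trans (lerD IH (lexx _)) _.
have a0 : 0 < N.+1%:R :> R by rewrite ltr0n.
have b0 : 0 < N.+2%:R :> R by rewrite ltr0n.
have ab : N.+2%:R = N.+1%:R + 1 :> R by rewrite natr1.
rewrite -subr_ge0.
have -> : 2 - N.+2%:R^-1 - (2 - N.+1%:R^-1 + N.+2%:R^-1 / N.+2%:R) =
    (N.+1%:R * N.+2%:R * N.+2%:R)^-1 :> R.
  by rewrite ab in b0 *; field; rewrite !gt_eqF.
by rewrite invr_ge0 !mulr_ge0 // ltW.
Qed.

End Summability.

Section Pretentious.
Variable R : realType.
Variables (f : nat -> R[i]) (t : R) (q : nat) (chi : nat -> R[i]).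
Hypotheses (fb : forall n, normc (f n) <= 1).
Hypotheses (hf : multiplicative_fun f) (hchi : dirichlet_character q chi).
Hypothesis hp : pretends f (fun n => npow_it n t * chi n).

(** The quotient of f by the function that it pretends to be, on the integers prime
    to q. *)
Definition twist (n : nat) : R[i] := f n * conjc (npow_it n t * chi n).

Lemma twist_mult : multiplicative_fun twist.
Proof.
move=> m n m0 n0 cmn; rewrite /twist hf // npow_itM // (chiM hchi).
by rewrite !rmorphM /=; ring.
Qed.

Lemma twist_bound n : normc (twist n) <= 1.
Proof.
rewrite /twist normcM normc_conj normcM normc_npow mul1r.
by rewrite -[leRHS]mulr1 ler_pM ?normc_ge0 // (chi_norm_le1 hchi).
Qed.

Lemma mulc_conj (z : R[i]) : normc z = 1 -> z * conjc z = 1.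
Proof.
move=> hz; rewrite -sqr_normc normc_def2 hz -rmorphXn /= expr1n //.
Qed.

Lemma twistK n : coprime n q -> f n = twist n * (npow_it n t * chi n).
Proof.
move=> cn; rewrite /twist -mulrA [conjc _ * _]mulrC mulc_conj ?mulr1 //.
by rewrite normcM normc_npow (chi_norm hchi cn) mulr1.
Qed.

Lemma gap_summable : exists e, summable_on prime (gap twist) e.
Proof.
have g0 l : 0 <= gap twist l by exact: (gap_ge0 twist_bound).
have t0 l : (0 <= ((l%:R^-1 * (1 - complex.Re (f l * conjc (npow_it l t * chi l))))%:E : \bar R))%E.
  by rewrite lee_fin mulr_ge0 // ?invr_ge0 //; exact: g0.
have fin : sq_distance f (fun n => npow_it n t * chi n) \is a fin_num.
  rewrite ge0_fin_numE //; apply: nneseries_ge0 => l _ _; exact: t0.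
exists (fine (sq_distance f (fun n => npow_it n t * chi n))) => B.
rewrite -lee_fin (fineK fin) /sq_distance.
have := @nneseries_lim_ge R (fun l => (l%:R^-1 * (1 - complex.Re (f l * conjc (npow_it l t * chi l))))%:E)
  prime 0 B (fun l _ _ => t0 l).
apply: le_trans; rewrite sumEFin lee_fin; apply: ler_eq.
by apply: eq_bigr => l _; rewrite mulrC.
Qed.

Lemma tail_active (rho : R) : 0 < rho -> exists K, forall A : pred nat,
  (forall l, A l -> prime l && (K <= l)%N) ->
  summable_on A (gap twist) rho /\ summable_on A (fun l => l%:R^-1) rho.
Proof.
move=> rho0; have g0 l : 0 <= gap twist l by exact: (gap_ge0 twist_bound).
have [e he] := gap_summable.
have [K1 h1] := summable_tail g0 he rho0.
have i0 l : 0 <= l%:R^-1 :> R by rewrite invr_ge0.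
have [K2 h2] := summable_tail i0 (@summable_inverse R prime) rho0.
exists (maxn K1 K2) => A hA; split.
  by apply: h1 => l /hA /andP[-> /=]; rewrite geq_max => /andP[].
by apply: h2 => l /hA /andP[-> /=]; rewrite geq_max => /andP[].
Qed.

(** The sums of gap l / l and of 1 / l^2 over the primes converge, hence are small on
    the primes above some K. *)
Lemma active_coprime (e : R) : 0 < e -> exists K, forall V W,
  (forall l, prime l -> (l < K)%N -> (l %| V)%N) ->
  (forall l, prime l -> coprime l V -> coprime l W) ->
  (forall l k, prime l -> coprime l W -> ~~ coprime l V -> (0 < k)%N -> twist (l ^ k)%N = 1) ->
  active (fun l => prime l && coprime l V) twist W e.
Proof.
move=> e0; have [K hK] := tail_active e0; exists K => V W hV hVW hW.
have AK l : prime l && coprime l V -> prime l && (K <= l)%N.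
  move=> /andP[pl cl]; rewrite pl /= leqNgt; apply/negP => lK.
  by move: cl; rewrite prime_coprime // hV.
have [hg hs] := hK _ AK; split => // [l /andP[pl cl]|l k pl cl].
  by rewrite pl hVW.
by rewrite pl /= => ncl k0; exact: hW.
Qed.

(** Otherwise f = 0 and every prime has gap 1. The sum of the gaps of the large primes
    dividing n is small in mean, but it is at least 1 for every n > 1 that is 1 modulo W. *)
Lemma f1 : f 1%N = 1.
Proof.
have sq : f 1%N = f 1%N * f 1%N := hf (m := 1) (n := 1) isT isT isT.
have [f10|f10] := eqVneq (f 1%N) 0; last by apply: (mulfI f10); rewrite mulr1 -sq.
exfalso.
have f0 n : (0 < n)%N -> f n = 0.
  by move=> n0; rewrite -(muln1 n) hf ?coprimen1 // f10 mulr0.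
have q0 : 0 < (4^-1 : R) by rewrite invr_gt0.
have [K hK] := active_coprime q0.
pose W := K`!; have W0 : (0 < W)%N := fact_gt0 K.
pose A l := prime l && coprime l W.
have Ap l : A l -> prime l by case/andP.
have AW l : A l -> coprime l W by case/andP.
have [||l k _ -> //|_ _ hg _] := hK W W => //.
  by move=> l pl lK; apply: dvdn_fact; rewrite prime_gt0 //= ltnW.
have u := ub_dsum (gap_ge0 twist_bound) Ap AW (ltnSn 0) W0 hg.
have ge1 m : (1 <= m)%N -> 1 <= dsum A (gap twist) (1 + W * m).
  move=> m1; set n := (1 + W * m)%N.
  have n1 : (1 < n)%N by rewrite /n ltnS muln_gt0 W0.
  pose p := pdiv n; have pp : prime p := pdiv_prime n1; have pn : (p %| n)%N := pdiv_dvd n.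
  have Apr : A p.
    rewrite /A pp prime_coprime //; apply/negP => pW.
    have : (p %| 1)%N by move: pn; rewrite /n dvdn_addl // dvdn_mulr.
    by rewrite dvdn1 => /eqP p1; move: pp; rewrite p1.
  have gp : gap twist p = 1 by rewrite /gap /twist f0 ?prime_gt0 // mul0r subr0.
  have pin : p \in index_iota 0 n.+1.
    by rewrite mem_index_iota /= ltnS dvdn_leq.
  rewrite /dsum (big_rem p) //= Apr pn /= gp lerDl sumr_ge0 // => l _.
  exact: (gap_ge0 twist_bound).
have := ub_eventually ge1 u => /(_ _ q0) [C hC].
have [N hN] : exists N : nat, C * 2 < N%:R.
  by exists (Num.truncn (C * 2)).+1; exact: truncnS_gt.
have := hC N; rewrite sumr_const card_ord.
by move: hN; move: (N%:R : R) => x; lra.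
Qed.

Lemma twist1 : twist 1%N = 1.
Proof. by rewrite /twist f1 npow_it1 (chi1 hchi) mulr1 conjc1 mulr1. Qed.

End Pretentious.

(** * Residue classes that separate *)

Section Classes.
Variable R : realType.
Variables (f : nat -> R[i]) (t : R) (q : nat) (chi : nat -> R[i]).
Hypotheses (fb : forall n, normc (f n) <= 1).
Hypotheses (hf : multiplicative_fun f) (hchi : dirichlet_character q chi).
Hypothesis hp : pretends f (fun n => npow_it n t * chi n).

Local Notation h := (twist f t chi).
Let q0 : (0 < q)%N := chi_gt0 hchi.
Let hm : multiplicative_fun h := twist_mult t hf hchi.
Let h1 : h 1%N = 1 := twist1 fb hf hchi hp.
Let hb : forall n, normc (h n) <= 1 := twist_bound t fb hchi.

Definition slow (w : nat -> R[i]) :=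
  forall j, (fun m => normc (w (m + j)%N - w m)) @ \oo --> (0 : R).

(** Its values at all residues r modulo W share the same theta. *)
Definition phase (A : pred nat) r W (m : nat) : R[i] :=
  expi (theta A h m) * npow_it (r + W * m) t.

Lemma normc_phase A r W m : normc (phase A r W m) = 1.
Proof. by rewrite /phase normcM normc_expi normc_npow mulr1. Qed.

Lemma normcM_sub (a b c d : R[i]) : normc a <= 1 -> normc d <= 1 ->
  normc (a * b - c * d) <= normc (a - c) + normc (b - d).
Proof.
move=> ha hd; apply: le_trans (normc_dist _ _ (a * d)) _.
rewrite -mulrBr -mulrBl !normcM addrC lerD //.
  by rewrite -[leRHS]mulr1 ler_wpM2l ?normc_ge0.
by rewrite -[leRHS]mul1r ler_wpM2r ?normc_ge0.
Qed.

Lemma phase_slow (A : pred nat) r W : (forall l, A l -> prime l) -> (0 < r)%N -> (0 < W)%N ->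
  slow (phase A r W).
Proof.
move=> Ap r0 W0 j.
have k1 : (fun m => `|theta A h (m + j) - theta A h m|) @ \oo --> (0 : R).
  rewrite -[X in _ --> X](@normr0 _ R); apply: cvg_norm; exact: theta_slow.
have k2 : (fun m => normc (npow_it (r + W * (m + j)) t - npow_it (r + W * m) t)) @ \oo --> (0 : R).
  apply: npow_it_slow.
    move=> m; split; rewrite -add1n leq_add // ?leq_pmull //.
    by rewrite (leq_trans (leq_addr j m)) // leq_pmull.
  by exists (W * j)%N => m; rewrite mulnDr addnA; split=> //; rewrite -addnA leq_addr.
apply: (@squeeze_cvgr _ _ _ _ (fun=> 0) (fun m => `|theta A h (m + j) - theta A h m| +
   normc (npow_it (r + W * (m + j)) t - npow_it (r + W * m) t))).
- apply: nearW => m; rewrite normc_ge0 andTb; apply: le_trans (normcM_sub _ _ _ _) _.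
  + by rewrite normc_expi.
  + by rewrite normc_npow.
  + by rewrite lerD2r normc_expiB.
- exact: cvg_cst.
- by rewrite -[X in _ --> X](addr0 0); exact: cvgD.
Qed.

(** As q divides W, chi is constant on the class, and f = h chi n^(it) there. *)
Lemma class_concentration (A : pred nat) rho r W :
  0 < rho -> rho <= 1 -> active A h W (rho ^+ 2) ->
  (0 < r)%N -> (0 < W)%N -> coprime r W -> (q %| W)%N ->
  ubmean (fun m => normc (f (r + W * m)%N - chi r * phase A r W m)) (13 * rho).
Proof.
move=> rho0 rho1 hA r0 W0 crW qW.
have := phase_concentration (active_prime hA) hm h1 hb rho0 rho1 hA r0 W0 crW.
apply: ub_le => m; set n := (r + W * m)%N.
have cn : coprime n q.
  apply: (coprime_dvdr qW); rewrite /n -coprime_modl -modnDmr -mulnC modnMl addn0.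
  by rewrite coprime_modl.
have chin : chi n = chi r.
  by have [k Wk] := dvdnP qW; rewrite /n Wk [(k * q)%N]mulnC -mulnA (chi_addM hchi).
rewrite (twistK f t hchi cn) /phase -/n chin.
have -> : h n * (npow_it n t * chi r) - chi r * (expi (theta A h m) * npow_it n t) =
  (h n - expi (theta A h m)) * (npow_it n t * chi r) by ring.
rewrite normcM -[leRHS]mulr1 ler_wpM2l ?normc_ge0 //.
by rewrite normcM normc_npow mul1r (chi_norm_le1 hchi).
Qed.

Lemma ub_npow_slow r r' W : (0 < r)%N -> (0 < r')%N -> (0 < W)%N ->
  ubmean (fun m => normc (npow_it (r' + W * m) t - npow_it (r + W * m) t)) 0.
Proof.
move=> r0 r'0 W0; apply: ub_null; apply: npow_it_slow => [m|].
  by split; rewrite -add1n leq_add // leq_pmull.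
by exists (r + r')%N => m; split; lia.
Qed.

(** Two classes modulo W follow the same phase, since n^(it) varies slowly. *)
Lemma class_concentration_moved (A : pred nat) rho r r' W :
  0 < rho -> rho <= 1 -> active A h W (rho ^+ 2) ->
  (0 < r)%N -> (0 < r')%N -> (0 < W)%N -> coprime r' W -> (q %| W)%N ->
  ubmean (fun m => normc (f (r' + W * m)%N - chi r' * phase A r W m)) (13 * rho).
Proof.
move=> rho0 rho1 hA r0 r'0 W0 crW qW.
have u1 := class_concentration rho0 rho1 hA r'0 W0 crW qW.
have := ubD u1 (ub_npow_slow r0 r'0 W0); rewrite addr0; apply: ub_le => m.
apply: le_trans (normc_dist _ _ (chi r' * phase A r' W m)) _; rewrite lerD2l.
rewrite /phase -!mulrBr !normcM normc_expi mul1r.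
by rewrite -[leRHS]mul1r ler_wpM2r ?normc_ge0 // (chi_norm_le1 hchi).
Qed.

Lemma pick_rho (e : R) : 0 < e -> exists rho : R, [/\ 0 < rho, rho <= 1 & 13 * rho <= e].
Proof.
move=> e0; exists (Num.min 1 (e / 13)); split.
- by rewrite lt_min ltr01 divr_gt0.
- by rewrite ge_min lexx.
have : Num.min 1 (e / 13) <= e / 13 by rewrite ge_min lexx orbT.
by move: (Num.min _ _) => x; lra.
Qed.

(** On two classes modulo p^b Q, whose offsets differ by a multiple of Q, f follows one
    slowly varying w up to distinct factors F1 and F2. Averages over multiples of p^b Q
    tell the two classes apart, although functions fixed by the shift by Q cannot. *)
Definition separates (p : nat) (delta eps : R) :=
  exists Q b r k (F1 F2 : R[i]) (w : nat -> R[i]),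
  [/\ (0 < Q)%N,
      delta <= normc (F1 - F2),
      (forall m, normc (w m) = 1) /\ slow w,
      ubmean (fun m => normc (f (r + p ^ b * Q * m)%N - F1 * w m)) eps &
      ubmean (fun m => normc (f (r + k * Q + p ^ b * Q * m)%N - F2 * w m)) eps].

(** On p^s (1 + p Q m) the value f(p^s) is a factor, while on p^s + Q + p^(s+1) Q m the
    integers are prime to the modulus and the factor is chi(p^s), as q | Q. The two
    factors differ by hypothesis. *)
Lemma separates_at_prime_power p s : prime p -> ~~ (p %| q)%N -> (0 < s)%N ->
  f (p ^ s)%N <> npow_it p (s%:R * t) * chi (p ^ s)%N ->
  exists2 delta, 0 < delta & forall eps, 0 < eps -> separates p delta eps.
Proof.
move=> pp npq s0 hne.
pose F1 := f (p ^ s)%N * conjc (npow_it (p ^ s) t).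
pose F2 := chi (p ^ s)%N.
have p0 := prime_gt0 pp.
exists (normc (F1 - F2)).
  rewrite lt_neqAle normc_ge0 andbT eq_sym; apply/eqP => /eq0_normc /eqP.
  rewrite subr_eq0 => /eqP F12; apply: hne; rewrite -npow_itX // -/F2 -F12 /F1.
  by rewrite mulrC -mulrA [conjc _ * _]mulrC mulc_conj ?mulr1 // normc_npow.
move=> eps eps0; have [rho [rho0 rho1 rhoe]] := pick_rho eps0.
have r20 : 0 < rho ^+ 2 by rewrite exprn_gt0.
have [K hK] := active_coprime fb hchi hp r20.
have pq0 : (0 < p * q)%N by rewrite muln_gt0 p0.
have [L [L0 cL hL]] := smooth_modulus K pq0.
(* The first class is p^s times the class of 1 modulo W1. *)
pose Q := (q * L)%N; pose W1 := (p * Q)%N; pose W := (p ^ s.+1 * Q)%N.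
have Q0 : (0 < Q)%N by rewrite muln_gt0 q0.
have W10 : (0 < W1)%N by rewrite muln_gt0 p0.
have W0 : (0 < W)%N by rewrite muln_gt0 expn_gt0 p0.
have WE : W = (p ^ s * W1)%N by rewrite /W /W1 expnSr mulnA.
have cpQ : coprime p Q.
  rewrite /Q coprimeMr prime_coprime // npq /=.
  by rewrite coprime_sym; move: cL; rewrite coprimeMr => /andP[].
pose A l := prime l && coprime l W1.
have small l : prime l -> (l < K)%N -> (l %| W1)%N.
  move=> pl lK; rewrite /W1 /Q mulnA.
  by case: (boolP (l %| p * q)%N) => [|/hL h]; [exact: dvdn_mulr | rewrite dvdn_mull // h // ltnW].
have hA1 : active A h W1 (rho ^+ 2) by apply: hK => // l k _ ->.
have hA : active A h W (rho ^+ 2).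
  apply: (hK W1) => // [l _ cl|l k _]; rewrite WE coprimeMr; last by case/andP=> _ ->.
  by rewrite cl andbT coprimeXr //; move: cl; rewrite /W1 coprimeMr => /andP[].
have ps0 : (0 < p ^ s)%N by rewrite expn_gt0 p0.
have qW1 : (q %| W1)%N by rewrite /W1 /Q dvdn_mull // dvdn_mulr.
have qW : (q %| W)%N by rewrite WE dvdn_mull.
exists Q, s.+1, (p ^ s)%N, 1%N, F1, F2, (phase A (p ^ s) W); split => //.
- by split=> [m|]; [exact: normc_phase | exact: (phase_slow (active_prime hA))].
- apply: ub_weaken rhoe _.
  apply: ub_le (class_concentration rho0 rho1 hA1 (ltnSn 0) W10 (coprime1n _) qW1) => m.
  rewrite (chi1 hchi) mul1r -/W.
  have nE : (p ^ s + W * m = p ^ s * (1 + W1 * m))%N by rewrite WE mulnDr muln1 mulnA.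
  have n10 : (0 < 1 + W1 * m)%N by [].
  have cpn : coprime (p ^ s) (1 + W1 * m).
    rewrite coprimeXl // prime_coprime //; apply/negP.
    rewrite /W1 -mulnA dvdn_addl ?dvdn_mulr // dvdn1 => /eqP p1.
    by move: pp; rewrite p1.
  rewrite nE hf // /F1 /phase nE npow_itM //.
  have -> : f (p ^ s)%N * f (1 + W1 * m)%N - f (p ^ s)%N * conjc (npow_it (p ^ s) t) *
      (expi (theta A h m) * (npow_it (p ^ s) t * npow_it (1 + W1 * m) t)) =
     f (p ^ s)%N * (f (1 + W1 * m)%N - (npow_it (p ^ s) t * conjc (npow_it (p ^ s) t)) *
      (expi (theta A h m) * npow_it (1 + W1 * m) t)) by ring.
  rewrite mulc_conj ?normc_npow // mul1r normcM.
  by rewrite -[leRHS]mul1r ler_wpM2r ?normc_ge0.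
- apply: ub_weaken rhoe _; rewrite mul1n -/W.
  have r'0 : (0 < p ^ s + Q)%N by rewrite addn_gt0 ps0.
  have cr' : coprime (p ^ s + Q) W.
    rewrite /W coprimeMr; apply/andP; split.
      rewrite coprimeXr // coprime_sym prime_coprime //.
      rewrite dvdn_addr ?dvdn_exp //; by rewrite -prime_coprime.
    by rewrite -coprime_modl modnDr coprime_modl coprimeXl.
  have := class_concentration_moved rho0 rho1 hA ps0 r'0 W0 cr' qW.
  by have -> : chi (p ^ s + Q)%N = F2 by rewrite /Q (chi_addM hchi).
Qed.

(** Primitivity gives n1 and n2 that are equal modulo the part q' of q prime to p and
    have distinct values of chi. The Chinese remainder theorem moves them to residues
    that agree modulo Q = q' L and are prime to W = p^a Q. *)
Lemma separates_at_conductor p : primitive_character q chi -> prime p -> (p %| q)%N ->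
  exists2 delta, 0 < delta & forall eps, 0 < eps -> separates p delta eps.
Proof.
move=> hprim pp pq.
have p0 := prime_gt0 pp.
pose a := logn p q; have a0 : (0 < a)%N by rewrite logn_gt0 mem_primes pp q0.
have [q' cpq' qE'] := pfactor_coprime pp q0.
have qE : q = (p ^ a * q')%N by rewrite mulnC.
have q'0 : (0 < q')%N by case: (q') qE q0 => // ->; rewrite muln0.
have [n1 [n2 [c1 c2 n12 chi12]]] := primitive_separates hprim pp a0 qE cpq'.
exists (normc (chi n1 - chi n2)).
  rewrite lt_neqAle normc_ge0 andbT eq_sym; apply/eqP => /eq0_normc /eqP.
  by rewrite subr_eq0 => /eqP.
move=> eps eps0; have [rho [rho0 rho1 rhoe]] := pick_rho eps0.
have r20 : 0 < rho ^+ 2 by rewrite exprn_gt0.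
have [K hK] := active_coprime fb hchi hp r20.
have [L [L0 cL hL]] := smooth_modulus K q0.
have cqL : coprime q L by rewrite coprime_sym.
pose Q := (q' * L)%N; pose W := (q * L)%N.
have W0 : (0 < W)%N by rewrite muln_gt0 q0.
have Q0 : (0 < Q)%N by rewrite muln_gt0 q'0.
have WE : W = (p ^ a * Q)%N by rewrite /W {1}qE -mulnA.
have q'q : (q' %| q)%N by rewrite qE dvdn_mull.
pose A l := prime l && coprime l W.
have hA : active A h W (rho ^+ 2).
  apply: hK => // [l pl lK|l k _ -> //].
  by case: (boolP (l %| q)%N) => [|/hL h]; [exact: dvdn_mulr | rewrite dvdn_mull // h // ltnW].
have qW : (q %| W)%N by rewrite /W dvdn_mulr.
have crt n : coprime n q -> coprime (chinese q L n 1) W.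
  move=> cn; rewrite /W coprimeMr -coprime_modl chinese_modl // coprime_modl cn /=.
  by rewrite -coprime_modl chinese_modr // coprime_modl coprime1n.
(* The multiple of W makes r2 at least r1, so that r2 - r1 is a natural number. *)
pose r1 := chinese q L n1 1; pose r2 := (chinese q L n2 1 + W * r1)%N.
have cr1 : coprime r1 W := crt n1 c1.
have cr2 : coprime r2 W by rewrite -coprime_modl /r2 -modnDmr mulnC modnMl addn0 coprime_modl crt.
have r10 : (0 < r1)%N.
  rewrite lt0n; apply/eqP => r1z; move: cr1; rewrite r1z /coprime gcd0n => /eqP W1.
  have : (p %| W)%N by rewrite /W dvdn_mulr.
  by rewrite W1 dvdn1 => /eqP p1; move: pp; rewrite p1.
have r12 : (r1 <= r2)%N by rewrite /r2 (leq_trans _ (leq_addl _ _)) // leq_pmull.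
have r20' : (0 < r2)%N := leq_trans r10 r12.
have hk : (Q %| r2 - r1)%N.
  rewrite Gauss_dvd; last exact: coprime_dvdl q'q cqL.
  rewrite -!eqn_mod_dvd //; apply/andP; split; apply/eqP.
    have m1 x : chinese q L x 1 = x %[mod q'].
      by rewrite -(modn_dvdm _ q'q) chinese_modl // modn_dvdm.
    have /eqP W0q : (W * r1 %% q' == 0)%N by apply: dvdn_mulr; apply: dvdn_mulr.
    by rewrite /r2 -modnDm W0q addn0 modn_mod !m1.
  rewrite /r2 -modnDmr.
  have -> : (W * r1 = 0 %[mod L])%N by rewrite /W mulnAC modnMl mod0n.
  by rewrite mod0n addn0 !chinese_modr.
case/dvdnP: hk => k hk.
have r2E : r2 = (r1 + k * Q)%N by rewrite -hk subnKC.
have chir1 : chi r1 = chi n1 by apply: (chi_mod hchi); exact: chinese_modl.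
have chir2 : chi r2 = chi n2.
  by rewrite /r2 /W -mulnA (chi_addM hchi); apply: (chi_mod hchi); exact: chinese_modl.
exists Q, a, r1, k, (chi n1), (chi n2), (phase A r1 W); split => //.
- by split=> [m|]; [exact: normc_phase | exact: (phase_slow (active_prime hA))].
- apply: ub_weaken rhoe _; rewrite -WE -chir1.
  exact: class_concentration.
- apply: ub_weaken rhoe _; rewrite -WE -chir2 -r2E.
  exact: class_concentration_moved.
Qed.

End Classes.

(** * Almost periodicity in mean *)

Section Partition.
Variable R : realType.

(** The progression of the integers x.1 * (x.2 + W m). *)
Definition inclass (W : nat) (x : nat * nat) (n : nat) : bool :=
  inprog (x.1 * x.2) (x.1 * W) n.

(** The classes are disjoint, so that the bounds relative to each class add up. *)
Lemma ub_classes (W : nat) (s : seq (nat * nat)) (b : nat * nat -> nat -> R) e :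
  (0 < W)%N -> (forall x, x \in s -> (0 < x.1)%N) -> 0 <= e ->
  (forall x, x \in s -> ubmean (b x) e) ->
  (forall n, \sum_(x <- s) ((inclass W x n)%:R : R) <= 1) ->
  ubmean (fun n => \sum_(x <- s) spread (x.1 * x.2) (x.1 * W) (b x) n) e.
Proof.
move=> W0 s0 e0 hb hdis eta eta0.
have [C hC] : exists C, forall N, \sum_(x <- s) \sum_(n < N) spread (x.1 * x.2) (x.1 * W) (b x) n <=
    (e + eta) * (\sum_(x <- s) \sum_(n < N) ((inclass W x n)%:R : R)) + C.
  elim: s s0 hb {hdis} => [|x s IH] s0 hb.
    by exists 0 => N; rewrite !big_nil mulr0 addr0.
  have [||C hC] := IH.
  - by move=> y ys; apply: s0; rewrite inE ys orbT.
  - by move=> y ys; apply: hb; rewrite inE ys orbT.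
  have xW0 : (0 < x.1 * W)%N by rewrite muln_gt0 s0 ?mem_head.
  have [C' hC'] := ub_prog (x.1 * x.2) xW0 (hb _ (mem_head _ _)) eta0.
  exists (C' + C) => N; rewrite !big_cons mulrDr addrACA lerD //.
  apply: le_trans (hC' N) _; rewrite lerD2r ler_wpM2l ?addr_ge0 ?(ltW eta0) //.
  by apply: ler_sum => n _; rewrite /spread /inclass; case: ifP.
exists C => N; rewrite exchange_big /=; apply: le_trans (hC N) _.
rewrite lerD2r ler_wpM2l ?addr_ge0 ?(ltW eta0) // exchange_big /=.
apply: (@le_trans _ _ (\sum_(n < N) 1)); first by apply: ler_sum => n _; exact: hdis.
by rewrite sumr_const card_ord.
Qed.

Definition index_set (D W : nat) : seq (nat * nat) :=
  [seq (d, r) | d <- divisors D, r <- [seq r <- iota 1 W | coprime r W]].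

Lemma index_setP D W x : (0 < D)%N -> x \in index_set D W ->
  [/\ (0 < x.1)%N, (x.1 %| D)%N, (0 < x.2)%N, (x.2 <= W)%N & coprime x.2 W].
Proof.
move=> D0 /allpairsP[[d r] /= [hd hr ->]] /=.
rewrite -dvdn_divisors // in hd; move: hr; rewrite mem_filter mem_iota => /and3P[cr r0 rW].
by split => //; exact: dvdn_gt0 hd.
Qed.

(** A term n = d (r + W m) has gcd d with W^e, because r + W m is prime to W. *)
Lemma class_unique D W e n x : (0 < W)%N -> D = (W ^ e)%N -> x \in index_set D W ->
  inclass W x n -> x = (gcdn n D, ((n %/ gcdn n D - 1) %% W).+1).
Proof.
move=> W0 DE hx.
have D0 : (0 < D)%N by rewrite DE expn_gt0 W0.
have [d0 dD r0 rW cr] := index_setP D0 hx.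
case: x hx d0 dD r0 rW cr => d r /= hx d0 dD r0 rW cr /andP[/= hn /dvdnP[m hm]].
have nE : n = (d * (r + W * m))%N by rewrite -(subnKC hn) hm; ring.
have cop : coprime (r + W * m) W.
  by rewrite -coprime_modl -modnDmr mulnC modnMl addn0 coprime_modl.
have gE : gcdn n D = d.
  case/dvdnP: dD => k kE.
  have ck : coprime (r + W * m) k.
    apply: (@coprime_dvdr _ D); first by rewrite kE dvdn_mulr.
    by rewrite DE coprimeXr.
  by rewrite nE kE [(k * d)%N]mulnC -muln_gcdr (eqP ck) muln1.
rewrite gE nE mulKn //; congr (_, _).
have -> : (r + W * m - 1 = r.-1 + m * W)%N by lia.
by rewrite addnC modnMDl modn_small; lia.
Qed.

Lemma index_set_disjoint D W e n : (0 < W)%N -> D = (W ^ e)%N ->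
  \sum_(x <- index_set D W) ((inclass W x n)%:R : R) <= 1.
Proof.
move=> W0 DE; pose x0 := (gcdn n D, ((n %/ gcdn n D - 1) %% W).+1).
have un : uniq (index_set D W).
  apply: allpairs_uniq; [exact: divisors_uniq | by rewrite filter_uniq // iota_uniq | ].
  by move=> [? ?] [? ?].
apply: (@le_trans _ _ (\sum_(x <- index_set D W) ((x == x0)%:R : R))).
  rewrite big_seq [leRHS]big_seq; apply: ler_sum => x hx.
  case: (boolP (inclass W x n)) => [/(class_unique W0 DE hx) ->|_] /=; last by rewrite ler0n.
  by rewrite eqxx.
rewrite -natr_sum (ler_nat R _ 1).
have -> : (\sum_(x <- index_set D W) (x == x0) = count_mem x0 (index_set D W))%N.
  by rewrite -sum1_count [RHS]big_mkcond; apply: eq_bigr => x _ /=; case: eqP.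
by rewrite count_uniq_mem // leq_b1.
Qed.

(** Divide n by its gcd d with W^e. If the quotient is not prime to W, a common prime l
    divides n more often than it divides W^e, hence at least e times. *)
Lemma class_cover D W e n : (0 < W)%N -> D = (W ^ e)%N -> (0 < n)%N ->
  (exists2 x, x \in index_set D W & inclass W x n) \/
  (exists l, [/\ prime l, (l <= W)%N & (l ^ e %| n)%N]).
Proof.
move=> W0 DE n0.
have D0 : (0 < D)%N by rewrite DE expn_gt0 W0.
pose d := gcdn n D; have dn : (d %| n)%N := dvdn_gcdl _ _.
have d0 : (0 < d)%N by rewrite gcdn_gt0 n0.
pose n' := (n %/ d)%N; have nE : n = (d * n')%N by rewrite /n' mulnC divnK.
have n'0 : (0 < n')%N by rewrite divn_gt0 // dvdn_leq.
have [cn|ncn] := boolP (coprime n' W).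
  left; exists (d, ((n' - 1) %% W).+1).
    apply/allpairsP; exists (d, ((n' - 1) %% W).+1); split => //=.
      by rewrite -dvdn_divisors // dvdn_gcdr.
    have zW : ((n' - 1) %% W < W)%N by rewrite ltn_pmod.
    rewrite mem_filter mem_iota; apply/andP; split; last by lia.
    have := cn; rewrite -coprime_modl; congr is_true.
    by rewrite -[in RHS]coprime_modl -addn1 modnDml subnK.
  rewrite /inclass /inprog /=.
  have h : (n' = ((n' - 1) %% W).+1 + W * ((n' - 1) %/ W))%N.
    by rewrite addSn addnC mulnC -divn_eq; lia.
  rewrite nE leq_mul2l {2}h leq_addr orbT /= -mulnBr {1}h addKn mulnA.
  by rewrite dvdn_mulr.
right; have [l [pl ln lW]] : exists l, [/\ prime l, (l %| n')%N & (l %| W)%N].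
  have g0 : (0 < gcdn n' W)%N by rewrite gcdn_gt0 n'0.
  have g1 : (1 < gcdn n' W)%N by move: ncn g0; rewrite /coprime; case: (gcdn _ _) => [|[|]].
  exists (pdiv (gcdn n' W)); split; first exact: pdiv_prime.
    exact: dvdn_trans (pdiv_dvd _) (dvdn_gcdl _ _).
  exact: dvdn_trans (pdiv_dvd _) (dvdn_gcdr _ _).
exists l; split=> //; first exact: dvdn_leq.
have k1 : (0 < logn l n')%N by rewrite logn_gt0 mem_primes pl n'0.
have k2 : logn l n = (logn l d + logn l n')%N by rewrite {1}nE lognM.
have k3 : logn l d = minn (logn l n) (logn l D) by rewrite /d logn_gcd.
have k4 : logn l D = (e * logn l W)%N by rewrite DE lognX.
have k5 : (0 < logn l W)%N by rewrite logn_gt0 mem_primes pl W0.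
rewrite pfactor_dvdn //; have : (e <= logn l D)%N by rewrite k4 leq_pmulr.
lia.
Qed.

End Partition.

Section AlmostPeriod.
Variable R : realType.
Variables (f : nat -> R[i]) (t : R) (q : nat) (chi : nat -> R[i]).
Hypotheses (fb : forall n, normc (f n) <= 1).
Hypotheses (hf : multiplicative_fun f) (hchi : dirichlet_character q chi).
Hypothesis hp : pretends f (fun n => npow_it n t * chi n).
Variable p : nat.
Hypotheses (pp : prime p) (npq : ~~ (p %| q)%N).
Hypothesis fps : forall s, (0 < s)%N -> f (p ^ s)%N = npow_it p (s%:R * t) * chi (p ^ s)%N.
Local Notation h := (twist f t chi).
Let q0 : (0 < q)%N := chi_gt0 hchi.

Lemma twist_prime_power s : (0 < s)%N -> h (p ^ s)%N = 1.
Proof.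
move=> s0; rewrite /twist fps // npow_itX ?prime_gt0 // mulc_conj //.
rewrite normcM normc_npow mul1r (chi_norm hchi) //.
by rewrite coprimeXl // prime_coprime.
Qed.

(** Moving d (r + W m) by the multiple Q of d W changes only m, by a fixed amount, and
    f(d (r + W m)) = f(d) f(r + W m) follows a slow phase. *)
Lemma class_almost_period (A : pred nat) rho W e Q x :
  0 < rho -> rho <= 1 -> active A h W (rho ^+ 2) -> (0 < W)%N -> (q %| W)%N ->
  (W ^ e.+1 %| Q)%N -> x \in index_set (W ^ e) W ->
  ubmean (fun m => normc (f (x.1 * (x.2 + W * m) + Q)%N - f (x.1 * (x.2 + W * m))%N)) (26 * rho).
Proof.
move=> rho0 rho1 hA W0 qW dQ hx.
have D0 : (0 < W ^ e)%N by rewrite expn_gt0 W0.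
have [] := index_setP D0 hx; case: x {hx} => d r /= d0 dD r0 rW cr.
have u := class_concentration fb hf hchi hp rho0 rho1 hA r0 W0 cr qW.
have /dvdnP[k QE] : (d * W %| Q)%N.
  by apply: dvdn_trans dQ; rewrite expnSr dvdn_mul.
have sl := ub_null (phase_slow t fb hchi (active_prime hA) r0 W0 k).
have := ubD (ubD (ub_shift k u) u) sl.
rewrite addr0 (_ : 13 * rho + 13 * rho = 26 * rho); last by ring.
apply: ub_le => m.
set n := (r + W * m)%N; set n' := (r + W * (m + k))%N.
have cop j : coprime d (r + W * j).
  apply: (@coprime_dvdl _ (W ^ e)) => //; rewrite coprimeXl // coprime_sym.
  by rewrite -coprime_modl -modnDmr mulnC modnMl addn0 coprime_modl.
have n0 j : (0 < r + W * j)%N by rewrite addn_gt0 r0.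
have -> : (d * n + Q = d * n')%N by rewrite QE /n /n'; ring.
rewrite !hf //; try exact: n0; try exact: cop.
rewrite -mulrBr normcM.
apply: le_trans (ler_wpM2r (normc_ge0 _) (fb d)) _; rewrite mul1r.
set F := chi r; set w := phase _ _ _ _ _ _.
have -> : f n' - f n = (f n' - F * w (m + k)%N) - (f n - F * w m) + F * (w (m + k)%N - w m) by ring.
apply: le_trans (normcD _ _) _; apply: lerD.
  by apply: le_trans (normcD _ _) _; rewrite normcN.
rewrite normcM -[leRHS]mul1r ler_wpM2r ?normc_ge0 //.
exact: (chi_norm_le1 hchi).
Qed.

(** The modulus W can be taken prime to p, as h = 1 at the powers of p, so that
    Q = W^((e+1)(p-1)) is 1 modulo p. It is also a multiple of d W for each d | W^e,
    hence an almost period on every class. The integers in no class are multiples of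
    l^e for a prime l | W; they are rare for large e. *)
Lemma almost_period (eps : R) : 0 < eps -> exists2 Q, Q = 1 %[mod p] &
  ubmean (fun n => normc (f (n + Q)%N - f n)) eps.
Proof.
move=> eps0; have [rho [rho0 rho1 rhoe]] : exists rho : R, [/\ 0 < rho, rho <= 1 & 13 * rho <= eps / 4].
  by apply: pick_rho; rewrite divr_gt0.
have r20 : 0 < rho ^+ 2 by rewrite exprn_gt0.
have [K hK] := active_coprime fb hchi hp r20.
have p0 := prime_gt0 pp.
have pq0 : (0 < p * q)%N by rewrite muln_gt0 p0.
have [L [L0 cL hL]] := smooth_modulus K pq0.
pose W := (q * L)%N.
have W0 : (0 < W)%N by rewrite muln_gt0 q0.
have cpW : coprime p W.
  rewrite /W coprimeMr prime_coprime // npq /=.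
  by rewrite coprime_sym; move: cL; rewrite coprimeMr => /andP[].
pose A l := prime l && coprime l (p * W).
have hA : active A h W (rho ^+ 2).
  apply: hK => [l pl lK|l _|l k pl cl].
  - rewrite /W mulnA; case: (boolP (l %| p * q)%N) => [|/hL h']; first exact: dvdn_mulr.
    by rewrite dvdn_mull // h' // ltnW.
  - by rewrite coprimeMr => /andP[].
  - rewrite coprimeMr cl andbT prime_coprime // negbK dvdn_prime2 // => /eqP -> k0.
    exact: twist_prime_power.
have qW : (q %| W)%N by rewrite /W dvdn_mulr.
(* The multiples of l^e for the at most W primes l <= W have density at most W / 2^e. *)
have [e he] : exists e : nat, 4 * W.+1%:R / eps < (2 ^ e)%:R.
  exists (Num.truncn (4 * W.+1%:R / eps)).+1; apply: lt_trans (truncnS_gt _) _.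
  by rewrite ltr_nat ltn_expl.
pose Q := (W ^ (e.+1 * p.-1))%N.
have dQ : (W ^ e.+1 %| Q)%N.
  by rewrite /Q dvdn_exp2l // leq_pmulr // -subn1 subn_gt0 prime_gt1.
exists Q.
  have cWp : coprime (W ^ e.+1) p by rewrite coprimeXl // coprime_sym.
  by have := Euler_exp_totient cWp; rewrite totient_prime // -expnM.
pose s := [seq l <- iota 0 W | prime l.+1].
pose b (x : nat * nat) m := normc (f (x.1 * (x.2 + W * m) + Q)%N - f (x.1 * (x.2 + W * m))%N).
have D0 : (0 < W ^ e)%N by rewrite expn_gt0 W0.
have u1 : ubmean (fun n => \sum_(x <- index_set (W ^ e) W)
    spread (x.1 * x.2) (x.1 * W) (b x) n) (26 * rho).
  apply: ub_classes => //.
  - by move=> x /(index_setP D0)[].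
  - by rewrite mulr_ge0 // ltW.
  - by move=> x hx; exact: (class_almost_period rho0 rho1 hA W0 qW dQ hx).
  - by move=> n; exact: index_set_disjoint.
have u2 : ubmean (fun n => \sum_(l <- s) 2 * spread 0 (l.+1 ^ e) (fun=> (1 : R)) n)
    (\sum_(l <- s) 2 * (1 / (l.+1 ^ e)%N%:R)).
  by apply: ub_sum => l; apply: ubZ => //; apply: ub_spread (ub_cst 1); rewrite ?expn_gt0.
have small : \sum_(l <- s) 2 * (1 / (l.+1 ^ e)%N%:R) <= eps / 2 :> R.
  have e20 : 0 < (2 ^ e)%:R :> R by rewrite ltr0n expn_gt0.
  apply: (@le_trans _ _ (\sum_(l <- iota 0 W) (2 * (1 / (2 ^ e)%:R)))).
    rewrite /s big_filter big_mkcond /=; apply: ler_sum => l _; case: ifP => [pl|_]; last first.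
      by rewrite mulr_ge0 // divr_ge0.
    rewrite ler_wpM2l // !mul1r lef_pV2 ?posrE ?ltr0n ?expn_gt0 // ler_nat.
    by case: (e) => [|e']; rewrite ?expn0 // leq_exp2r // prime_gt1.
  rewrite big_const_seq count_predT size_iota iter_addr addr0 -[leLHS]mulr_natr mul1r.
  rewrite mulrAC ler_pdivrMr //.
  by move: he; rewrite ltr_pdivrMr // -[W.+1%:R]natr1; move: (W%:R) ((2 ^ e)%:R) => w z; nra.
have := ubD u1 u2 => u; apply: ub_weaken (_ : 26 * rho + \sum_(l <- s) 2 * (1 / (l.+1 ^ e)%N%:R) <= _) _.
  by move: small rhoe; move: (\sum_(l <- s) _) => x; lra.
have S10 n x : 0 <= spread (x.1 * x.2) (x.1 * W) (b x) n.
  by rewrite /spread; case: ifP => // _; exact: normc_ge0.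
have S20 n l : 0 <= 2 * spread 0 (l.+1 ^ e) (fun=> (1 : R)) n.
  by rewrite mulr_ge0 // /spread; case: ifP.
apply: (@ub_eventually _ _ _ _ 1) u => n n0.
have [[x hx cx]|[l [pl lW ln]]] := @class_cover (W ^ e) W e n W0 erefl n0.
  rewrite (big_rem x) //= -[leLHS]addr0 -addrA lerD //; last first.
    by rewrite addr_ge0 ?sumr_ge0.
  rewrite /spread -/(inclass W x n) cx /b.
  have -> : (x.1 * (x.2 + W * ((n - x.1 * x.2) %/ (x.1 * W))) = n)%N.
    have /andP[h1 h2] := cx.
    by rewrite mulnDr mulnA [X in (_ + X)%N]mulnC divnK // subnKC.
  exact: lexx.
have hl : l.-1 \in s.
  by rewrite mem_filter prednK ?prime_gt0 // pl mem_iota /= add0n prednK ?prime_gt0.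
apply: (@le_trans _ _ (0 + 2 * spread 0 (l.-1.+1 ^ e) (fun=> 1) n)); last first.
  by rewrite lerD ?sumr_ge0 // [leRHS](big_rem l.-1) //= lerDl sumr_ge0.
rewrite prednK ?prime_gt0 // /spread /inprog /= subn0 ln mulr1 add0r.
by apply: le_trans (normcD _ _) _; rewrite normcN (_ : 2 = 1 + 1) // lerD.
Qed.

End AlmostPeriod.

(** * Block averages *)

Section Blocks.
Variable R : realType.
Variable f : nat -> R[i].

Definition block M W n : R[i] := (M%:R^-1)%:C%C * \sum_(0 <= i < M) f (n + W * i)%N.

(** On the class of r the blocks at n and n + k Q follow F1 w and F2 w. This class has
    density 1 / (p^b Q), and the error e n absorbs the other integers, so that the
    inequality holds for all n and can be integrated. *)
Lemma block_gap p delta eps : (0 < p)%N -> 0 < delta -> 0 <= eps -> separates f p delta eps ->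
  exists Q b k, (0 < Q)%N /\ forall M, (0 < M)%N ->
    exists2 e : nat -> R, ubmean e (2 * eps / (p ^ b * Q)%:R) &
    forall n, delta / (p ^ b * Q)%:R <=
      normc (block M (p ^ b * Q) (n + k * Q)%N - block M (p ^ b * Q) n) + e n.
Proof.
move=> p0 delta0 eps0 [Q [b [r [k [F1 [F2 [w [Q0 F12 [w1 sw] h1 h2]]]]]]]].
exists Q, b, k; split=> // M M0.
set W := (p ^ b * Q)%N in h1 h2 *.
have W0 : (0 < W)%N by rewrite muln_gt0 expn_gt0 p0.
have MR : 0 < M%:R :> R by rewrite ltr0n.
pose al m := normc (f (r + W * m)%N - F1 * w m).
pose al' m := normc (f (r + k * Q + W * m)%N - F2 * w m).
pose dr i m := (normc F1 + normc F2) * normc (w (m + i)%N - w m).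
pose stuff m := M%:R^-1 * \sum_(0 <= i < M) (al (m + i)%N + al' (m + i)%N + dr i m).
have ub_stuff : ubmean stuff (2 * eps).
  have sum2 : \sum_(0 <= i < M) (2 * eps) = M%:R * (2 * eps).
    by rewrite big_const_nat subn0 iter_addr addr0 [RHS]mulr_natl.
  rewrite -[X in ubmean _ X](mulKf (lt0r_neq0 MR)) -sum2; apply: ubZ; first by rewrite invr_ge0.
  apply: ub_sum => i; rewrite mulr_natl mulr2n -[X in ubmean _ X]addr0; apply: ubD.
    by apply: ubD; exact: ub_shift.
  rewrite -(mulr0 (normc F1 + normc F2)); apply: ubZ; first by rewrite addr_ge0 ?normc_ge0.
  exact/ub_null/sw.
exists (fun n => delta * (W%:R^-1 - spread r W (fun=> 1) n) + spread r W stuff n).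
  rewrite -[X in ubmean _ X]add0r; apply: ubD; last by apply: ub_spread; rewrite ?mulr_ge0.
  by rewrite -(mulr0 delta); apply: ubZ; [exact: ltW | exact: ub_spread_compl].
move=> n; rewrite /spread; case: ifP => [/andP[rn /dvdnP[m nE]]|_]; last first.
  by rewrite subr0 addr0 lerDr normc_ge0.
have -> : ((n - r) %/ W = m)%N by rewrite nE mulnK.
have {nE} -> : n = (r + W * m)%N by rewrite mulnC -nE subnKC.
suff : delta <= normc (block M W (r + W * m + k * Q)%N - block M W (r + W * m)%N) + stuff m.
  by move: (normc _) (stuff m) => x y; lra.
rewrite /block -mulrBr normcM normc_real ?invr_ge0 // /stuff -mulrDr.
rewrite ler_pdivlMl // -sumrB.
have const : M%:R * delta <= normc (\sum_(0 <= i < M) (F2 - F1) * w m).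
  rewrite big_const_nat subn0 iter_addr addr0 -[X in normc X]mulr_natl normcM.
  rewrite normcM w1 mulr1 [normc (F2 - F1)]normcB.
  have -> : normc (M%:R : R[i]) = M%:R.
    by rewrite -(@normc_real R M%:R) // rmorph_nat.
  by rewrite ler_pM2l.
apply: le_trans const _.
pose diff i := f (r + W * m + k * Q + W * i)%N - f (r + W * m + W * i)%N.
apply: le_trans (le_trans _ (normcD (\sum_(0 <= i < M) diff i)
  (\sum_(0 <= i < M) ((F2 - F1) * w m - diff i)))) _.
  by rewrite -big_split /=; apply: ler_eq; congr normc; apply: eq_bigr => i _; rewrite addrC subrK.
rewrite lerD2l; apply: le_trans (normc_sum _ _) _; apply: ler_sum => i _; rewrite /diff.
have -> : (r + W * m + k * Q + W * i = r + k * Q + W * (m + i))%N by rewrite mulnDr; lia.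
have -> : (r + W * m + W * i = r + W * (m + i))%N by rewrite mulnDr addnA.
rewrite /dr -/(al _) -/(al' _).
have -> : (F2 - F1) * w m - (f (r + k * Q + W * (m + i))%N - f (r + W * (m + i))%N) =
   (f (r + W * (m + i))%N - F1 * w (m + i)%N) - (f (r + k * Q + W * (m + i))%N - F2 * w (m + i)%N)
   + ((F1 - F2) * (w (m + i)%N - w m)) by ring.
apply: le_trans (normcD _ _) _; apply: lerD.
  by apply: le_trans (normcD _ _) _; rewrite normcN.
rewrite normcM ler_wpM2r ?normc_ge0 //.
by apply: le_trans (normcD _ _) _; rewrite normcN.
Qed.

End Blocks.

(** * Expectations of bounded measurable functions *)

Section Expectation.
Context {d : measure_display} {T : measurableType d} {R : realType}.
Implicit Types (P : probability T R) (u v : T -> R).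

Definition bmeas u :=
  measurable_fun setT u /\ exists B, forall x, `|u x| <= B.

Definition Ex P u : R := (\int[P]_x u x)%R.

Lemma bmeas_integrable P u : bmeas u -> P.-integrable setT (EFin \o u).
Proof.
move=> [mu [B hB]]; apply: measurable_bounded_integrable => //.
  by rewrite ltey_eq fin_num_measure.
exists B; split; first by rewrite num_real.
by move=> x Bx y _ /=; exact: (le_trans (hB y) (ltW Bx)).
Qed.

Lemma bmeas_cst c : bmeas (fun=> c).
Proof. by split=> //; exists `|c|. Qed.

Lemma bmeasD u v : bmeas u -> bmeas v -> bmeas (fun x => u x + v x).
Proof.
move=> [mu [B hB]] [mv [C hC]]; split; first exact: measurable_funD.
exists (B + C) => x; apply: (le_trans (ler_normD _ _)); exact: lerD.
Qed.

Lemma bmeasM u v : bmeas u -> bmeas v -> bmeas (fun x => u x * v x).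
Proof.
move=> [mu [B hB]] [mv [C hC]]; split; first exact: measurable_funM.
by exists (B * C) => x; rewrite normrM; exact: ler_pM.
Qed.

Lemma bmeasZ c u : bmeas u -> bmeas (fun x => c * u x).
Proof. by apply: bmeasM; exact: bmeas_cst. Qed.

Lemma bmeasN u : bmeas u -> bmeas (fun x => - u x).
Proof.
move=> /(@bmeasZ (-1)) h.
by rewrite (_ : (fun x => - u x) = (fun x => -1 * u x)) //; apply/funext => x; rewrite mulN1r.
Qed.

Lemma bmeasB u v : bmeas u -> bmeas v -> bmeas (fun x => u x - v x).
Proof. by move=> hu /bmeasN; exact: bmeasD. Qed.

Lemma bmeas_norm u : bmeas u -> bmeas (fun x => `|u x|).
Proof.
move=> [mu [B hB]]; split; first exact: measurableT_comp.
by exists B => x; rewrite normr_id.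
Qed.

Lemma bmeas_sqr u : bmeas u -> bmeas (fun x => u x ^+ 2).
Proof. by move=> h; have := bmeasM h h. Qed.

Lemma bmeas_max u v : bmeas u -> bmeas v -> bmeas (fun x => Num.max (u x) (v x)).
Proof.
move=> [mu [B hB]] [mv [C hC]]; split; first exact: measurable_maxr.
exists (B + C) => x; have B0 := le_trans (normr_ge0 _) (hB x).
have C0 := le_trans (normr_ge0 _) (hC x).
rewrite /Num.max; case: ifP => _; first by rewrite (le_trans (hC x))// lerDr.
by rewrite (le_trans (hB x))// lerDl.
Qed.

Lemma bmeas_indic A : measurable A -> bmeas (\1_A : T -> R).
Proof.
move=> mA; split; first exact: measurable_indic.
by exists 1 => x; rewrite indicE; case: (_ \in _); rewrite ?normr1// normr0.
Qed.

Lemma bmeas_comp (S : T -> T) u :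
  measurable_fun setT S -> bmeas u -> bmeas (fun x => u (S x)).
Proof.
move=> mS [mu [B hB]]; split; first exact: measurableT_comp.
by exists B => x.
Qed.

Variable P : probability T R.
Local Notation E := (Ex P).

Lemma Ex_cst c : E (fun=> c) = c.
Proof. by rewrite /Ex Rintegral_cst//= probability_setT mulr1. Qed.

Lemma ExD u v : bmeas u -> bmeas v -> E (fun x => u x + v x) = E u + E v.
Proof. by move=> hu hv; rewrite /Ex RintegralD //; exact: bmeas_integrable. Qed.

Lemma ExB u v : bmeas u -> bmeas v -> E (fun x => u x - v x) = E u - E v.
Proof. by move=> hu hv; rewrite /Ex RintegralB //; exact: bmeas_integrable. Qed.

Lemma ExZ c u : bmeas u -> E (fun x => c * u x) = c * E u.
Proof. by move=> hu; rewrite /Ex RintegralZl //; exact: bmeas_integrable. Qed.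

Lemma le_Ex u v : bmeas u -> bmeas v -> (forall x, u x <= v x) -> E u <= E v.
Proof. by move=> hu hv uv; apply: le_Rintegral => //; exact: bmeas_integrable. Qed.

Lemma Ex_ge0 u : (forall x, 0 <= u x) -> 0 <= E u.
Proof. by move=> h; apply: Rintegral_ge0. Qed.

Lemma ler_norm_Ex u : bmeas u -> `|E u| <= E (fun x => `|u x|).
Proof. by move=> hu; apply: le_normr_Rintegral => //; exact: bmeas_integrable. Qed.

Lemma Ex_ae_eq0 u : bmeas u -> (forall x, 0 <= u x) -> E u = 0 ->
  {ae P, forall x, u x = 0}.
Proof.
move=> hu u0 Eu.
have /= := @ae_eq_integral_abs _ _ _ P setT measurableT (EFin \o u).
have mu : measurable_fun [set: T] (EFin \o u) by apply/measurable_EFinP; exact: hu.1.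
move=> /(_ mu) [+ _].
have -> : (\int[P]_x `|(u x)%:E| = 0)%E.
  have h := integrable_fin_num measurableT (bmeas_integrable P hu).
  under eq_integral => x _ do rewrite gee0_abs ?lee_fin//.
  by rewrite -(fineK h) -[fine _]/(E u) Eu.
move=> /(_ erefl); apply: filterS => x /= /(_ I)/=.
by move=> [].
Qed.

Lemma Ex_ae_eq u v : bmeas u -> bmeas v -> {ae P, forall x, u x = v x} -> E u = E v.
Proof.
move=> hu hv huv; rewrite /Ex /Rintegral; congr fine.
apply: ae_eq_integral => //; try (apply/measurable_EFinP).
- exact: hu.1.
- exact: hv.1.
by apply: filterS huv => x /= ->.
Qed.

Lemma Ex_dist_trans u v w : bmeas u -> bmeas v -> bmeas w ->
  E (fun x => `|u x - w x|) <= E (fun x => `|u x - v x|) + E (fun x => `|v x - w x|).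
Proof.
move=> hu hv hw.
have h1 := bmeas_norm (bmeasB hu hv); have h2 := bmeas_norm (bmeasB hv hw).
rewrite -ExD //; apply: le_Ex; [exact: bmeas_norm (bmeasB hu hw)|exact: bmeasD|].
by move=> x; exact: ler_distD.
Qed.

Lemma Ex_dist_comb c c' u v u' v' : bmeas u -> bmeas v -> bmeas u' -> bmeas v' ->
  E (fun x => `|(c * u x + c' * v x) - (c * u' x + c' * v' x)|) <=
  `|c| * E (fun x => `|u x - u' x|) + `|c'| * E (fun x => `|v x - v' x|).
Proof.
move=> hu hv hu' hv'.
have h1 := bmeas_norm (bmeasB hu hu'); have h2 := bmeas_norm (bmeasB hv hv').
rewrite -!ExZ // -ExD; [|exact: bmeasZ..]; apply: le_Ex.
- by apply: bmeas_norm; apply: bmeasB; apply: bmeasD; exact: bmeasZ.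
- by apply: bmeasD; exact: bmeasZ.
move=> x; rewrite -!normrM; apply: le_trans (ler_normD _ _).
by apply: ler_eq; congr `|_|; ring.
Qed.

Lemma Ex_dist_max u v u' v' : bmeas u -> bmeas v -> bmeas u' -> bmeas v' ->
  E (fun x => `|Num.max (u x) (v x) - Num.max (u' x) (v' x)|) <=
  E (fun x => `|u x - u' x|) + E (fun x => `|v x - v' x|).
Proof.
move=> hu hv hu' hv'.
have h1 := bmeas_norm (bmeasB hu hu'); have h2 := bmeas_norm (bmeasB hv hv').
rewrite -ExD //; apply: le_Ex; [|exact: bmeasD|].
  by apply: bmeas_norm; apply: bmeasB; exact: bmeas_max.
move=> x; move: (u x) (v x) (u' x) (v' x) => a b a' b'.
have := lexx `|a - a'|; rewrite {1}ler_norml => /andP[a1 a2].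
have := lexx `|b - b'|; rewrite {1}ler_norml => /andP[a3 a4].
have b1 := normr_ge0 (a - a'); have b2 := normr_ge0 (b - b').
rewrite ler_norml; case: (leP a b) => c1; case: (leP a' b') => c2; lra.
Qed.

End Expectation.

(** * The shift space *)

Section Coordinates.
Variable R : realType.
Notation X := (shift_space R).

Definition reC (k : int) (x : X) : R := complex.Re (x k : R[i]).
Definition imC (k : int) (x : X) : R := complex.Im (x k : R[i]).

Lemma lipschitz_continuous (part : R[i] -> R) :
  (forall z w, `|part z - part w| <= normc (z - w)) -> continuous (part : R[i]^o -> R).
Proof.
move=> lip z A [e /= e0 hA]; exists e%:C%C; first by rewrite /= ltcR.
by move=> w /=; rewrite normc_def2 ltcR => h; apply: hA; exact: le_lt_trans (lip z w) h.
Qed.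


Lemma disc_val_continuous : continuous (@disc_val R : disc R -> R[i]^o).
Proof. exact: initial_continuous. Qed.

Lemma coord_continuous k : continuous ((fun x => x k) : X -> disc R).
Proof. exact: (@proj_continuous int (fun=> disc R) k). Qed.

Lemma coord_part_continuous (part : R[i] -> R) k :
  (forall z w, `|part z - part w| <= normc (z - w)) ->
  continuous (fun x : X => part (x k : R[i])).
Proof.
move=> lip x.
apply: (@continuous_comp _ _ _ (fun x : X => x k) (fun z : disc R => part (z : R[i]))).
  exact: coord_continuous.
apply: (@continuous_comp _ _ _ (@disc_val R : disc R -> R[i]^o)).
  exact: disc_val_continuous.
exact: lipschitz_continuous.
Qed.

Lemma reC_continuous k : continuous (reC k).
Proof. exact: (@coord_part_continuous (@complex.Re R) k (@Re_lipschitz R)). Qed.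

Lemma imC_continuous k : continuous (imC k).
Proof. exact: (@coord_part_continuous (@complex.Im R) k (@Im_lipschitz R)). Qed.

Lemma cvg_coord (F : set_system X) (x : X) : Filter F ->
  (forall k, (fun y : X => y k) @ F --> x k) -> F --> x.
Proof.
move=> FF h.
apply: (iffRL (@cvg_sup (forall i : int, disc R) int (fun i => Topological.class
    (initial_topology (fun f : (forall i : int, disc R) => f i))) F x FF)).
move=> k A [B [[C oC <-] Cx] CA].
apply: filterS CA _; apply: h; exact: open_nbhs_nbhs.
Qed.

Lemma shift_continuous : continuous (@left_shift R : X -> X).
Proof.
move=> x.
have FF := @fmap_filter _ _ (@left_shift R : X -> X) _ (nbhs_filter x).
apply: (@cvg_coord _ (left_shift x) FF) => k A hA.
exact: (@coord_continuous (k + 1) x A hA).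
Qed.

(** The sets on the right form a filter that converges to x in each coordinate. *)
Lemma nbhs_coord (x : X) (U : set X) : nbhs x U ->
  exists (s : seq int) (e : R), 0 < e /\
   forall y : X, (forall k, k \in s ->
     `|reC k x - reC k y| < e /\ `|imC k x - imC k y| < e) -> U y.
Proof.
pose F : set_system X := fun U => exists (s : seq int) (e : R), 0 < e /\
   forall y : X, (forall k, k \in s ->
     `|reC k x - reC k y| < e /\ `|imC k x - imC k y| < e) -> U y.
have FF : Filter F.
  split.
  - by exists [::], 1; split.
  - move=> A B [s [e [e0 hA]]] [s' [e' [e0' hB]]].
    exists (s ++ s'), (Num.min e e'); split; first by rewrite lt_min e0.
    move=> y hy; split.
      apply: hA => k ks; have [|] := hy k; first by rewrite mem_cat ks.
      by rewrite !lt_min => /andP[-> _] /andP[-> _].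
    apply: hB => k ks; have [|] := hy k; first by rewrite mem_cat ks orbT.
    by rewrite !lt_min => /andP[_ ->] /andP[_ ->].
  - by move=> A B AB [s [e [e0 hA]]]; exists s, e; split=> // y /hA /AB.
suff : F --> x by move=> h; exact: h.
apply: cvg_coord => k C.
move=> [C' [[D oD <-] Dx] DC].
have : nbhs (disc_val (x k) : R[i]^o) D by exact: open_nbhs_nbhs.
move=> [e /= e0 eD].
exists [:: k], (complex.Re e / 2); split.
  by move: e0; case: (e) => a b; rewrite ltcE /= => /andP[_ a0]; rewrite divr_gt0.
move=> y /(_ k (mem_head _ _)) [h1 h2]; apply: DC; apply: eD => /=.
rewrite normc_def2.
have : e = (complex.Re e)%:C%C.
  by move: e0; case: (e) => a b; rewrite ltcE /= => /andP[/eqP -> _].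
move=> ->; rewrite ltcR.
apply: le_lt_trans (ler_normc_ReIm _) _.
rewrite ReB ImB; move: h1 h2; rewrite /reC /imC => h1 h2.
by rewrite [ltRHS]splitr ltrD.
Qed.

Definition halfspaces : set_system X :=
  [set A | exists k a, A = [set x | a < reC k x] \/ A = [set x | a < imC k x]].

Lemma reC_measurable_half k :
  measurable_fun setT (reC k : g_sigma_algebraType halfspaces -> R).
Proof.
apply: (measurability _ (RGenOInfty.measurableE R)) => //.
move=> _ [_ [a ->] <-]; rewrite setTI; apply: sub_sigma_algebra.
exists k, a; left; apply/seteqP; split => x /=; by rewrite in_itv/= andbT.
Qed.

Lemma imC_measurable_half k :
  measurable_fun setT (imC k : g_sigma_algebraType halfspaces -> R).
Proof.
apply: (measurability _ (RGenOInfty.measurableE R)) => //.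
move=> _ [_ [a ->] <-]; rewrite setTI; apply: sub_sigma_algebra.
exists k, a; right; apply/seteqP; split => x /=; by rewrite in_itv/= andbT.
Qed.

Definition side (c : int * ((rat * rat) * (rat * rat))) : set X :=
  reC c.1 @^-1` `](ratr c.2.1.1), (ratr c.2.1.2)[ `&`
  imC c.1 @^-1` `](ratr c.2.2.1), (ratr c.2.2.2)[.

Definition box (s : seq (int * ((rat * rat) * (rat * rat)))) : set X :=
  \big[setI/setT]_(c <- s) side c.

Lemma boxP s x : box s x <-> forall c, c \in s -> side c x.
Proof.
rewrite /box; elim: s => [|c s IH]; first by rewrite big_nil; split.
rewrite big_cons; split=> [[h /IH hs] c'|h].
  by rewrite inE => /orP[/eqP->//|]; exact: hs.
split; first by apply: h; rewrite mem_head.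
by apply/IH => c' hc'; apply: h; rewrite inE hc' orbT.
Qed.

Lemma box_measurable s : measurable (box s : set (g_sigma_algebraType halfspaces)).
Proof.
apply: bigsetI_measurable => c _; apply: measurableI; rewrite -[X in measurable X]setTI.
  by apply: reC_measurable_half => //; exact: measurable_itv.
by apply: imC_measurable_half => //; exact: measurable_itv.
Qed.

(** Boxes with rational corners form a countable base of the topology. *)
Lemma open_half (U : set X) : open U -> <<s halfspaces >> U.
Proof.
move=> oU.
have -> : U = \bigcup_(s in [set s | box s `<=` U]) box s.
  apply/seteqP; split=> [x Ux|x [s sU]]; last exact: sU.
  have [s [e [e0 hs]]] := nbhs_coord (open_nbhs_nbhs (conj oU Ux)).
  have rat_near (r : R) : exists ab : rat * rat,
      r - e < ratr ab.1 < r /\ r < ratr ab.2 < r + e.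
    have [|a] := @rat_in_itvoo _ (r - e) r; first by lra.
    have [|b] := @rat_in_itvoo _ r (r + e); first by lra.
    by rewrite !in_itv/= => hb ha; exists (a, b).
  pose ab r := projT1 (cid (rat_near r)).
  have abP r : r - e < ratr (ab r).1 < r /\ r < ratr (ab r).2 < r + e.
    exact: (projT2 (cid (rat_near r))).
  pose c k := (k, (ab (reC k x), ab (imC k x))).
  exists (map c s).
    move=> y /boxP hy; apply: hs => k ks.
    have /hy [] : c k \in map c s by exact: map_f.
    rewrite /= !in_itv/=.
    have [/andP[h1 h2] /andP[h3 h4]] := abP (reC k x).
    have [/andP[h5 h6] /andP[h7 h8]] := abP (imC k x).
    move=> /andP[h9 h10] /andP[h11 h12].
    by split; rewrite ltr_norml; apply/andP; split; lra.
  apply/boxP => _ /mapP[k ks ->]; split; rewrite /= in_itv/=.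
    by have [/andP[_ ->] /andP[-> _]] := abP (reC k x).
  by have [/andP[_ ->] /andP[-> _]] := abP (imC k x).
rewrite bigcup_mkcond.
apply: (@countable_bigcupT_measurable _ (g_sigma_algebraType halfspaces)) => [|s].
  exact: countableP.
by case: ifP => _; [exact: box_measurable | exact: measurable0].
Qed.

Lemma continuous_borel (u : X -> R) : continuous u ->
  measurable_fun setT (u : borel R -> R).
Proof.
move=> /continuousP cu; apply: (measurability _ (RGenOpens.measurableE R)) => //.
move=> _ [_ [a [b ->]] <-]; rewrite setTI; apply: sub_sigma_algebra.
exact/cu/interval_open.
Qed.

Lemma shift_measurable : measurable_fun setT (@left_shift R : borel R -> borel R).
Proof.
apply: (@measurability _ _ (borel R) (borel R) setT _ (@open X)) => //.
move=> _ [U oU <-]; rewrite setTI; apply: sub_sigma_algebra.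
have /continuousP h := shift_continuous; exact: h.
Qed.

Lemma iter_shift_measurable n :
  measurable_fun setT (iter n (@left_shift R) : borel R -> borel R).
Proof.
elim: n => [|n IH] /=; first exact: measurable_id.
exact: (measurableT_comp shift_measurable IH).
Qed.

Lemma iter_shiftE n (x : X) k : iter n (@left_shift R) x k = x (k + n%:Z).
Proof.
elim: n k => [|n IH] k /=; first by rewrite addr0.
by rewrite /left_shift IH; congr (x _); rewrite intS; ring.
Qed.

Lemma disc_normc (z : disc R) : normc (z : R[i]) <= 1.
Proof.
case: z => z hz; have := hz; rewrite inE /= normc_def2.
by move=> h; rewrite -lecR.
Qed.

Lemma reC_bound k x : `|reC k x| <= 1.
Proof. exact: le_trans (ler_Re_normc _) (disc_normc _). Qed.

Lemma imC_bound k x : `|imC k x| <= 1.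
Proof. exact: le_trans (ler_Im_normc _) (disc_normc _). Qed.

(** Sums and maxima of coordinates suffice to approximate indicators of half-spaces and
    of finite unions, and a test function is displaced by a power of the shift at most
    as much, up to a constant, as the coordinates. *)
Inductive test : (borel R -> R) -> Prop :=
| test_cst c : test (fun=> c)
| test_re k : test (reC k)
| test_im k : test (imC k)
| testD u v : test u -> test v -> test (fun x => u x + v x)
| testZ c u : test u -> test (fun x => c * u x)
| test_max u v : test u -> test v -> test (fun x => Num.max (u x) (v x)).

Lemma test_continuous u : test u -> continuous (u : X -> R).
Proof.
elim=> {u} [c|k|k|u v _ hu _ hv|c u _ hu|u v _ hu _ hv] x.
- exact: cst_continuous.
- exact: reC_continuous.
- exact: imC_continuous.
- exact: (continuousD (hu x) (hv x)).
- exact: (continuousM (@cst_continuous _ _ c x) (hu x)).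
- exact: (continuous_max (hu x) (hv x)).
Qed.

Lemma test_bmeas u : test u -> bmeas u.
Proof.
elim=> {u} [c|k|k|u v _ hu _ hv|c u _ hu|u v _ hu _ hv].
- exact: bmeas_cst.
- split; first by apply: continuous_borel; exact: reC_continuous.
  by exists 1; exact: reC_bound.
- split; first by apply: continuous_borel; exact: imC_continuous.
  by exists 1; exact: imC_bound.
- exact: bmeasD.
- exact: bmeasZ.
- exact: bmeas_max.
Qed.
End Coordinates.

(** * Approximation by test functions *)

Section Vanish.
Context {d : measure_display} {T : measurableType d} {R : realType}.
Variable P : probability T R.

Lemma Ex_indic (A : set T) : measurable A -> Ex P (\1_A) = fine (P A).
Proof.
by move=> mA; rewrite /Ex /Rintegral; congr fine; rewrite integral_indic // setIT.
Qed.

Lemma Ex_indic_vanish (B : nat -> set T) (e : R) : (forall n, measurable (B n)) ->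
  (forall n, B n.+1 `<=` B n) -> (forall x, exists n, ~ B n x) -> 0 < e ->
  exists n0, forall n, (n0 <= n)%N -> Ex P (\1_(B n)) <= e.
Proof.
move=> mB decB capB e0.
have nB : nonincreasing_seq B.
  apply/nonincreasing_seqP => n; rewrite subsetEset; exact: decB.
have cap0 : \bigcap_n B n = set0.
  by rewrite -subset0 => x h; have [n nBx] := capB x; apply: nBx; exact: h.
have h0 : (P (B 0%N) < +oo)%E by rewrite ltey_eq fin_num_measure.
have := nonincreasing_cvg_mu h0 mB.
rewrite cap0 measure0 => /(_ measurable0 nB).
move=> /fine_cvgP [_] /cvgrPdist_le /(_ e e0) [n0 _ hn0].
exists n0 => n n0n; rewrite Ex_indic //.
have := hn0 n n0n; rewrite /= sub0r normrN; apply: le_trans.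
exact: ler_norm.
Qed.

End Vanish.

Section Approx.
Variable R : realType.
Notation X := (shift_space R).
Variables P1 P2 : probability (borel R) R.

(** Two measures at once: the invariance of a measure is proved by comparing it with
    its image under the shift, and one approximation has to serve for both. *)
Definition near_test (u : borel R -> R) (e : R) := exists phi, [/\ test phi,
  Ex P1 (fun x => `|u x - phi x|) <= e & Ex P2 (fun x => `|u x - phi x|) <= e].

Definition approx_test (u : borel R -> R) := forall e : R, 0 < e -> near_test u e.

Lemma near_trans u v e e' : bmeas u -> bmeas v ->
  Ex P1 (fun x => `|u x - v x|) <= e -> Ex P2 (fun x => `|u x - v x|) <= e ->
  near_test v e' -> near_test u (e + e').
Proof.
move=> hu hv h1 h2 [phi [tphi k1 k2]]; have bphi := test_bmeas tphi.
exists phi; split => //.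
  exact: le_trans (Ex_dist_trans _ hu hv bphi) (lerD h1 k1).
exact: le_trans (Ex_dist_trans _ hu hv bphi) (lerD h2 k2).
Qed.

Lemma near_comb c c' u v e e' : bmeas u -> bmeas v ->
  near_test u e -> near_test v e' ->
  near_test (fun x => c * u x + c' * v x) (`|c| * e + `|c'| * e').
Proof.
move=> hu hv [phi [tphi h1 h2]] [psi [tpsi k1 k2]].
have bphi := test_bmeas tphi; have bpsi := test_bmeas tpsi.
exists (fun x => c * phi x + c' * psi x); split; first by apply: testD; apply: testZ.
  by apply: (le_trans (Ex_dist_comb _ _ _ hu hv bphi bpsi)); rewrite lerD // ler_wpM2l.
by apply: (le_trans (Ex_dist_comb _ _ _ hu hv bphi bpsi)); rewrite lerD // ler_wpM2l.
Qed.

Lemma near_max u v e e' : bmeas u -> bmeas v ->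
  near_test u e -> near_test v e' ->
  near_test (fun x => Num.max (u x) (v x)) (e + e').
Proof.
move=> hu hv [phi [tphi h1 h2]] [psi [tpsi k1 k2]].
have bphi := test_bmeas tphi; have bpsi := test_bmeas tpsi.
exists (fun x => Num.max (phi x) (psi x)); split; first exact: test_max.
  exact: (le_trans (Ex_dist_max _ hu hv bphi bpsi) (lerD h1 k1)).
exact: (le_trans (Ex_dist_max _ hu hv bphi bpsi) (lerD h2 k2)).
Qed.

Definition approx_set : set_system X :=
  [set A | measurable (A : set (borel R)) /\ approx_test (\1_A)].

Lemma approx_setC A : approx_set A -> approx_set (~` A).
Proof.
move=> [mA hA]; split; first exact: measurableC.
move=> e e0; have [phi [tphi h1 h2]] := hA e e0.
exists (fun x => 1 + (-1) * phi x); split.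
- by apply: testD; [exact: test_cst|exact: testZ].
- apply: le_trans h1; apply: ler_eq.
  congr (Ex P1 _); apply/funext => x.
  rewrite [RHS]distrC; congr `|_|; rewrite !indicE in_setC; case: (_ \in _) => /=; ring.
- apply: le_trans h2; apply: ler_eq.
  congr (Ex P2 _); apply/funext => x.
  rewrite [RHS]distrC; congr `|_|; rewrite !indicE in_setC; case: (_ \in _) => /=; ring.
Qed.

Lemma approx_setU A B : approx_set A -> approx_set B -> approx_set (A `|` B).
Proof.
move=> [mA hA] [mB hB]; split; first exact: measurableU.
move=> e e0; have e20 : 0 < e / 2 by rewrite divr_gt0.
have := near_max (bmeas_indic mA) (bmeas_indic mB) (hA _ e20) (hB _ e20).
rewrite -splitr.
congr (near_test _ e); apply/funext => x; rewrite !indicE in_setU /Num.max.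
by case: (x \in A); case: (x \in B); rewrite /= ?ltxx ?ltr01 ?ltr10.
Qed.

Lemma approx_set0 : approx_set set0.
Proof.
split; first exact: measurable0.
move=> e e0; exists (fun=> 0); split; first exact: test_cst.
all: under eq_fun do rewrite indicE in_set0 subrr normr0.
all: by rewrite Ex_cst ltW.
Qed.

(** Finite unions exhaust the union up to small measure. *)
Lemma approx_bigcup (F : nat -> set X) : (forall i, approx_set (F i)) ->
  approx_set (\bigcup_i F i).
Proof.
move=> hF.
have mF i : measurable (F i : set (borel R)) := (hF i).1.
have mU : measurable (\bigcup_i F i : set (borel R)) by exact: bigcupT_measurable.
split=> // e e0.
pose G n := \bigcup_(i < n) F i.
have hG n : approx_set (G n).
  elim: n => [|n IH].
    rewrite (_ : G 0%N = set0); first exact: approx_set0.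
    by rewrite -subset0 => x [].
  rewrite (_ : G n.+1 = G n `|` F n); first exact: approx_setU.
  rewrite eqEsubset; split => [x [i /=]|x [[i /= iln ?]|?]].
  - rewrite ltnS leq_eqVlt => /orP[/eqP ->|iln]; first by right.
    by left; exists i.
  - by exists i => //=; rewrite ltnW.
  - by exists n => /=.
pose B n := (\bigcup_i F i) `\` G n.
have mB n : measurable (B n : set (borel R)) by apply: measurableD => //; exact: (hG n).1.
have decB n : B n.+1 `<=` B n.
  by move=> x [Ux nG]; split=> // -[i /= iln Fi]; apply: nG; exists i => //=; rewrite ltnW.
have capB x : exists n, ~ B n x.
  have [[i _ Fi]|h] := pselect ((\bigcup_i F i) x); last by exists 0%N => -[].
  by exists i.+1 => -[_]; apply; exists i => /=.
have e20 : 0 < e / 2 by rewrite divr_gt0.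
have [n1 h1] := Ex_indic_vanish P1 mB decB capB e20.
have [n2 h2] := Ex_indic_vanish P2 mB decB capB e20.
pose n := maxn n1 n2.
have indB : (fun x => `|\1_(\bigcup_i F i) x - \1_(G n) x| : R) = \1_(B n).
  apply/funext => x; rewrite !indicE /B in_setD.
  case: (boolP (x \in G n)) => [|_]; last first.
    by rewrite andbT subr0; case: (_ \in _); rewrite ?normr1 ?normr0.
  rewrite inE => -[i _ Fi]; rewrite andbF.
  have -> : x \in \bigcup_i F i by rewrite inE; exists i.
  by rewrite subrr normr0.
rewrite [e]splitr; apply: (@near_trans _ (\1_(G n))).
- exact: bmeas_indic.
- by apply: bmeas_indic; exact: (hG n).1.
- by rewrite indB; exact: h1 (leq_maxl _ _).
- by rewrite indB; exact: h2 (leq_maxr _ _).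
- exact: (hG n).2.
Qed.

(** The ramp min (1, max (0, n (u - a))) differs from the indicator of a < u only on
    a < u <= a + 1 / n, and these sets decrease to the empty set. *)
Lemma approx_superlevel u a : test u -> approx_set [set x | a < u x].
Proof.
move=> tu; have bu := test_bmeas tu.
have mA (b : R) : measurable ([set x | b < u x] : set (borel R)).
  rewrite -[X in measurable X]setTI.
  have -> : [set x | b < u x] = u @^-1` `]b, +oo[.
    by apply/seteqP; split=> x /=; rewrite in_itv/= andbT.
  by apply: bu.1 => //; exact: measurable_itv.
split=> // e e0.
pose B (n : nat) := [set x : X | a < u x] `\` [set x | a + n.+1%:R^-1 < u x].
have mB n : measurable (B n : set (borel R)) by apply: measurableD.
have decB n : B n.+1 `<=` B n.
  move=> x [ax h]; split=> // h'; apply: h => /=; apply: le_lt_trans h' => /=.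
  by rewrite lerD2l lef_pV2 ?posrE // ler_nat.
have capB x : exists n, ~ B n x.
  have [ax|h] := ltP a (u x); last by exists 0%N => -[/=]; rewrite ltNge h.
  have d0 : 0 < u x - a by rewrite subr_gt0.
  exists (Num.truncn (u x - a)^-1) => -[_]; apply => /=.
  rewrite -ltrBrDl invf_plt ?posrE //; exact: truncnS_gt.
have [n1 h1] := Ex_indic_vanish P1 mB decB capB e0.
have [n2 h2] := Ex_indic_vanish P2 mB decB capB e0.
pose n := maxn n1 n2.
pose phi x := Num.max 0 ((-1) * Num.max (-1) (- (n.+1%:R) * (u x + (- a)))).
have tphi : test phi.
  apply: test_max; first exact: test_cst.
  apply: testZ; apply: test_max; first exact: test_cst.
  by apply: testZ; apply: testD => //; exact: test_cst.
have key x : `|\1_[set x | a < u x] x - phi x| <= \1_(B n) x.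
  have n0 : 0 < n.+1%:R :> R by rewrite ltr0n.
  have nn : n.+1%:R * (n.+1%:R^-1) = 1 :> R by rewrite divff // gt_eqF.
  rewrite !indicE /phi /B in_setD; set v := u x + - a.
  case: (boolP (x \in [set x | a < u x])) => [/set_mem /= ax|]; last first.
    rewrite notin_setE /= => ax.
    have v0 : v <= 0 by rewrite /v; lra.
    have w0 : 0 <= - n.+1%:R * v by rewrite mulNr -mulrN mulr_ge0 ?oppr_ge0 // ltW.
    rewrite (max_r (_ : -1 <= _)); last by lra.
    by rewrite max_l ?subrr ?normr0 //; lra.
  have v0 : 0 < v by rewrite /v; lra.
  case: (boolP (x \in [set x | a + n.+1%:R^-1 < u x])) => [/set_mem /= ax'|].
    have w1 : n.+1%:R * n.+1%:R^-1 <= n.+1%:R * v by rewrite ler_pM2l // /v lerBrDl ltW.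
    rewrite nn in w1.
    rewrite mulNr (max_l (_ : _ <= -1)); last by lra.
    by rewrite mul1r opprK max_r // subrr normr0.
  rewrite notin_setE /= => ax'.
  have w0 : 0 <= n.+1%:R * v by rewrite mulr_ge0 // ltW.
  have w1 : n.+1%:R * v <= n.+1%:R * n.+1%:R^-1.
    by rewrite ler_pM2l // /v lerBlDl leNgt; apply/negP.
  rewrite nn in w1.
  rewrite mulNr (max_r (_ : -1 <= _)); last by lra.
  by rewrite max_r; [rewrite ler_norml; lra | lra].
have bphi := test_bmeas tphi.
have bi := bmeas_norm (bmeasB (@bmeas_indic _ _ R _ (mA a)) bphi).
exists phi; split => //.
  exact: le_trans (le_Ex P1 bi (bmeas_indic (mB n)) key) (h1 _ (leq_maxl _ _)).
exact: le_trans (le_Ex P2 bi (bmeas_indic (mB n)) key) (h2 _ (leq_maxr _ _)).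
Qed.

(** The sets with an approximable indicator form a sigma-algebra containing the
    half-spaces. *)
Lemma approx_measurable (A : set (borel R)) : measurable A -> approx_set A.
Proof.
have sA : sigma_algebra setT approx_set.
  split; first exact: approx_set0.
  - by move=> B hB; rewrite setTD; exact: approx_setC.
  - exact: approx_bigcup.
have half : <<s @halfspaces R >> `<=` approx_set.
  apply: smallest_sub => // _ [k [a [->|->]]].
    by apply: approx_superlevel; exact: test_re.
  by apply: approx_superlevel; exact: test_im.
apply: smallest_sub => // U oU; apply: half; exact: open_half.
Qed.

(** Peel off a binary digit: u = (1_A + u1) / 2 with A = {u >= 1/2} and u1 again valued
    in [0, 1], so that each step halves the error. *)
Lemma near_unit (n : nat) (u : borel R -> R) : measurable_fun setT u -> (forall x, 0 <= u x <= 1) ->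
  forall e, 0 < e -> near_test u ((2^-1) ^+ n + e).
Proof.
elim: n u => [|n IH] u mu u01 e e0.
  have bu : bmeas u.
    by split=> //; exists 1 => x; have /andP[? ?] := u01 x; rewrite ger0_norm.
  have le1 (P : probability (borel R) R) : Ex P (fun x => `|u x - 0|) <= (2^-1) ^+ 0 + e.
    have le_1 : Ex P (fun x => `|u x - 0|) <= Ex P (fun=> 1).
      apply: le_Ex; [exact: bmeas_norm (bmeasB bu (bmeas_cst 0)) | exact: bmeas_cst | move=> x].
      by have /andP[? ?] := u01 x; rewrite subr0 ger0_norm.
    by rewrite expr0 (le_trans le_1) // Ex_cst lerDl ltW.
  by exists (fun=> 0); split; [exact: test_cst | exact: le1 | exact: le1].
pose A := [set x | 2^-1 <= u x].
have mA : measurable (A : set (borel R)).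
  rewrite -[X in measurable X]setTI.
  have -> : A = u @^-1` `[2^-1, +oo[.
    by apply/seteqP; split=> x /=; rewrite in_itv/= andbT.
  by apply: mu => //; exact: measurable_itv.
pose u1 x := 2 * u x - \1_A x.
have mu1 : measurable_fun setT u1.
  apply: measurable_funB; first exact: measurable_funM.
  exact: measurable_indic.
have u1b x : 0 <= u1 x <= 1.
  rewrite /u1 indicE; have /andP[a b] := u01 x.
  case: (boolP (x \in A)) => [/set_mem|]; rewrite ?notin_setE /A /= => h; apply/andP; split.
  - by move: h; rewrite -[2^-1]mul1r ler_pdivrMr // => h; rewrite subr_ge0 mulrC.
  - by rewrite lerBlDr; lra.
  - by rewrite subr0 mulr_ge0.
  - rewrite subr0; move/negP: h; rewrite -ltNge => h.
    by move: (ltW h); rewrite -[2^-1]mul1r ler_pdivlMr // mulrC.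
have bA := @bmeas_indic _ _ R _ mA.
have bu1 : bmeas u1.
  by split=> //; exists 1 => x; have /andP[? ?] := u1b x; rewrite ger0_norm.
have := near_comb 2^-1 2^-1 bA bu1 ((approx_measurable mA).2 e e0) (IH _ mu1 u1b e e0).
have -> : (fun x => 2^-1 * \1_A x + 2^-1 * u1 x) = u.
  by apply/funext => x; rewrite /u1; field.
rewrite ger0_norm ?invr_ge0 //.
by have -> : 2^-1 * e + 2^-1 * (2^-1 ^+ n + e) = 2^-1 ^+ n.+1 + e by rewrite exprS; field.
Qed.

Lemma approx_bmeas u : bmeas u -> approx_test u.
Proof.
move=> [mu [B hB]] e e0.
have B0 : 0 <= B := le_trans (normr_ge0 _) (hB point).
pose C := B + 1; have C0 : 0 < C by rewrite /C; lra.
pose v x := (2 * C)^-1 * (u x + C).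
have mv : measurable_fun setT v.
  by apply: measurable_funM => //; exact: measurable_funD.
have v01 x : 0 <= v x <= 1.
  have := hB x; rewrite ler_norml => /andP[h1 h2].
  rewrite /v mulrC divr_ge0 ?ler_pdivrMr /C; lra.
have [n hn] : exists n, (2^-1 : R) ^+ n < e / (4 * C).
  have : (2^-1 : R) ^+ n @[n --> \oo] --> (0 : R).
    by apply: cvg_expr; rewrite ger0_norm // invf_lt1 // ltr1n.
  have d0 : 0 < e / (4 * C) by rewrite divr_gt0 // mulr_gt0.
  move=> /cvgrPdist_lt /(_ _ d0) [n _ h]; exists n.
  have := h n (leqnn n); rewrite /= sub0r normrN; apply: le_lt_trans; exact: ler_norm.
have d0 : 0 < e / (4 * C) by rewrite divr_gt0 // mulr_gt0.
have bv : bmeas v.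
  by split=> //; exists 1 => x; have /andP[? ?] := v01 x; rewrite ger0_norm.
have n1 : near_test (fun=> 1) 0.
  exists (fun=> 1); split; first exact: test_cst.
    by under eq_fun do rewrite subrr normr0; rewrite Ex_cst.
  by under eq_fun do rewrite subrr normr0; rewrite Ex_cst.
have hk := near_comb (2 * C) (- C) bv (bmeas_cst 1) (near_unit n mv v01 d0) n1.
have uE : (fun x => 2 * C * v x + - C * 1) = u.
  by apply/funext => x; rewrite /v; field; rewrite gt_eqF.
have le : `|2 * C| * (2^-1 ^+ n + e / (4 * C)) + `|- C| * 0 <= e.
  rewrite mulr0 addr0 ger0_norm; last by rewrite mulr_ge0 // ltW.
  have eE : e = 2 * C * (e / (4 * C) + e / (4 * C)) by field; rewrite gt_eqF.
  rewrite [leRHS]eE.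
  by rewrite ler_wpM2l ?mulr_ge0 ?(ltW C0) // lerD2r ltW.
rewrite uE in hk; case: hk => phi [tphi k1 k2].
exists phi; split => //; exact: (le_trans _ le).
Qed.

End Approx.

(** * The mean ergodic theorem *)

Section L1Limits.
Context {d : measure_display} {T : measurableType d} {R : realType}.
Variable P : probability T R.
Local Notation E := (Ex P).

Lemma limn_sup_near (u : nat -> R) (B c s : R) k : (forall n, `|u n| <= B) ->
  (forall n, (k <= n)%N -> `|u n - c| <= s) -> `|limn_sup u - c| <= s.
Proof.
move=> uB us.
have ub : has_ubound (range u).
  by exists B => _ [n _ <-]; exact: le_trans (ler_norm _) (uB n).
have lb : has_lbound (range u).
  by exists (- B) => _ [n _ <-]; have := uB n; rewrite ler_norml => /andP[].
have ubd n : has_ubound (sdrop u n).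
  by exists B => _ [m _ <-]; exact: le_trans (ler_norm _) (uB m).
have nz n : sdrop u n !=set0 by exists (u n), n => /=.
have bd : bounded_fun u.
  exists B; split; first exact: num_real.
  by move=> M BM n _ /=; exact: le_trans (uB n) (ltW BM).
rewrite limn_supE // ler_distl; apply/andP; split.
  apply: lb_le_inf; first by exists (sups u 0), 0%N.
  move=> _ [n _ <-]; apply: (@le_trans _ _ (u (maxn n k))).
    by have := us (maxn n k) (leq_maxr _ _); rewrite ler_distl => /andP[].
  by apply: ub_le_sup => //; exists (maxn n k) => //=; exact: leq_maxl.
apply: (@le_trans _ _ (sups u k)).
  apply: ge_inf; last by exists k.
  exists (- B) => _ [n _ <-]; apply: (@le_trans _ _ (u n)).
    by have := uB n; rewrite ler_norml => /andP[].
  by apply: ub_le_sup => //; exists n => /=.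
apply: ge_sup => // _ [n /= kn <-].
by have := us n kn; rewrite ler_distl => /andP[].
Qed.

(** The limsup is measurable and bounded wherever the sequence diverges, and it is
    within the sum of the later increments of each term. *)
Lemma fast_cauchy_limit (F : nat -> T -> R) (B : R) :
  (forall n, measurable_fun setT (F n)) -> (forall n x, `|F n x| <= B) ->
  (forall n, E (fun x => `|F n.+1 x - F n x|) <= 2^-1 ^+ n) ->
  exists2 h, bmeas h & forall k, E (fun x => `|h x - F k x|) <= 2 * 2^-1 ^+ k.
Proof.
move=> mF FB hF; pose h x := limn_sup (F ^~ x).
have bF n : bmeas (F n) by split=> //; exists B.
have mh : measurable_fun setT h.
  apply: measurable_fun_limn_sup => // x _.
    by exists B => _ [n _ <-]; exact: le_trans (ler_norm _) (FB n x).
  by exists (- B) => _ [n _ <-]; have := FB n x; rewrite ler_norml => /andP[].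
have hB x : `|h x| <= B.
  by rewrite -[h x]subr0; apply: (@limn_sup_near _ B _ _ 0) => // n _; rewrite subr0.
have bh : bmeas h by split=> //; exists B.
exists h => // k.
pose D n x := `|F n.+1 x - F n x|.
have bD n : bmeas (D n) by apply: bmeas_norm; exact: bmeasB.
have mD n : measurable_fun setT (EFin \o D n).
  by apply/measurable_EFinP; exact: (bD n).1.
have D0 n x : (0 <= (D n x)%:E)%E by rewrite lee_fin /D.
pose S x := (\sum_(n <oo) (D (n + k)%N x)%:E)%E.
have S0 x : (0 <= S x)%E by apply: nneseries_ge0 => n _ _; exact: D0.
have pt x : (`|h x - F k x|%:E <= S x)%E.
  case: (boolP (S x == +oo)%E) => [/eqP ->|Sfin]; first by rewrite leey.
  have Sf : S x \is a fin_num by rewrite ge0_fin_numE // ltey.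
  rewrite -(fineK Sf) lee_fin; apply: (@limn_sup_near _ B _ _ k) => // n kn.
  rewrite -lee_fin (fineK Sf) -(subnK kn).
  have part m : `|F (m + k)%N x - F k x| <= \sum_(0 <= i < m) D (i + k)%N x.
    elim: m => [|m IH]; first by rewrite add0n subrr normr0 big_geq.
    rewrite big_nat_recr //= addrC; apply: le_trans (ler_distD (F (m + k)%N x) _ _) _.
    by rewrite lerD.
  apply: (@le_trans _ _ ((\sum_(0 <= i < n - k) D (i + k)%N x)%:E)).
    by rewrite lee_fin.
  rewrite -sumEFin; by apply: nneseries_lim_ge => i _ _; exact: D0.
have bhF : bmeas (fun x => `|h x - F k x|) by apply: bmeas_norm; exact: bmeasB.
have iE (u : T -> R) : bmeas u -> (\int[P]_x (u x)%:E)%E = (E u)%:E.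
  move=> bu; rewrite /Ex /Rintegral fineK //.
  exact: (integrable_fin_num measurableT (bmeas_integrable P bu)).
rewrite -lee_fin -iE //.
apply: (@le_trans _ _ (\int[P]_x S x)%E).
  apply: ge0_le_integral => //.
  - by apply/measurable_EFinP; exact: bhF.1.
  - apply: (@ge0_emeasurable_sum _ _ _ setT (fun n x => (D (n + k)%N x)%:E) xpredT) => n.
      by move=> x _ _; exact: D0.
    by move=> _; exact: mD.
rewrite integral_nneseries //; last by move=> n; exact: mD.
apply: lime_le.
  by apply: is_cvg_nneseries => n _ _; apply: integral_ge0 => x _; exact: D0.
apply: nearW => N; under eq_bigr do rewrite iE //.
rewrite sumEFin lee_fin.
apply: (@le_trans _ _ (\sum_(0 <= i < N) 2^-1 ^+ (i + k))).
  by apply: ler_sum => i _; exact: hF.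
have geo : \sum_(0 <= i < N) (2^-1 : R) ^+ (i + k) = 2 * 2^-1 ^+ k - 2 * 2^-1 ^+ (N + k).
  elim: (N) => [|m IH]; first by rewrite big_geq // add0n subrr.
  by rewrite big_nat_recr //= IH addSn exprS; field.
by rewrite geo gerBl mulr_ge0 // exprn_ge0 // invr_ge0.
Qed.
End L1Limits.

Section MeanErgodic.
Context {d : measure_display} {T : measurableType d} {R : realType}.
Variable P : probability T R.
Local Notation E := (Ex P).
Variable S : T -> T.
Hypothesis mS : measurable_fun setT S.
Hypothesis invS : forall u, bmeas u -> E (fun x => u (S x)) = E u.
Implicit Types (u v : T -> R).

Definition sqn u := E (fun x => u x ^+ 2).

Lemma bmeas_iterS n u : bmeas u -> bmeas (fun x => u (iter n S x)).
Proof.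
move=> bu; elim: n => // n IH.
have := bmeas_comp mS IH; congr (bmeas _); apply/funext => x.
by rewrite -iterSr.
Qed.

Lemma Ex_iterS n u : bmeas u -> E (fun x => u (iter n S x)) = E u.
Proof.
move=> bu; elim: n => // n <-.
rewrite -(invS (bmeas_iterS n bu)); congr Ex; apply/funext => y.
by rewrite -iterSr.
Qed.

Definition dyadic j u (x : T) : R := (2 ^ j)%:R^-1 * \sum_(0 <= m < 2 ^ j) u (iter m S x).

(** Closed under what takes u to its dyadic averages. Midpoints suffice because the
    lengths of the averages are powers of 2. *)
Inductive hull u : (T -> R) -> Prop :=
| hull_self : hull u u
| hull_shift v : hull u v -> hull u (fun x => v (S x))
| hull_mid v w : hull u v -> hull u w -> hull u (fun x => 2^-1 * (v x + w x)).

Lemma hull_bmeas u v : bmeas u -> hull u v -> bmeas v.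
Proof.
move=> bu; elim=> // {v} [v _ bv|v w _ bv _ bw]; first exact: bmeas_comp.
by apply: bmeasZ; exact: bmeasD.
Qed.

Lemma hull_iter u v n : hull u v -> hull u (fun x => v (iter n S x)).
Proof.
move=> hv; elim: n => // n IH.
have := hull_shift IH; congr (hull u _); apply/funext => x.
by rewrite -iterSr.
Qed.

Lemma dyadicS j u x : dyadic j.+1 u x = 2^-1 * (dyadic j u x + dyadic j u (iter (2 ^ j) S x)).
Proof.
rewrite /dyadic -mulrDr mulrA -invfM -natrM -expnS; congr (_ * _).
rewrite (@big_cat_nat _ _ _ (2 ^ j)%N) //=; last by rewrite leq_exp2l.
congr (_ + _); rewrite expnS mul2n -addnn.
rewrite -{1}[(2 ^ j)%N]add0n big_addn addnK; apply: eq_bigr => m _.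
by rewrite iterD.
Qed.

Lemma dyadic_hull u v j : hull u v -> hull u (dyadic j v).
Proof.
move=> hv; elim: j => [|j IH].
  rewrite (_ : dyadic 0 v = v) //; apply/funext => x.
  by rewrite /dyadic expn0 invr1 mul1r big_nat1.
rewrite (_ : dyadic j.+1 v = (fun x => 2^-1 * (dyadic j v x + dyadic j v (iter (2 ^ j) S x)))).
  by apply: hull_mid => //; exact: (hull_iter (2 ^ j) IH).
by apply/funext => x; rewrite dyadicS.
Qed.

Lemma bmeas_dyadic j u : bmeas u -> bmeas (dyadic j u).
Proof. by move=> bu; apply: (hull_bmeas bu); apply: dyadic_hull; exact: hull_self. Qed.

Lemma sqn_ge0 u : 0 <= sqn u.
Proof. by apply: Ex_ge0 => x; exact: sqr_ge0. Qed.

Lemma parallelogram u v : bmeas u -> bmeas v ->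
  sqn (fun x => u x - v x) = 2 * sqn u + 2 * sqn v - 4 * sqn (fun x => 2^-1 * (u x + v x)).
Proof.
move=> bu bv; rewrite /sqn.
have bm : bmeas (fun x => 2^-1 * (u x + v x)) by apply: bmeasZ; exact: bmeasD.
have h1 := bmeas_sqr bu; have h2 := bmeas_sqr bv; have h3 := bmeas_sqr bm.
rewrite -!ExZ // -ExD; [|exact: bmeasZ..]; rewrite -ExB; [|by apply: bmeasD; exact: bmeasZ|exact: bmeasZ].
by congr Ex; apply/funext => x; field.
Qed.

Lemma sqn_mid u v : bmeas u -> bmeas v ->
  sqn (fun x => 2^-1 * (u x + v x)) <= 2^-1 * (sqn u + sqn v).
Proof.
move=> bu bv; have := parallelogram bu bv; have := sqn_ge0 (fun x => u x - v x).
by move: (sqn _) (sqn u) (sqn v) (sqn _) => a b c e; lra.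
Qed.

Lemma sqn_dyadic u j : bmeas u -> sqn (dyadic j u) <= sqn u.
Proof.
move=> bu; elim: j => [|j IH].
  rewrite (_ : dyadic 0 u = u) //; apply/funext => x.
  by rewrite /dyadic expn0 invr1 mul1r big_nat1.
rewrite (_ : dyadic j.+1 u = (fun x => 2^-1 * (dyadic j u x + dyadic j u (iter (2 ^ j) S x)))); last first.
  by apply/funext => x; rewrite dyadicS.
have bd := bmeas_dyadic j bu.
apply: le_trans (sqn_mid bd (bmeas_iterS (2 ^ j) bd)) _.
have -> : sqn (fun x => dyadic j u (iter (2 ^ j) S x)) = sqn (dyadic j u).
  exact: (Ex_iterS (2 ^ j) (bmeas_sqr bd)).
by move: IH; move: (sqn _) (sqn u) => a b; lra.
Qed.

Lemma dyadic_shift j x v B : (forall y, `|v y| <= B) ->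
  `|dyadic j v (S x) - dyadic j v x| <= 2 * B / (2 ^ j)%:R.
Proof.
move=> hB; rewrite /dyadic -mulrBr normrM ger0_norm ?invr_ge0 // mulrC ler_wpM2r ?invr_ge0 //.
under eq_bigr do rewrite -iterSr.
have -> : \sum_(0 <= m < 2 ^ j) v (iter m.+1 S x) - \sum_(0 <= m < 2 ^ j) v (iter m S x) =
   v (iter (2 ^ j) S x) - v x.
  by rewrite -sumrB (telescope_sumr (fun m => v (iter m S x))).
apply: le_trans (ler_normB _ _) _; have := hB (iter (2 ^ j) S x); have := hB x; lra.
Qed.

(** Shifting v changes its dyadic averages by O(2^-j), so that all the elements of the
    hull have asymptotically the same averages. *)
Lemma hull_close u v : bmeas u -> hull u v -> exists C, forall j x,
  `|dyadic j v x - dyadic j u x| <= C / (2 ^ j)%:R.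
Proof.
move=> bu; elim=> {v} [|v hv [C hC]|v w hv [C hC] hw [C' hC']].
- by exists 0 => j x; rewrite subrr normr0 mul0r.
- have [_ [B hB]] := hull_bmeas bu hv.
  exists (2 * B + C) => j x.
  apply: le_trans (ler_distD (dyadic j v x) _ _) _; rewrite mulrDl lerD //.
  apply: le_trans (dyadic_shift j x hB); apply: ler_eq.
  congr `|_ - _|; rewrite /dyadic; congr (_ * _); apply: eq_bigr => m _.
  by rewrite -iterS iterSr.
- exists (2^-1 * (C + C')) => j x.
  have -> : dyadic j (fun x => 2^-1 * (v x + w x)) x = 2^-1 * (dyadic j v x + dyadic j w x).
    rewrite /dyadic -mulrDr -big_split /= -big_distrr /=; ring.
  have -> : 2^-1 * (dyadic j v x + dyadic j w x) - dyadic j u x =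
     2^-1 * ((dyadic j v x - dyadic j u x) + (dyadic j w x - dyadic j u x)) by field.
  rewrite normrM ger0_norm ?invr_ge0 // -mulrA ler_wpM2l ?invr_ge0 //.
  by apply: le_trans (ler_normD _ _) _; rewrite mulrDl lerD.
Qed.

(** Take v in the hull with nearly minimal norm. Its averages are in the hull, with norm
    at most that of v, hence are close to one another by the parallelogram identity; the
    averages of u are close to them. *)
Lemma dyadic_sqn_cauchy u : bmeas u -> forall eps, 0 < eps ->
  exists J, forall i j, (J <= i)%N -> (J <= j)%N ->
    sqn (fun x => dyadic i u x - dyadic j u x) <= eps.
Proof.
move=> bu eps eps0.
pose V := [set s | exists2 v, hull u v & s = sqn v].
have hV : has_inf V.
  split; first by exists (sqn u); exists u => //; exact: hull_self.
  by exists 0 => _ [v _ ->]; exact: sqn_ge0.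
have e0 : 0 < eps / 16 by rewrite divr_gt0.
have [_ [v hv ->] hvs] := inf_adherent e0 hV.
have bv := hull_bmeas bu hv.
have low w : hull u w -> inf V <= sqn w.
  by move=> hw; apply: (inf_lbound hV.2) ; exists w.
have [C hC] := hull_close bu hv.
have C0 : 0 <= C by have := le_trans (normr_ge0 _) (hC 0%N point); rewrite divr1.
have [J hJ] : exists J : nat, (4 * C) ^+ 2 / (eps / 4) < J%:R.
  by exists (Num.truncn ((4 * C) ^+ 2 / (eps / 4))).+1; exact: truncnS_gt.
have small j : (J <= j)%N -> (2 * (C / (2 ^ j)%:R)) ^+ 2 <= eps / 16.
  move=> Jj; have p0 : 0 < (2 ^ j)%:R :> R by rewrite ltr0n expn_gt0.
  have p1 : (4 * C) ^+ 2 / (eps / 4) <= (2 ^ j)%:R.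
    apply: le_trans (ltW hJ) _; rewrite ler_nat; apply: leq_trans Jj _.
    by apply: ltnW; exact: ltn_expl.
  have p2 : 1 <= (2 ^ j)%:R :> R by rewrite ler1n expn_gt0.
  have e40 : 0 < eps / 4 by rewrite divr_gt0.
  move: p1; rewrite ler_pdivrMr // => p1.
  have -> : (2 * (C / (2 ^ j)%:R)) ^+ 2 = (4 * C) ^+ 2 / 4 / ((2 ^ j)%:R * (2 ^ j)%:R).
    by field; rewrite gt_eqF.
  rewrite ler_pdivrMr ?mulr_gt0 //.
  have p3 : eps * (2 ^ j)%:R <= eps * ((2 ^ j)%:R * (2 ^ j)%:R).
    by rewrite ler_wpM2l ?(ltW eps0) // ler_peMl // ltW.
  by move: p1 p3; move: ((4 * C) ^+ 2) ((2 ^ j)%:R) => c z; lra.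
exists J => i j Ji Jj.
have bi := bmeas_dyadic i bu; have bj := bmeas_dyadic j bu.
have bvi := bmeas_dyadic i bv; have bvj := bmeas_dyadic j bv.
have main : sqn (fun x => dyadic i v x - dyadic j v x) <= 4 * (eps / 16).
  rewrite (parallelogram bvi bvj).
  have h1 := sqn_dyadic i bv; have h2 := sqn_dyadic j bv.
  have h3 := low _ (hull_mid (dyadic_hull i hv) (dyadic_hull j hv)).
  by move: h1 h2 h3 hvs; move: (sqn _) (sqn _) (sqn _) (sqn v) (inf V) => a b c e f; lra.
pose D u' x := dyadic i u' x - dyadic j u' x.
have bDv : bmeas (D v) by exact: bmeasB.
have bDu : bmeas (D u) by exact: bmeasB.
have pt x : D u x ^+ 2 <= 2 * D v x ^+ 2 + 4 * (eps / 16).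
  have hi := hC i x; have hj := hC j x; have si := small i Ji; have sj := small j Jj.
  have si0 : 0 <= C / (2 ^ i)%:R by rewrite divr_ge0.
  have sj0 : 0 <= C / (2 ^ j)%:R by rewrite divr_ge0.
  have hd : `|D u x - D v x| <= C / (2 ^ i)%:R + C / (2 ^ j)%:R.
    rewrite /D (_ : _ - _ = (dyadic j v x - dyadic j u x) - (dyadic i v x - dyadic i u x)); last by ring.
    by apply: le_trans (ler_normB _ _) _; rewrite addrC lerD.
  have hd2 : (D u x - D v x) ^+ 2 <= 2 * (eps / 16).
    rewrite -[leLHS]real_normK ?num_real //.
    move: hd (normr_ge0 (D u x - D v x)) si sj si0 sj0.
    move: `|D u x - D v x| (C / (2 ^ i)%:R) (C / (2 ^ j)%:R) => a b c h0 h1 h2 h3 h4 h5.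
    have h6 : a ^+ 2 <= (b + c) ^+ 2 by rewrite lerXn2r ?nnegrE ?addr_ge0.
    by have := sqr_ge0 (b - c); nra.
  have := sqr_ge0 (D u x - 2 * D v x); move: hd2; move: (D u x) (D v x) => a b; nra.
have bs := bmeas_sqr bDv.
apply: (@le_trans _ _ (E (fun x => 2 * D v x ^+ 2 + 4 * (eps / 16)))).
  by apply: le_Ex => //; [exact: bmeas_sqr | apply: bmeasD; [exact: bmeasZ | exact: bmeas_cst]].
rewrite (ExD P (bmeasZ 2 bs) (bmeas_cst _)) (ExZ P 2 bs) Ex_cst.
rewrite -/(sqn (D v)); move: main; rewrite -/(D v); move: (sqn _) => a; lra.
Qed.

(** A subsequence of the averages converges rapidly, hence has a limit by
    [fast_cauchy_limit]; it is invariant because the shift changes the averages by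
    O(2^-j). *)
Lemma mean_ergodic u : bmeas u -> exists h, [/\ bmeas h,
  {ae P, forall x, h (S x) = h x} &
  forall eps, 0 < eps -> exists J, forall j, (J <= j)%N ->
    E (fun x => `|h x - dyadic j u x|) <= eps].
Proof.
move=> bu; have [_ [B hB]] := bu.
have l1 n : exists J, forall i j, (J <= i)%N -> (J <= j)%N ->
    E (fun x => `|dyadic i u x - dyadic j u x|) <= 2^-1 ^+ n.
  pose e : R := 2^-1 ^+ n; have e0 : 0 < e by rewrite exprn_gt0 // invr_gt0.
  have e20 : 0 < e ^+ 2 by rewrite exprn_gt0.
  have [J hJ] := dyadic_sqn_cauchy bu e20; exists J => i j Ji Jj; rewrite -/e; clearbody e.
  have bd : bmeas (fun x => dyadic i u x - dyadic j u x).
    by apply: bmeasB; exact: bmeas_dyadic.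
  have bs := bmeas_sqr bd.
  apply: (@le_trans _ _ (E (fun x => (2 * e)^-1 * (dyadic i u x - dyadic j u x) ^+ 2 + e / 2))).
    apply: le_Ex; [exact: bmeas_norm | by apply: bmeasD; [exact: bmeasZ | exact: bmeas_cst] | move=> x].
    rewrite -[_ ^+ 2]real_normK ?num_real //; move: `|_| => a.
    have e2 : 0 < 2 * e by rewrite mulr_gt0.
    rewrite -(ler_pM2l e2) mulrDr mulrA divff ?gt_eqF // mul1r.
    by have := sqr_ge0 (a - e); nra.
  rewrite (ExD P (bmeasZ _ bs) (bmeas_cst _)) (ExZ P _ bs) Ex_cst.
  have := hJ i j Ji Jj; rewrite /sqn => hs.
  have e2 : 0 <= (2 * e)^-1 by rewrite invr_ge0 mulr_ge0 // ltW.
  apply: le_trans (lerD (ler_wpM2l e2 hs) (lexx _)) _.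
  by apply: ler_eq; field; rewrite gt_eqF.
pose J n := projT1 (cid (l1 n)).
have hJ n i j : (J n <= i)%N -> (J n <= j)%N ->
    E (fun x => `|dyadic i u x - dyadic j u x|) <= 2^-1 ^+ n := projT2 (cid (l1 n)) i j.
pose jn n := ((\sum_(m < n.+1) J m) + n)%N.
have jnJ n : (J n <= jn n)%N.
  by rewrite /jn big_ord_recr /= addnAC leq_addl.
have jnS n : (jn n <= jn n.+1)%N.
  by rewrite /jn [X in (_ <= X + _)%N]big_ord_recr /=; lia.
pose F n := dyadic (jn n) u.
have bF n : bmeas (F n) by exact: bmeas_dyadic.
have FB n x : `|F n x| <= B.
  rewrite /F /dyadic normrM ger0_norm ?invr_ge0 //.
  rewrite mulrC ler_pdivrMr ?ltr0n ?expn_gt0 //.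
  apply: le_trans (ler_norm_sum _ _ _) _.
  apply: (@le_trans _ _ (\sum_(0 <= m < 2 ^ jn n) B)); first by apply: ler_sum => m _.
  by rewrite big_const_nat subn0 iter_addr addr0 mulr_natr.
have hF n : E (fun x => `|F n.+1 x - F n x|) <= 2^-1 ^+ n.
  by apply: hJ => //; exact: leq_trans (jnJ n) (jnS n).
have [h bh hk] := fast_cauchy_limit (fun n => (bF n).1) FB hF.
have pow0 (c eps : R) : 0 <= c -> 0 < eps -> exists k, c * 2^-1 ^+ k <= eps.
  move=> c0 eps0; have [k hk'] : exists k : nat, c / eps < k%:R.
    by exists (Num.truncn (c / eps)).+1; exact: truncnS_gt.
  exists k; rewrite exprVn ler_pdivrMr ?exprn_gt0 // mulrC.
  move: hk'; rewrite ltr_pdivrMr // => hk'; apply: le_trans (ltW hk') _.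
  by rewrite ler_wpM2r ?(ltW eps0) // -natrX ler_nat ltnW // ltn_expl.
exists h; split => //; last first.
  move=> eps eps0; have [k hk2] := pow0 3 eps (ler0n _ _) eps0.
  exists (J k) => j Jj; apply: le_trans hk2.
  apply: le_trans (Ex_dist_trans P bh (bF k) (bmeas_dyadic j bu)) _.
  by have := hk k; have := hJ k _ j (jnJ k) Jj; rewrite /F; lra.
have bhS := bmeas_comp mS bh.
have B0 : 0 <= B := le_trans (normr_ge0 _) (hB point).
have bd : bmeas (fun x => `|h (S x) - h x|) by apply: bmeas_norm; exact: bmeasB.
have Eh : E (fun x => `|h (S x) - h x|) = 0.
  apply/eqP; rewrite eq_le Ex_ge0 // andbT.
  apply/ler_addgt0Pl => eps eps0; rewrite addr0.
  have c0 : 0 <= 4 + 2 * B by rewrite addr_ge0 // mulr_ge0.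
  have [k hk2] := pow0 _ eps c0 eps0; apply: le_trans hk2.
  have bFS := bmeas_comp mS (bF k).
  apply: le_trans (Ex_dist_trans P bhS bFS bh) _.
  have t1 : E (fun x => `|h (S x) - F k (S x)|) <= 2 * 2^-1 ^+ k.
    by rewrite (invS (bmeas_norm (bmeasB bh (bF k)))).
  have t2 : E (fun x => `|F k (S x) - h x|) <= 2 * B * 2^-1 ^+ k + 2 * 2^-1 ^+ k.
    apply: le_trans (Ex_dist_trans P bFS (bF k) bh) _; apply: lerD.
      rewrite -(Ex_cst P (2 * B * 2^-1 ^+ k)); apply: le_Ex.
      - by apply: bmeas_norm; exact: bmeasB.
      - exact: bmeas_cst.
      move=> x; apply: le_trans (dyadic_shift (jn k) x hB) _.
      rewrite exprVn ler_wpM2l ?mulr_ge0 // lef_pV2 ?posrE ?exprn_gt0 ?ltr0n ?expn_gt0 //.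
      by rewrite -natrX ler_nat leq_exp2l // /jn leq_addl.
    by apply: le_trans (hk k); under eq_fun do rewrite distrC.
  apply: le_trans (lerD t1 t2) _.
  by apply: ler_eq; ring.
have := Ex_ae_eq0 bd (fun x => normr_ge0 _) Eh.
by apply: filterS => x /normr0_eq0 /eqP; rewrite subr_eq0 => /eqP.
Qed.

End MeanErgodic.

(** * Integrals over a Furstenberg system *)

Section Averages.
Variable R : realType.
Variable av : averaging.
Notation X := (shift_space R).
Notation T := (@left_shift R).

Lemma integral_average (x : X) (N : nat) (u : X -> R) : continuous u ->
  (forall y, 0 <= u y) ->
  (\int[average_measure av N (fun n => dirac (iter n T x : borel R))]_y u y)%R =
  avg av N (fun n => u (iter n T x)).
Proof.
move=> cu u0.
have mu : measurable_fun setT (EFin \o (u : borel R -> R)).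
  by apply/measurable_EFinP; exact: continuous_borel.
have u0' y : setT y -> (0 <= (u y)%:E)%E by rewrite lee_fin.
rewrite /Rintegral /average_measure ge0_integral_mscale //=.
rewrite ge0_integral_measure_sum //.
have -> : (\sum_(i < N) \int[mscale (weight R av i.+1) (dirac (iter i.+1 T x : borel R))]_y (u y)%:E =
   (\sum_(1 <= n < N.+1) (weight R av n)%:num * u (iter n T x))%:E)%E.
  rewrite big_add1 /= big_mkord -sumEFin; apply: eq_bigr => n _.
  rewrite ge0_integral_mscale //= integral_dirac //= diracT mul1e.
  by rewrite -EFinM.
by rewrite -EFinM.
Qed.

Section System.
Variables (mu : probability (borel R) R) (N : nat -> nat) (x : X).
Hypotheses (N0 : forall k, (0 < N k)%N) (Ninc : forall j k, (j < k)%N -> (N j < N k)%N).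
Hypothesis hlim : weak_star_limit
      (fun k => average_measure av (N k)
         (fun n => dirac (iter n T x : borel R))) mu.
Local Notation E := (Ex mu).

Lemma N_ge k : (k <= N k)%N.
Proof. by elim: k => // k IH; apply: leq_ltn_trans IH _; exact: Ninc. Qed.

Lemma avg_cvg (u : X -> R) : continuous u -> (forall y, 0 <= u y) ->
  (fun k => avg av (N k) (fun n => u (iter n T x))) @ \oo --> E u.
Proof.
move=> cu u0; have := hlim cu; apply: cvg_trans; apply: near_eq_cvg.
by apply: nearW => k /=; rewrite integral_average.
Qed.

Lemma Ex_le_ub (u : X -> R) (a : nat -> R) e : continuous u -> (forall y, 0 <= u y) ->
  (forall n, (0 < n)%N -> u (iter n T x) <= a n) -> ubmean a e -> E u <= e.
Proof.
move=> cu u0 ua ha; apply/ler_addgt0Pr => eta eta0.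
have [n0 h0] := avg_ub av ha eta0.
apply: (cvgr_to_le (avg_cvg cu u0)); exists n0 => // k /= hk.
apply: le_trans (h0 (N k) (leq_trans hk (N_ge k))).
exact: avg_le.
Qed.

Lemma Ex_ge_ub (u : X -> R) (a : nat -> R) c e : continuous u -> (forall y, 0 <= u y) ->
  (forall n, (0 < n)%N -> c <= u (iter n T x) + a n) -> ubmean a e -> c - e <= E u.
Proof.
move=> cu u0 ua ha; apply/ler_addgt0Pr => eta eta0.
have [n0 h0] := avg_ub av ha eta0.
rewrite -lerBlDr; apply: (cvgr_to_ge (avg_cvg cu u0)); exists n0 => // k /= hk.
have h1 := h0 (N k) (leq_trans hk (N_ge k)).
have h2 : c <= avg av (N k) (fun n => u (iter n T x)) + avg av (N k) a.
  rewrite -avgD -[leLHS](avg_cst av c (N0 k)); exact: avg_le.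
lra.
Qed.

(** The averages of u and of its shift along the orbit of x differ by o(1). *)
Lemma Ex_shift_pos (u : X -> R) B : continuous u -> (forall y, 0 <= u y) ->
  (forall y, `|u y| <= B) -> E (fun y => u (T y)) = E u.
Proof.
move=> cu u0 uB.
have cuT : continuous (fun y => u (T y)).
  by move=> y; apply: continuous_comp; [exact: shift_continuous | exact: cu].
have h1 := avg_cvg cuT (fun y => u0 (T y)).
have h2 := avg_cvg cu u0.
have h3 : (fun k => avg av (N k) (fun n => u (T (iter n T x))) -
     avg av (N k) (fun n => u (iter n T x))) @ \oo --> (0 : R).
  apply/cvgrPdist_le => eta eta0; have [n0 h0] := tot_unbounded av (2 * B / eta).
  exists n0 => // k /= hk; rewrite sub0r normrN.
  have h4 := avg_shift_diff av (fun n => uB (iter n T x)) (N0 k).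
  apply: le_trans h4 _; rewrite ler_pdivrMr ?tot_gt0 //.
  by have := h0 _ (leq_trans hk (N_ge k)); rewrite ler_pdivrMr // [total_weight _ _ _ * _]mulrC.
apply/eqP; rewrite -subr_eq0; apply/eqP.
exact: (cvg_unique _ (cvgB h1 h2) h3).
Qed.

Lemma Ex_shift_cts (u : X -> R) : continuous u -> bmeas (u : borel R -> R) ->
  E (fun y => u (T y)) = E u.
Proof.
move=> cu bu; have [B hB] := bu.2.
have B0 : 0 <= B := le_trans (normr_ge0 _) (hB point).
have bT := bmeas_comp (@shift_measurable R) bu.
pose v y := u y + B.
have cv : continuous v by move=> y; exact: (continuousD (cu y) (@cst_continuous _ _ B y)).
have v0 y : 0 <= v y by rewrite /v; have := hB y; rewrite ler_norml => /andP[h _]; lra.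
have vB y : `|v y| <= B + B by apply: le_trans (ler_normD _ _) _; rewrite lerD // ger0_norm.
have := Ex_shift_pos cv v0 vB.
rewrite /v (ExD mu bT (bmeas_cst B)) (ExD mu bu (bmeas_cst B)) => h.
exact: addIr h.
Qed.

Definition shift_mfun : {mfun borel R >-> borel R} :=
  HB.pack (T : borel R -> borel R) (isMeasurableFun.Build _ _ _ _ _ (@shift_measurable R)).

Lemma Ex_distribution (u : borel R -> R) : bmeas u ->
  Ex (distribution mu shift_mfun) u = E (fun y => u (T y)).
Proof.
move=> bu; rewrite /Ex /Rintegral; congr fine.
have bT := bmeas_comp (@shift_measurable R) bu.
rewrite integral_distribution //; first by apply/measurable_EFinP; exact: bu.1.
exact: (bmeas_integrable mu bT).
Qed.

(** A bounded measurable u is near a test function both in mean for mu and for its image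
    under the shift, and its two integrals agree as it is continuous. *)
Lemma Ex_shift (u : borel R -> R) : bmeas u -> E (fun y => u (T y)) = E u.
Proof.
move=> bu; rewrite -Ex_distribution //; apply/eqP; rewrite -subr_eq0 -normr_le0.
apply/ler_addgt0Pl => e e0; rewrite addr0.
have e20 : 0 < e / 2 by rewrite divr_gt0.
have [phi [tphi h1 h2]] := approx_bmeas (distribution mu shift_mfun) mu bu e20.
have bphi := test_bmeas tphi.
have ephi : Ex (distribution mu shift_mfun) phi = E phi.
  by rewrite Ex_distribution // (Ex_shift_cts (test_continuous tphi) bphi).
set E2 := Ex _ in h1 ephi *.
have -> : E2 u - E u = (E2 u - E2 phi) - (E u - E phi) by rewrite ephi; ring.
rewrite [leRHS]splitr; apply: le_trans (ler_normB _ _) _.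
have k1 : `|E2 u - E2 phi| <= e / 2.
  by rewrite -ExB //; apply: le_trans h1; apply: ler_norm_Ex; exact: bmeasB.
have k2 : `|E u - E phi| <= e / 2.
  by rewrite -ExB //; apply: le_trans h2; apply: ler_norm_Ex; exact: bmeasB.
exact: lerD.
Qed.

Lemma Ex_iter n (u : borel R -> R) : bmeas u -> E (fun y => u (iter n T y)) = E u.
Proof. exact: (Ex_iterS (@shift_measurable R) Ex_shift). Qed.

End System.
End Averages.

(** * Eigenfunctions *)

Section ComplexFunctions.
Context {d : measure_display} {T : measurableType d} {R : realType}.
Implicit Types (g : T -> R[i]).

Definition cmeas g := bmeas (fun x => complex.Re (g x)) /\ bmeas (fun x => complex.Im (g x)).

Lemma cmeas_cst c : cmeas (fun=> c).
Proof. by split; exact: bmeas_cst. Qed.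

Lemma cmeasM g g' : cmeas g -> cmeas g' -> cmeas (fun x => g x * g' x).
Proof.
move=> [r i] [r' i']; split.
  under eq_fun do rewrite complexReM; by apply: bmeasB; exact: bmeasM.
by under eq_fun do rewrite complexImM; apply: bmeasD; exact: bmeasM.
Qed.

Lemma cmeasB g g' : cmeas g -> cmeas g' -> cmeas (fun x => g x - g' x).
Proof.
move=> [r i] [r' i']; split.
  by under eq_fun do rewrite ReB; exact: bmeasB.
by under eq_fun do rewrite ImB; exact: bmeasB.
Qed.

Lemma cmeasX g n : cmeas g -> cmeas (fun x => g x ^+ n).
Proof.
move=> hg; elim: n => [|n IH].
  by under eq_fun do rewrite expr0; exact: cmeas_cst.
by under eq_fun do rewrite exprS; exact: cmeasM.
Qed.

Lemma cmeas_comp (S : T -> T) g : measurable_fun setT S -> cmeas g -> cmeas (fun x => g (S x)).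
Proof. by move=> mS [r i]; split; [exact: (bmeas_comp mS r) | exact: (bmeas_comp mS i)]. Qed.

Lemma cmeas_real (u : T -> R) : bmeas u -> cmeas (fun x => (u x)%:C%C).
Proof. by move=> bu; split=> //=; exact: bmeas_cst. Qed.

End ComplexFunctions.

Section Eigenfunctions.
Context {d : measure_display} {T : measurableType d} {R : realType}.
Variable P : probability T R.
Variable S : T -> T.
Hypothesis mS : measurable_fun setT S.
Hypothesis invS : forall u, bmeas u -> Ex P (fun x => u (S x)) = Ex P u.
Implicit Types (g : T -> R[i]).

Lemma ae_shift (Q : T -> Prop) : {ae P, forall x, Q x} -> {ae P, forall x, Q (S x)}.
Proof.
move=> [A [mA PA0 QA]].
have mSA : measurable (S @^-1` A) by rewrite -[X in measurable X]setTI; exact: mS.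
exists (S @^-1` A); split => //; last by move=> x /= h; apply: QA.
have := invS (bmeas_indic mA).
have -> : (fun x => \1_A (S x) : R) = \1_(S @^-1` A) by [].
rewrite (Ex_indic P mA) (Ex_indic P mSA) PA0 => h.
by rewrite -(@fineK _ (P (S @^-1` A))) ?fin_num_measure // h.
Qed.

Lemma ae_iter (Q : T -> Prop) n : {ae P, forall x, Q x} -> {ae P, forall x, Q (iter n S x)}.
Proof.
move=> hQ; elim: n => // n IH.
by have := ae_shift IH; apply: filterS => x; rewrite -iterSr.
Qed.

Lemma period_multiple Q k (h : T -> R) :
  {ae P, forall x, h (iter Q S x) = h x} ->
  {ae P, forall x, h (iter (k * Q) S x) = h x}.
Proof.
move=> hQ; elim: k => [|k IH]; first exact: nearW.
have hk := ae_iter (k * Q) hQ; apply: filterS2 IH hk => x IH.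
by rewrite -iterD -mulSn IH.
Qed.

Lemma ae_eigen_iter (z : R[i]) g n : {ae P, forall x, g (S x) = z * g x} ->
  {ae P, forall x, g (iter n S x) = z ^+ n * g x}.
Proof.
move=> eg; elim: n => [|n IH]; first by apply: nearW => x; rewrite expr0 mul1r.
have hn := ae_iter n eg; apply: filterS2 IH hn => x IH.
by rewrite /= => ->; rewrite IH exprS mulrA.
Qed.

Definition eigen (z : R[i]) g := [/\ cmeas g, ~ {ae P, forall x, g x = 0} &
  {ae P, forall x, g (S x) = z * g x}].

Lemma eigenX z g k : eigen z g -> eigen (z ^+ k) (fun x => g x ^+ k).
Proof.
move=> [hg nz eg]; split; first exact: cmeasX.
  move=> h; apply: nz; apply: filterS h => x /eqP; case: k => [|k]; first by rewrite expr0 oner_eq0.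
  by rewrite expf_eq0 => /andP[_ /eqP].
by apply: filterS eg => x ->; rewrite exprMn.
Qed.

(** The product of the operators g |-> g o S - z g over the z in s. *)
Fixpoint chain (s : seq R[i]) g : T -> R[i] :=
  if s is z :: s' then chain s' (fun x => g (S x) - z * g x) else g.

(** The last function of the chain that is not null is an eigenfunction. *)
Lemma chain_eigen (s : seq R[i]) g : cmeas g -> ~ {ae P, forall x, g x = 0} ->
  {ae P, forall x, chain s g x = 0} -> exists z g', z \in s /\ eigen z g'.
Proof.
elim: s g => [|z s IH] g hg nz /= hs; first by exfalso.
pose g1 x := g (S x) - z * g x.
have hg1 : cmeas g1.
  by apply: cmeasB; [exact: cmeas_comp | apply: cmeasM => //; exact: cmeas_cst].
have [h0|h0] := pselect {ae P, forall x, g1 x = 0}.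
  exists z, g; split; first exact: mem_head.
  split=> //; apply: filterS h0 => x /eqP; rewrite subr_eq0 => /eqP //.
have [z' [g' [z's eg']]] := IH g1 hg1 h0 hs.
by exists z', g'; split => //; rewrite inE z's orbT.
Qed.

(** The polynomial p in the operator g |-> g o S. *)
Definition act (p : {poly R[i]}) g x := \sum_(i < size p) p`_i * g (iter i S x).

Lemma act_bound n (p : {poly R[i]}) g x : (size p <= n)%N ->
  act p g x = \sum_(i < n) p`_i * g (iter i S x).
Proof.
move=> pn; rewrite /act -(big_mkord xpredT (fun i => p`_i * g (iter i S x))).
rewrite -(big_mkord xpredT (fun i => p`_i * g (iter i S x))) [RHS](@big_cat_nat _ _ _ (size p)) //=.
rewrite [X in _ = _ + X]big1_seq ?addr0 // => i /andP[_]; rewrite mem_index_iota => /andP[h _].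
by rewrite nth_default ?mul0r.
Qed.

Lemma actD (p r : {poly R[i]}) g x : act (p + r) g x = act p g x + act r g x.
Proof.
pose n := maxn (size p) (size r).
rewrite (@act_bound n) ?size_polyD // (@act_bound n p) ?leq_maxl // (@act_bound n r) ?leq_maxr //.
by rewrite -big_split; apply: eq_bigr => i _; rewrite coefD mulrDl.
Qed.

Lemma actXn n g x : act 'X^n g x = g (iter n S x).
Proof.
rewrite /act size_polyXn big_ord_recr /= coefXn eqxx mul1r big1 ?add0r // => i _.
by rewrite coefXn ltn_eqF // mul0r.
Qed.

Lemma act0 g x : act 0 g x = 0. Proof. by rewrite /act size_poly0 big_ord0. Qed.

Lemma act_factor (p : {poly R[i]}) z g x :
  act (('X - z%:P) * p) g x = act p (fun y => g (S y) - z * g y) x.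
Proof.
pose n := (size p).+1.
have sn : (size (('X - z%:P) * p)%R <= n)%N.
  by apply: leq_trans (size_polyMleq _ _) _; rewrite size_XsubC.
rewrite (act_bound g x sn) (@act_bound n p) //.
rewrite (eq_bigr (fun i : 'I_n =>
  ('X * p : {poly R[i]})`_i * g (iter i S x) - z * p`_i * g (iter i S x))); last first.
  by move=> i _; rewrite mulrBl coefB coefCM mulrBl.
rewrite sumrB [X in X - _]big_ord_recl coefXM eqxx mul0r add0r.
rewrite [in RHS]big_ord_recr /= [p`_(size p)]nth_default // mul0r addr0.
rewrite [X in _ - X]big_ord_recr /= [p`_(size p)]nth_default // mulr0 mul0r addr0 -sumrB.
apply: eq_bigr => i _; rewrite /bump /= add1n coefXM /= mulrBr mulrA -[in RHS]iterS.
by rewrite /= [z * _]mulrC; ring.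
Qed.

Lemma chain_act s g x : chain s g x = act (\prod_(z <- s) ('X - z%:P)) g x.
Proof.
elim: s g => [|z s IH] g /=.
  by rewrite big_nil -[1](expr0 'X) actXn.
by rewrite big_cons act_factor -IH.
Qed.

(** Let g = h o S^V - h. The polynomial 1 + X^V + ... + X^((p-1)V) maps g to
    h o S^(pV) - h = 0. It splits over C, so that one of its roots z is an eigenvalue, and
    z^V is a root of 1 + Y + ... + Y^(p-1). *)
Lemma eigen_of_period (h : T -> R) (p V : nat) : (0 < V)%N -> (0 < p)%N -> bmeas h ->
  {ae P, forall x, h (iter (p * V) S x) = h x} ->
  ~ {ae P, forall x, h (iter V S x) = h x} ->
  exists z g, [/\ eigen z g, (z ^+ V) ^+ p = 1 & z ^+ V != 1].
Proof.
move=> V0 p0 bh hp hV.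
pose Q : {poly R[i]} := \sum_(j < p) 'X^(j * V).
have mi n : measurable_fun setT (iter n S).
  elim: n => [|n IH]; first exact: measurable_id.
  exact: (measurableT_comp mS IH).
pose g x : R[i] := (h (iter V S x) - h x)%:C%C.
have hg : cmeas g.
  by apply: cmeas_real; apply: bmeasB => //; exact: (bmeas_comp (mi V)).
have gnz : ~ {ae P, forall x, g x = 0}.
  move=> h0; apply: hV; apply: filterS h0 => x /(congr1 (@complex.Re R)) /= /eqP.
  by rewrite subr_eq0 => /eqP.
have actQ x : act Q g x = (h (iter (p * V) S x) - h x)%:C%C.
  rewrite /Q; elim: (p) => [|k IH]; first by rewrite big_ord0 act0 mul0n subrr.
  rewrite big_ord_recr actD IH actXn /g -rmorphD /= -iterD; congr (_%:C%C).
  by rewrite mulSn addrC subrKA.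
have Q0 : Q != 0.
  apply/eqP => Qz; have : Q`_0 = 0 by rewrite Qz coef0.
  rewrite coef_sum; case: (p) p0 => // k _; rewrite big_ord_recl mul0n expr0 coef1 eqxx /=.
  rewrite big1 ?addr0 => [/eqP|i _]; first by rewrite oner_eq0.
  by rewrite coefXn; case: eqP => //; rewrite /bump /=; nia.
have [s Qs] := closed_field_poly_normal Q.
have lc : lead_coef Q != 0 by rewrite lead_coef_eq0.
have chain0 : {ae P, forall x, chain s g x = 0}.
  apply: filterS hp => x hx.
  have : act Q g x = 0 by rewrite actQ hx subrr.
  rewrite Qs => ha; rewrite chain_act; apply: (mulfI lc); rewrite mulr0 -{}ha.
  rewrite /act size_scale // big_distrr /=; apply: eq_bigr => i _.
  by rewrite coefZ mulrA.
have [z [g' [zs eg']]] := chain_eigen hg gnz chain0.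
exists z, g'.
have root : \sum_(j < p) (z ^+ V) ^+ j = 0.
  have : Q.[z] = 0.
    have /rootP r0 : root (\prod_(y <- s) ('X - y%:P)) z by rewrite root_prod_XsubC.
    by rewrite Qs hornerZ r0 mulr0.
  rewrite (_ : Q.[z] = \sum_(j < p) (z ^+ V) ^+ j) // /Q horner_sum; apply: eq_bigr => j _.
  by rewrite hornerXn mulnC exprM.
split => //.
  apply/eqP; rewrite -subr_eq0; have := subrX1 (z ^+ V) p => ->.
  by rewrite root mulr0.
apply/eqP => z1; move: root; rewrite z1 (eq_bigr (fun=> 1)); last by move=> j _; rewrite expr1n.
by rewrite sumr_const card_ord => /eqP; rewrite pnatr_eq0; case: (p) p0.
Qed.


Lemma damp_measurable : measurable_fun setT (fun y : R => (1 + `|y|)^-1).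
Proof.
apply: continuous_measurable_fun => y.
apply: (@cvgV _ _ (nbhs y) _ (fun y : R => 1 + `|y|)).
  by rewrite gt_eqF // ltr_pwDl.
by apply: cvgD; [exact: cvg_cst | apply: cvg_norm; exact: cvg_id].
Qed.

(** Divide g by 1 + |g|^2, which is invariant as |z| = 1. *)
Lemma bounded_eigen z g : measurable_fun setT (fun x => complex.Re (g x)) ->
  measurable_fun setT (fun x => complex.Im (g x)) ->
  normc z = 1 -> ~ {ae P, forall x, g x = 0} ->
  {ae P, forall x, g (S x) = z * g x} -> exists g', eigen z g'.
Proof.
move=> mr mi z1 nz eg.
pose s x := complex.Re (g x) ^+ 2 + complex.Im (g x) ^+ 2.
pose r x := (1 + `|s x|)^-1.
have s0 x : 0 <= s x by rewrite addr_ge0 ?sqr_ge0.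
have sE x : s x = normc (g x) ^+ 2 by rewrite /s normc_sqr.
have r0 x : 0 < r x by rewrite invr_gt0 ltr_pwDl.
have mr' : measurable_fun setT r.
  apply: (measurableT_comp damp_measurable).
  by apply: measurable_funD; exact: measurable_funX.
have rb a x : a ^+ 2 <= s x -> `|a * r x| <= 1.
  move=> h; rewrite normrM (gtr0_norm (r0 x)) ler_pdivrMr ?ltr_pwDl // mul1r.
  rewrite (ger0_norm (s0 x)); have := normr_ge0 a.
  by move: h; rewrite -[a ^+ 2]real_normK ?num_real //; move: `|a| (s x) => b t; nra.
exists (fun x => g x * (r x)%:C%C); split.
- split; split; [| exists 1 => x | | exists 1 => x].
  + under eq_fun do rewrite complexReM /= mulr0 subr0; exact: measurable_funM.
  + by rewrite complexReM /= mulr0 subr0; apply: rb; rewrite lerDl sqr_ge0.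
  + under eq_fun do rewrite complexImM /= mulr0 add0r; exact: measurable_funM.
  + by rewrite complexImM /= mulr0 add0r; apply: rb; rewrite lerDr sqr_ge0.
- move=> h; apply: nz; apply: filterS h => x /eqP; rewrite mulf_eq0 => /orP[/eqP //|].
  by move=> /eqP /(congr1 (@complex.Re R)) /= rx; have := r0 x; rewrite rx ltxx.
apply: filterS eg => x e; rewrite e mulrA; congr (_ * (_)%:C%C).
by rewrite /r !sE e normcM z1 mul1r.
Qed.

(** For an eigenfunction, g o S^n - g = (z^n - 1) g almost everywhere. *)
Lemma eigen_displacement z g n (u : T -> R) : cmeas g -> bmeas u ->
  (forall x, `|u x| <= normc (g x)) -> {ae P, forall x, g (S x) = z * g x} ->
  normc (z ^+ n - 1) * Ex P (fun x => `|u x|) <=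
  Ex P (fun x => `|complex.Re (g (iter n S x)) - complex.Re (g x)|) +
  Ex P (fun x => `|complex.Im (g (iter n S x)) - complex.Im (g x)|).
Proof.
move=> [bR bI] bu ug eg.
have bd (v : T -> R) : bmeas v -> bmeas (fun x => `|v (iter n S x) - v x|).
  by move=> bv; apply: bmeas_norm; apply: bmeasB => //; exact: bmeas_iterS.
have b1 := bmeasD (bd _ bR) (bd _ bI).
rewrite -(ExD P (bd _ bR) (bd _ bI)) -(ExZ P _ (bmeas_norm bu)).
have b2 := bmeasZ (normc (z ^+ n - 1)) (bmeas_norm bu).
have bm := bmeas_max b1 b2.
rewrite [leRHS](Ex_ae_eq b1 bm); first by apply: le_Ex => // x; rewrite le_max lexx orbT.
apply: filterS (ae_eigen_iter n eg) => x e; apply/esym/max_idPl.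
apply: le_trans (ler_wpM2l (normc_ge0 _) (ug x)) _.
rewrite -normcM mulrBl mul1r -e -ReB -ImB.
exact: ler_normc_ReIm.
Qed.

End Eigenfunctions.

(** * The eigenvalue 1/p *)

Section RootsOfUnity.
Variable R : realType.

Lemma cis2piE (t : R) : cis2pi t = expi (2 * pi * t).
Proof. by []. Qed.

Lemma expiX (x : R) n : expi x ^+ n = expi (n%:R * x).
Proof.
elim: n => [|n IH]; first by rewrite mul0r expi0.
by rewrite exprS IH -expiD mulr_natl mulr_natl mulrS.
Qed.

Lemma cis2pi_unity p : (0 < p)%N -> cis2pi (p%:R^-1 : R) ^+ p = 1.
Proof.
move=> p0; rewrite cis2piE expiX (_ : p%:R * _ = pi *+ 2).
  by rewrite /expi cos2pi sin2pi.
by rewrite mulrC divfK ?pnatr_eq0 -?lt0n // mulr_natl.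
Qed.

Lemma cis2pi_neq1 p : prime p -> cis2pi (p%:R^-1 : R) != 1.
Proof.
move=> pp; have p2 : 2 <= p%:R :> R by rewrite (ler_nat R 2) prime_gt1.
have p0 : 0 < p%:R :> R by apply: lt_le_trans p2.
apply/eqP => e1.
have c1 : cos (2 * pi / p%:R) = cos 0 :> R by rewrite cos0 -[RHS]/(complex.Re (1 : R[i])) -e1.
have pi0 := @pi_gt0 R.
have h0 : 0 < 2 * pi / p%:R :> R by rewrite divr_gt0 // mulr_gt0.
have h1 : 2 * pi / p%:R = 0 :> R; last by rewrite h1 ltxx in h0.
apply: cos_inj c1; rewrite in_itv /= ?lexx ltW //= ler_pdivrMr // mulrC.
by rewrite ler_pM2l.
Qed.

(** z is a primitive p-th root of unity, whose powers are all the p-th roots of unity. *)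
Lemma cis2pi_power p (z : R[i]) : prime p -> z ^+ p = 1 -> z != 1 ->
  exists k, cis2pi (p%:R^-1 : R) = z ^+ k.
Proof.
move=> pp zp z1; have p0 := prime_gt0 pp.
have [m hm mp] := prim_order_exists p0 zp.
have pz : p.-primitive_root z.
  have /primeP[_ /(_ m mp) /orP[/eqP m1|/eqP <- //]] := pp.
  by have /eqP := prim_expr_order hm; rewrite m1 expr1 (negPf z1).
have [i ->] := prim_rootP pz (cis2pi_unity p0).
by exists i.
Qed.

End RootsOfUnity.

Section Spectrum.
Variable R : realType.
Variable mu : probability (borel R) R.
Notation T := (@left_shift R).
Notation mT := (@shift_measurable R).
Hypothesis invT : forall u : borel R -> R, bmeas u -> Ex mu (fun x => u (T x)) = Ex mu u.
Local Notation E := (Ex mu).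

Lemma cmeas_square_integrable (g : borel R -> R[i]) : cmeas g -> square_integrable mu g.
Proof.
move=> [r i]; split; [exact: r.1|exact: i.1|].
have bs : bmeas (fun x => normc (g x) ^+ 2).
  under eq_fun do rewrite normc_sqr; by apply: bmeasD; exact: bmeas_sqr.
have := integrable_fin_num measurableT (bmeas_integrable mu bs).
by rewrite ge0_fin_numE //; apply: integral_ge0 => x _; rewrite lee_fin sqr_ge0.
Qed.

Lemma spectrum_eigen p (z : R[i]) g : prime p -> eigen mu T z g ->
  cis2pi (p%:R^-1 : R) = z -> spectrum mu p%:R^-1.
Proof.
move=> pp [hg nz eg] hz; split.
  by rewrite invr_ge0 ler0n /= invf_lt1 ?ltr0n ?prime_gt0 // ltr1n prime_gt1.
by exists g; split => //; [exact: cmeas_square_integrable | rewrite hz].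
Qed.

(** An eigenvalue z with z^V of order p has a power equal to e(1/p), and the same power
    of its eigenfunction does not vanish. *)
Lemma period_drop p V (h : borel R -> R) : prime p -> (0 < V)%N -> bmeas h ->
  ~ spectrum mu p%:R^-1 ->
  {ae mu, forall x, h (iter (p * V) T x) = h x} ->
  {ae mu, forall x, h (iter V T x) = h x}.
Proof.
move=> pp V0 bh nsp hp; apply: contra_notP nsp => nV.
have [z [g [eg zp z1]]] := eigen_of_period mT V0 (prime_gt0 pp) bh hp nV.
have [k hk] := cis2pi_power pp zp z1.
by apply: (spectrum_eigen pp (eigenX (V * k) eg)); rewrite hk exprM.
Qed.

Lemma period_dropX p b Q (h : borel R -> R) : prime p -> (0 < Q)%N -> bmeas h ->
  ~ spectrum mu p%:R^-1 ->
  {ae mu, forall x, h (iter (p ^ b * Q) T x) = h x} ->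
  {ae mu, forall x, h (iter Q T x) = h x}.
Proof.
move=> pp Q0 bh nsp; elim: b => [|b IH]; first by rewrite mul1n.
rewrite expnS -mulnA => /period_drop H; apply/IH/H => //.
by rewrite muln_gt0 expn_gt0 prime_gt0.
Qed.

End Spectrum.

(** * Displacement under powers of the shift *)

Section NearPeriods.
Variable R : realType.
Variable mu : probability (borel R) R.
Notation T := (@left_shift R).
Notation mT := (@shift_measurable R).
Hypothesis invT : forall u : borel R -> R, bmeas u -> Ex mu (fun x => u (T x)) = Ex mu u.
Implicit Types (u v : borel R -> R).

Definition displacement n u := Ex mu (fun x => `|u (iter n T x) - u x|).

Lemma displacement_bmeas n u : bmeas u -> bmeas (fun x : borel R => `|u (iter n T x) - u x|).
Proof.
move=> bu; apply: bmeas_norm; apply: bmeasB => //.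
exact: (bmeas_comp (@iter_shift_measurable R n) bu).
Qed.

Lemma displacement_shift n m u : bmeas u ->
  displacement n (fun x => u (iter m T x)) = displacement n u.
Proof.
move=> bu; rewrite -[RHS](Ex_iterS mT invT m (displacement_bmeas n bu)).
by congr Ex; apply/funext => x; rewrite -!iterD addnC.
Qed.

(** By invariance all the coordinates are displaced as much as the coordinate 0. *)
Lemma displacement_coord n (c : int -> borel R -> R) :
  (forall k, bmeas (c k)) -> (forall k m x, c k (iter m T x) = c (k + m%:Z) x) ->
  forall k, displacement n (c k) = displacement n (c 0).
Proof.
move=> bc cE [k|k].
  rewrite -(displacement_shift n k (bc 0)); congr displacement; apply/funext => x.
  by rewrite cE add0r.
rewrite -(displacement_shift n k.+1 (bc (Negz k))); congr displacement; apply/funext => x.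
by rewrite cE NegzE addNr.
Qed.

Lemma displacement_test u : test u -> exists2 L : R, 0 <= L & forall n d,
  displacement n (reC 0) <= d -> displacement n (imC 0) <= d -> displacement n u <= L * d.
Proof.
have bR k : bmeas (reC k : borel R -> R) by apply: test_bmeas; exact: test_re.
have bI k : bmeas (imC k : borel R -> R) by apply: test_bmeas; exact: test_im.
have bT v n : bmeas v -> bmeas (fun x : borel R => v (iter n T x)).
  exact: (bmeas_comp (@iter_shift_measurable R n)).
elim=> {u} [c|k|k|u v tu [L L0 hL] tv [M M0 hM]|c u tu [L L0 hL]|u v tu [L L0 hL] tv [M M0 hM]].
- exists 0 => // n d _ _; rewrite /displacement mul0r.
  by under eq_fun do rewrite subrr normr0; rewrite Ex_cst.
- exists 1 => // n d hr _; rewrite mul1r displacement_coord // => j m x.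
  by rewrite /reC iter_shiftE.
- exists 1 => // n d _ hi; rewrite mul1r displacement_coord // => j m x.
  by rewrite /imC iter_shiftE.
- exists (L + M); first exact: addr_ge0.
  move=> n d hr hi; rewrite mulrDl; apply: le_trans (lerD (hL n d hr hi) (hM n d hr hi)).
  have bu := test_bmeas tu; have bv := test_bmeas tv.
  have := Ex_dist_comb mu 1 1 (bT _ n bu) (bT _ n bv) bu bv.
  by rewrite normr1 !mul1r; under eq_fun do rewrite !mul1r.
- exists (`|c| * L); first exact: mulr_ge0.
  move=> n d hr hi; rewrite -mulrA; apply: le_trans (ler_wpM2l (normr_ge0 c) (hL n d hr hi)).
  rewrite /displacement -ExZ; last exact: displacement_bmeas (test_bmeas tu).
  by apply: ler_eq; congr Ex; apply/funext => x; rewrite -mulrBr normrM.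
exists (L + M); first exact: addr_ge0.
move=> n d hr hi; rewrite mulrDl; apply: le_trans (lerD (hL n d hr hi) (hM n d hr hi)).
have bu := test_bmeas tu; have bv := test_bmeas tv.
exact: (Ex_dist_max mu (bT _ n bu) (bT _ n bv) bu bv).
Qed.

Lemma displacement_approx u e : bmeas u -> 0 < e -> exists2 d : R, 0 < d & forall n,
  displacement n (reC 0) <= d -> displacement n (imC 0) <= d -> displacement n u <= e.
Proof.
move=> bu e0; have e4 : 0 < e / 4 by rewrite divr_gt0.
have [v [tv hv _]] := approx_bmeas mu mu bu e4.
have [L L0 hL] := displacement_test tv; have bv := test_bmeas tv.
exists (e / 2 / (L + 1)); first by rewrite !divr_gt0 // ltr_pwDr.
move=> n hr hi; have := hL n _ hr hi.
have bT (w : borel R -> R) : bmeas w -> bmeas (fun x : borel R => w (iter n T x)).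
  exact: (bmeas_comp (@iter_shift_measurable R n)).
have small : L * (e / 2 / (L + 1)) <= e / 2.
  rewrite mulrA ler_pdivrMr ?ltr_pwDr // mulrC.
  by rewrite ler_wpM2l ?lerDl // ltW ?divr_gt0.
move=> hd; have hd' := le_trans hd small.
apply: le_trans (Ex_dist_trans mu (bT _ bu) (bT _ bv) bu) _.
have t1 : Ex mu (fun x => `|u (iter n T x) - v (iter n T x)|) <= e / 4.
  by rewrite (Ex_iterS mT invT n (bmeas_norm (bmeasB bu bv))).
have t2 : Ex mu (fun x => `|v (iter n T x) - u x|) <= e / 2 + e / 4.
  apply: le_trans (Ex_dist_trans mu (bT _ bv) bv bu) _; apply: lerD => //.
  by under eq_fun do rewrite distrC.
by move: (Ex mu _) (Ex mu _) t1 t2 => a b t1 t2; lra.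
Qed.

(** An eigenfunction g for e(1/p) satisfies g o T^Q = e(1/p) g for Q = 1 mod p. If the
    displacement by T^Q of the coordinate 0, hence that of g, can be made small, then
    g = 0. *)
Lemma near_periods_no_eigenvalue p : prime p ->
  (forall d, 0 < d -> exists Q, [/\ Q = 1 %[mod p],
     displacement Q (reC 0) <= d & displacement Q (imC 0) <= d]) ->
  ~ spectrum mu p%:R^-1.
Proof.
move=> pp near [_ [g [[mr mi _] nz eg]]].
set c := cis2pi _ in eg; have c1 : normc c = 1 by rewrite /c cis2piE normc_expi.
have [g' [bg nz' eg']] := bounded_eigen mr mi c1 nz eg.
have kappa : 0 < normc (c - 1).
  rewrite lt_neqAle normc_ge0 andbT eq_sym; apply/eqP => /eq0_normc /eqP.
  by rewrite subr_eq0 (negPf (cis2pi_neq1 R pp)).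
have van u : bmeas u -> (forall x, `|u x| <= normc (g' x)) -> {ae mu, forall x, u x = 0}.
  move=> bu ug; have E0 : Ex mu (fun x => `|u x|) = 0.
    apply/eqP; rewrite eq_le Ex_ge0 // andbT.
    apply/ler_addgt0Pl => eps eps0; rewrite addr0.
    have e0 : 0 < normc (c - 1) * eps / 2 by rewrite divr_gt0 // mulr_gt0.
    have [d1 d10 h1] := displacement_approx bg.1 e0.
    have [d2 d20 h2] := displacement_approx bg.2 e0.
    have d0 : 0 < Num.min d1 d2 by rewrite lt_min d10 d20.
    have [Q [Q1 hr hi]] := near _ d0.
    have [hr1 hr2] : displacement Q (reC 0) <= d1 /\ displacement Q (reC 0) <= d2.
      by move: hr; rewrite le_min => /andP.
    have [hi1 hi2] : displacement Q (imC 0) <= d1 /\ displacement Q (imC 0) <= d2.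
      by move: hi; rewrite le_min => /andP.
    have cQ : c ^+ Q = c.
      have cp : c ^+ p = 1 by exact: cis2pi_unity (prime_gt0 pp).
      by rewrite -(expr_mod _ cp) Q1 (expr_mod _ cp) expr1.
    have := eigen_displacement mT invT Q bg bu ug eg'; rewrite cQ => h.
    rewrite -(ler_pM2l kappa); apply: le_trans h _.
    have := h1 Q hr1 hi1; have := h2 Q hr2 hi2; rewrite /displacement.
    by move: (Ex mu _) (Ex mu _) => a b; lra.
  have := Ex_ae_eq0 (bmeas_norm bu) (fun x => normr_ge0 _) E0.
  by apply: filterS => x /normr0_eq0.
apply: nz'.
have hR := van _ bg.1 (fun x => ler_Re_normc _); have hI := van _ bg.2 (fun x => ler_Im_normc _).
move: hR hI; apply: filterS2 => x; case: (g' x) => a b /= -> ->.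
by [].
Qed.

End NearPeriods.

(** * The two implications *)

Section TestClosure.
Variable R : realType.
Notation T := (@left_shift R).
Implicit Types (u v : borel R -> R).

Lemma test_sum I (r : seq I) (F : I -> borel R -> R) : (forall i, test (F i)) ->
  test (fun x => \sum_(i <- r) F i x).
Proof.
move=> tF; elim: r => [|i r IH].
  rewrite (_ : (fun x => _) = fun=> 0); first exact: test_cst.
  by apply/funext => x; rewrite big_nil.
rewrite (_ : (fun x => _) = (fun x => F i x + \sum_(j <- r) F j x)); first exact: testD.
by apply/funext => x; rewrite big_cons.
Qed.

(** |a - b| is the maximum of a - b and b - a. *)
Lemma test_dist u v : test u -> test v -> test (fun x => `|u x - v x|).
Proof.
move=> tu tv.
have tB a b : test a -> test b -> test (fun x : borel R => a x + -1 * b x).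
  by move=> ta tb; apply: testD ta (testZ (-1) tb).
rewrite (_ : (fun x => _) = (fun x => Num.max (u x + -1 * v x) (v x + -1 * u x))).
  by apply: test_max; exact: tB.
apply/funext => x; rewrite !mulN1r; have [h|h] := leP (u x) (v x).
  by rewrite ler0_norm ?subr_le0 // opprB; apply/esym/max_idPr; lra.
by rewrite gtr0_norm ?subr_gt0 //; apply/esym/max_idPl; lra.
Qed.

Lemma test_iter n u : test u -> test (fun x => u (iter n T x)).
Proof.
elim=> {u} [c|k|k|u v _ hu _ hv|c u _ hu|u v _ hu _ hv].
- exact: test_cst.
- rewrite (_ : (fun x => _) = reC (k + n%:Z)); first exact: test_re.
  by apply/funext => x; rewrite /reC iter_shiftE.
- rewrite (_ : (fun x => _) = imC (k + n%:Z)); first exact: test_im.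
  by apply/funext => x; rewrite /imC iter_shiftE.
- exact: testD hu hv.
- exact: testZ.
- exact: test_max hu hv.
Qed.

Lemma test_dyadic W j u : test u -> test (dyadic (iter W T : borel R -> borel R) j u).
Proof.
move=> tu; apply: testZ; apply: test_sum => m.
rewrite (_ : (fun x => _) = (fun x : borel R => u (iter (m * W) T x))); first exact: test_iter.
by apply/funext => x; rewrite iterM.
Qed.

End TestClosure.

Section Main.
Variable R : realType.
Variables (av : averaging) (mu : probability (borel R) R).
Variables (N : nat -> nat) (x : shift_space R) (f : nat -> R[i]).
Hypotheses (N0 : forall k, (0 < N k)%N) (Ninc : forall j k, (j < k)%N -> (N j < N k)%N).
Hypothesis hlim : weak_star_limit
      (fun k => average_measure av (N k)
         (fun n => dirac (iter n (@left_shift R) x : borel R))) mu.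
Hypothesis xf : forall n, (0 < n)%N -> (x n%:Z : R[i]) = f n.
Notation T := (@left_shift R).
Local Notation E := (Ex mu).
Let invT := Ex_shift N0 Ninc hlim.

Let re_orbit n : (0 < n)%N -> reC 0 (iter n T x) = complex.Re (f n).
Proof. by move=> n0; rewrite /reC iter_shiftE add0r xf. Qed.

Let im_orbit n : (0 < n)%N -> imC 0 (iter n T x) = complex.Im (f n).
Proof. by move=> n0; rewrite /imC iter_shiftE add0r xf. Qed.

Lemma displacement_ub (c : borel R -> R) (part : R[i] -> R) Q e : test c ->
  (forall n, (0 < n)%N -> c (iter n T x) = part (f n)) ->
  (forall z w, `|part z - part w| <= normc (z - w)) ->
  ubmean (fun n => normc (f (n + Q)%N - f n)) e -> displacement mu Q c <= e.
Proof.
move=> tc cf hpart ha.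
have tD : test (fun y => `|c (iter Q T y) - c y|) by apply: test_dist => //; exact: test_iter.
have := Ex_le_ub Ninc hlim (test_continuous tD) (fun=> normr_ge0 _) _ ha; apply=> n n0.
by rewrite -iterD addnC !cf ?addn_gt0 ?n0 ?orbT.
Qed.

Lemma almost_periods_no_eigenvalue p : prime p ->
  (forall e : R, 0 < e -> exists2 Q, Q = 1 %[mod p] &
     ubmean (fun n => normc (f (n + Q)%N - f n)) e) -> ~ spectrum mu p%:R^-1.
Proof.
move=> pp h; apply: (near_periods_no_eigenvalue invT pp) => d d0.
have [Q Q1 hQ] := h d d0; exists Q; split => //.
  apply: (@displacement_ub _ (@complex.Re R) _ _ (test_re R 0) re_orbit (@Re_lipschitz R) hQ).
apply: (@displacement_ub _ (@complex.Im R) _ _ (test_im R 0) im_orbit (@Im_lipschitz R) hQ).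
Qed.

(** The averages of c over T^(p^b Q) tend to a function fixed by this power. If 1/p is
    not in the spectrum, it is fixed by T^Q as well, hence by T^(kQ), and the averages
    are nearly so. *)
Lemma dyadic_period p Q b k (c : borel R -> R) e : prime p -> (0 < Q)%N -> bmeas c -> 0 < e ->
  ~ spectrum mu p%:R^-1 -> exists J, forall j, (J <= j)%N ->
    displacement mu (k * Q) (dyadic (iter (p ^ b * Q) T : borel R -> borel R) j c) <= e.
Proof.
move=> pp Q0 bc e0 nsp.
set S : borel R -> borel R := iter (p ^ b * Q) T.
have mS : measurable_fun setT S by exact: iter_shift_measurable.
have invS (u : borel R -> R) : bmeas u -> E (fun y => u (S y)) = E u.
  exact: (Ex_iter N0 Ninc hlim).
have [h [bh hS hj]] := mean_ergodic mS invS bc.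
have hQ := period_multiple (@shift_measurable R) invT k (period_dropX pp Q0 bh nsp hS).
have e2 : 0 < e / 2 by rewrite divr_gt0.
have [J hJ] := hj _ e2; exists J => j Jj; have {}hJ := hJ j Jj.
have bD : bmeas (dyadic S j c) by exact: bmeas_dyadic.
have bT (u : borel R -> R) : bmeas u -> bmeas (fun y : borel R => u (iter (k * Q) T y)).
  exact: (bmeas_comp (@iter_shift_measurable R (k * Q))).
apply: le_trans (Ex_dist_trans mu (bT _ bD) (bT _ bh) bD) _.
rewrite [leRHS]splitr; apply: lerD.
  rewrite (Ex_iterS (@shift_measurable R) invT (k * Q) (bmeas_norm (bmeasB bD bh))).
  by under eq_fun do rewrite distrC.
rewrite (@Ex_ae_eq _ _ _ mu _ (fun y => `|h y - dyadic S j c y|)) //.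
- by apply: bmeas_norm; apply: bmeasB => //; exact: bT.
- by apply: bmeas_norm; exact: bmeasB.
by apply: filterS hQ => y ->.
Qed.

Lemma block_dyadic W j n : (0 < n)%N ->
  complex.Re (block f (2 ^ j) W n) = dyadic (iter W T : borel R -> borel R) j (reC 0) (iter n T x) /\
  complex.Im (block f (2 ^ j) W n) = dyadic (iter W T : borel R -> borel R) j (imC 0) (iter n T x).
Proof.
move=> n0; rewrite /block /dyadic complexReM complexImM /= !mul0r subr0 addr0.
rewrite (raddf_sum (@complex.Re R)) (raddf_sum (@complex.Im R)) /=.
split; congr (_ * _); apply: eq_bigr => m _; rewrite -iterM -iterD.
  by rewrite re_orbit ?addn_gt0 ?n0 ?orbT // addnC mulnC.
by rewrite im_orbit ?addn_gt0 ?n0 ?orbT // addnC mulnC.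
Qed.

(** If 1/p is not in the spectrum, long averages of the coordinate 0 over T^(p^b Q) are
    nearly fixed by T^(kQ). Along the orbit of x these averages are blocks of f, which
    [block_gap] keeps apart. *)
Lemma separated_eigenvalue p delta : prime p -> 0 < delta ->
  (forall eps, 0 < eps -> separates f p delta eps) -> spectrum mu p%:R^-1.
Proof.
move=> pp d0 hsep; apply: contrapT => nsp.
have eps0 : 0 < delta / 4 by rewrite divr_gt0.
have [Q [b [k [Q0 hgap]]]] := block_gap (prime_gt0 pp) d0 (ltW eps0) (hsep _ eps0).
set W := (p ^ b * Q)%N in hgap.
have W0 : 0 < W%:R :> R by rewrite ltr0n muln_gt0 expn_gt0 prime_gt0.
have e0 : 0 < delta / (8 * W%:R) by rewrite divr_gt0 // mulr_gt0.
have [J1 hre] := @dyadic_period p Q b k _ _ pp Q0 (test_bmeas (test_re R 0)) e0 nsp.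
have [J2 him] := @dyadic_period p Q b k _ _ pp Q0 (test_bmeas (test_im R 0)) e0 nsp.
pose j := maxn J1 J2; have {}hre := hre j (leq_maxl _ _); have {}him := him j (leq_maxr _ _).
have M0 : (0 < 2 ^ j)%N by rewrite expn_gt0.
have [e ube he] := hgap _ M0.
pose D (c : borel R -> R) := dyadic (iter W T : borel R -> borel R) j c.
pose phi c (y : borel R) := `|D c (iter (k * Q) T y) - D c y|.
have tphi c : test c -> test (phi c).
  by move=> tc; apply: test_dist; [apply: test_iter|]; exact: test_dyadic.
have tPhi := testD (tphi _ (test_re R 0)) (tphi _ (test_im R 0)).
have := Ex_ge_ub N0 Ninc hlim (test_continuous tPhi) _ _ ube.
move=> /(_ (delta / W%:R) (fun y => addr_ge0 (normr_ge0 _) (normr_ge0 _))) H.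
have : delta / W%:R - 2 * (delta / 4) / W%:R <= delta / (8 * W%:R) + delta / (8 * W%:R).
  apply: le_trans (lerD hre him).
  rewrite -ExD; [|exact: test_bmeas (tphi _ (test_re R 0))|exact: test_bmeas (tphi _ (test_im R 0))].
  apply: H => n n0; apply: le_trans (he n) _; rewrite lerD2r.
  apply: le_trans (ler_normc_ReIm _) _; rewrite ReB ImB.
  have [r1 i1] := block_dyadic W j n0.
  have nk0 : (0 < n + k * Q)%N by rewrite addn_gt0 n0.
  have [r2 i2] := block_dyadic W j nk0.
  by rewrite r1 i1 r2 i2 /phi /D addnC !iterD.
have y0 : 0 < W%:R^-1 :> R by rewrite invr_gt0.
have dy0 : 0 < delta * W%:R^-1 by rewrite mulr_gt0.
by rewrite invfM => h; move: h dy0; move: (W%:R^-1) => y; lra.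
Qed.

End Main.

Theorem theorem2p11 (R : realType) (f : nat -> disc R) (t : R) (q : nat)
    (chi : nat -> R[i]) (av : averaging) (mu : probability (borel R) R)
    (hf : multiplicative_fun (fun n => f n : R[i]))
    (hchi : primitive_character q chi)
    (hfchi : pretends (fun n => f n : R[i]) (fun n => npow_it n t * chi n))
    (hmu : furstenberg_system av f mu)
    (p : nat) (hp : prime p) :
  spectrum mu (p%:R^-1) <->
  ((p %| q)%N \/
   exists2 s : nat, (0 < s)%N &
     (f (p ^ s)%N : R[i]) <> npow_it p (s%:R * t) * chi (p ^ s)%N).
Proof.
have fb n : normc (f n : R[i]) <= 1 by exact: disc_normc.
have [N [N0 Ninc [x xf hlim]]] := hmu.
have xf' n : (0 < n)%N -> (x n%:Z : R[i]) = f n by move=> n0; rewrite xf.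
split=> [sp|].
  apply: contrapT => /not_orP[/negP npq hs].
  have fps s : (0 < s)%N -> (f (p ^ s)%N : R[i]) = npow_it p (s%:R * t) * chi (p ^ s)%N.
    by move=> s0; apply: contrapT => ne; apply: hs; exists s.
  apply: (almost_periods_no_eigenvalue N0 Ninc hlim xf' hp _ sp) => e e0.
  exact: (almost_period fb hf hchi.1 hfchi hp npq fps e0).
have sep delta : 0 < delta -> (forall eps, 0 < eps -> separates (fun n => f n : R[i]) p delta eps) ->
    spectrum mu p%:R^-1.
  exact: (separated_eigenvalue N0 Ninc hlim xf' hp).
have [pq _|npq [//|[s s0 hs]]] := boolP (p %| q)%N.
  have [delta d0 h] := separates_at_conductor fb hf hchi.1 hfchi hchi hp pq.
  exact: sep d0 h.
have [delta d0 h] := separates_at_prime_power fb hf hchi.1 hfchi hp npq s0 hs.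
exact: sep d0 h.
Qed.
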